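(* (Quantum $q$-Krawtchouk.) Let $\overline x=x+\eta$ with $\eta\in\{0,+1,-1\}$ and $\overline{\boldsymbol\rho}=\overline\alpha,\overline N,q$. The whole list of non-trivial $A_2$-contiguity relations between $R_i(x;\boldsymbol\rho)=R^{(qqK)}_i(x;\boldsymbol\rho)$ and $R_i(\overline x;\overline{\boldsymbol\rho})$ is the following (in each case both the relation and its associated relation hold, with the given coefficients, determined up to rescaling): (qqKI) $\eta=0$, $\overline\alpha=q\alpha$, $\overline N=N$: $\lambda^+_{x,\boldsymbol\rho}=1$, $\Phi_i^{0,+}=q^{-i}$, $\Phi_i^{-1,+}=1-q^{-i}$, $\lambda^-_{x,\boldsymbol\rho}=q^{-N}-\alpha q^{1-x}$, $\Phi_i^{0,-}=q^{-i}-\alpha q$, $\Phi_i^{1,-}=q^{-N}-q^{-i}$. (qqKII) $\eta=0$, $\overline\alpha=q\alpha$, $\overline N=N-1$: $\lambda^+_{x,\boldsymbol\rho}=1$, $\Phi_i^{0,+}=\frac{1-q^{N-i}}{1-q^N}$, $\Phi_i^{-1,+}=\frac{1-q^{-i}}{1-q^{-N}}$, $\lambda^-_{x,\boldsymbol\rho}=\frac{\alpha q(1-q^{N-x})}{1-q^N}$, $\Phi_i^{0,-}=\alpha q-q^{-i}$, $\Phi_i^{1,-}=q^{-i}$. (qqKIII) $\eta=-1$, $\overline\alpha=\alpha$, $\overline N=N-1$: $\lambda^+_{x,\boldsymbol\rho}=1-q^N$, $\Phi_i^{0,+}=1-q^{N-i}$, $\Phi_i^{-1,+}=-q^N(1-q^{-i})(1-\alpha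 q^i)$, $\lambda^-_{x,\boldsymbol\rho}=\alpha q^{N+1}\frac{1-q^{-x}}{1-q^N}$, $\Phi_i^{0,-}=-q^{-i}$, $\Phi_i^{1,-}=q^{-i}$. Moreover, for $\overline N\in\{N,N-1,N+1,N-2,N+2\}$, all contiguity relations of type $B_2$ and all those of type $B'_2$ for the quantum $q$-Krawtchouk polynomials are obtained by applying $A_2$-contiguity relations twice.
   Context: Quantum $q$-Krawtchouk polynomials: for $\boldsymbol\rho=\alpha,N,q$, $N$ a non-negative integer, $i=0,\dots,N$, $$R^{(qqK)}_i(x;\boldsymbol\rho)={}_2\phi_1\left({q^{-i},\ q^{-x}\atop q^{-N}}\Big|\,q;\alpha q^{i+1}\right),$$ where ${}_{p+1}\phi_p\big({q^{-i},a_1,\dots,a_p\atop b_1,\dots,b_p}|q;z\big)=\sum_{k=0}^i\frac{(q^{-i},a_1,\dots,a_p;q)_k}{(q,b_1,\dots,b_p;q)_k}z^k$, $(b_1,\dots,b_p;q)_k=\prod_j(b_j;q)_k$, $(b;q)_k=\prod_{\ell=0}^{k-1}(1-bq^\ell)$. $R_i$ has degree $i$ in $\lambda_{x,\boldsymbol\rho}=-(1-q^{-x})$. Conventions. Parameters are generic. $\overline{\boldsymbol\rho}$ denotes modified parameters; one requires $\lambda_{x,\boldsymbol\rho}=\zeta\lambda_{\overline x,\overline{\boldsymbol\rho}}-\xi$ with constants $\zeta,\xi$, here $\zeta=q^\eta$, $\xi=1-q^\eta$. An $A_2$-contiguity relation is $$\lambda^+_{x,\boldsymbol\rho}R_i(x;\boldsymbol\rho)=\Phi^{0,+}_iR_i(\overline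 x;\overline{\boldsymbol\rho})+\Phi^{-1,+}_iR_{i-1}(\overline x;\overline{\boldsymbol\rho}),\quad i\ge0,\ \Phi^{-1,+}_0=0,\ \Phi^{0,+}_0\ne0,$$ and its associated relation is $$\lambda^-_{x,\boldsymbol\rho}R_i(\overline x;\overline{\boldsymbol\rho})=\Phi^{1,-}_iR_{i+1}(x;\boldsymbol\rho)+\Phi^{0,-}_iR_i(x;\boldsymbol\rho),\quad i\ge0,$$ with $\lambda^\pm$ independent of $i$ and $\Phi$'s independent of $x$ (terms with zero coefficient are omitted at the boundary of the index range). The trivial relation is $\eta=0$, $\overline{\boldsymbol\rho}=\boldsymbol\rho$. Contiguity relations of type $B_2$ (resp. $B'_2$) express $\lambda^+_{x,\boldsymbol\rho}R_i(x;\boldsymbol\rho)$ as a combination, with $x$-independent coefficients, of $R_{i+\epsilon}(\widetilde x;\widetilde{\boldsymbol\rho})$, $\epsilon\in\{1,0,-1\}$ (resp. $\epsilon\in\{0,-1,-2\}$); for these $\overline N$ denotes the integer parameter of the right-hand side polynomials. ''Applying $A_2$ relations twice'' means: for $B_2$, expand $R_i(x;\boldsymbol\rho)$ in $R_i,R_{i-1}$ at some $(\overline x,\overline{\boldsymbol\rho})$ by an $A_2$-contiguity relation and then expand these by the associated relation of an $A_2$-contiguity relation from $(\widetilde x,\widetilde{\boldsymbol\rho})$ to $(\overline x,\overline{\boldsymbol\rho})$; for $B'_2$, compose an $A_2$-contiguity relation from $(x,\boldsymbol\rho)$ to $(\overline x,\overline{\boldsymbol\rho})$ with one from $(\overline x,\overline{\boldsymbol\rho})$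 to $(\widetilde x,\widetilde{\boldsymbol\rho})$.
   Formalization: Completeness of the A2 list is for N ≥ 3 and the B2, B'2 claims for N ≥ 4 (false for smaller N); a B2 relation with target equal to source is a sum of two compositions of A2 relations; at boundary indices i the relations hold on the lattice of the right-hand family. *)

(* Defs.v *)
From HB Require Import structures.
From mathcomp Require Export all_boot all_order all_algebra.

Set Implicit Arguments.
Unset Strict Implicit.
Unset Printing Implicit Defensive.

Import Order.TTheory GRing.Theory Num.Theory.

Local Open Scope ring_scope.

Definition qpoch (F : fieldType) (q b : F) (k : nat) : F :=
  \prod_(l < k) (1 - b * q ^+ l).

Definition qpochs (F : fieldType) (q : F) (bs : seq F) (k : nat) : F :=
  \prod_(b <- bs) qpoch q b k.

(* The terminating series with upper parameters q^-i, a_1, ..., a_p and lower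
   parameters b_1, ..., b_p. *)
Definition qhyp (F : fieldType) (q : F) (i : nat) (a b : seq F) (z : F) : F :=
  \sum_(k < i.+1)
    qpochs q (q ^- i :: a) k / qpochs q (q :: b) k * z ^+ k.

(* Only meaningful for i <= N: beyond that (q^-N; q)_k vanishes.
   The variable x is an integer. As q is never a root of unity below, an
   identity between polynomials in q^-x that holds for all integers x is an
   identity of polynomials. *)
Definition qqK (F : fieldType) (q alpha : F) (N i : nat) (x : int) : F :=
  qhyp q i [:: q ^ (- x)] [:: q ^- N] (alpha * q ^+ i.+1).

Definition generic (F : fieldType) (q alpha : F) : Prop :=
  [/\ q != 0, (forall k : nat, (0 < k)%N -> q ^+ k != 1),
      alpha != 0 & (forall k : int, alpha != q ^ k)].

(* The polynomials R_i(x + eta; alpha, N, q), i = 0, ..., N.  The requirement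
   lambda_x = zeta lambda_(x + eta) - xi, where lambda_x = -(1 - q^-x),
   zeta = q^eta and xi = 1 - q^eta, holds for every integer eta. *)
Record family (F : Type) := Family { feta : int; falpha : F; fN : nat }.

Definition fpoly (F : fieldType) (q : F) (f : family F) (i : nat) (x : int) : F :=
  qqK q (falpha f) (fN f) i (x + feta f).

Definition in_range (F : Type) (g : family F) (j : int) : bool :=
  (0 <= j) && (j <= (fN g)%:Z).

(* lam(x) f_i(x) = \sum_(e in eps) Phi_i^e g_(i + e)(x) for all 0 <= i <= N_f.
   A term whose index lies outside 0, ..., N_g has coefficient zero and is
   omitted.  The equation is an identity of polynomials in q^-x, except for the
   last indices i, where some i + e exceeds N_g: there g_(i + e) would be a
   multiple of the polynomial vanishing on the lattice 0, ..., N_g, and the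
   equation is required on that lattice. *)
Definition contiguity (F : fieldType) (q : F) (eps : seq int) (f g : family F)
    (lam : int -> F) (Phi : int -> nat -> F) : Prop :=
  (forall (i : nat) (e : int), (i <= fN f)%N -> e \in eps ->
     ~~ in_range g (i%:Z + e) -> Phi e i = 0) /\
  (forall (i : nat) (x : int), (i <= fN f)%N ->
     (forall e, e \in eps -> i%:Z + e <= (fN g)%:Z) \/
       in_range g (x + feta g) ->
     lam x * fpoly q f i x =
       \sum_(e <- eps | in_range g (i%:Z + e))
          Phi e i * fpoly q g (absz (i%:Z + e)) x).

Definition epsA2 : seq int := [:: 0; -1].
Definition epsA2_assoc : seq int := [:: 1; 0].
Definition epsB2 : seq int := [:: 1; 0; -1].
Definition epsB2' : seq int := [:: 0; -1; -2].

Definition A2 (F : fieldType) (q : F) (f g : family F)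
    (lam : int -> F) (Phi : int -> nat -> F) : Prop :=
  [/\ feta g - feta f \in [:: 0; 1; -1],
      contiguity q epsA2 f g lam Phi & Phi 0 0%N != 0].

(* Associated to an A2 relation from f to g: it expands the g_i in the f_i. *)
Definition A2_assoc (F : fieldType) (q : F) (f g : family F)
    (lam : int -> F) (Phi : int -> nat -> F) : Prop :=
  contiguity q epsA2_assoc g f lam Phi /\ exists x, lam x != 0.

Definition B2 (F : fieldType) (q : F) (f g : family F)
    (lam : int -> F) (Phi : int -> nat -> F) : Prop :=
  contiguity q epsB2 f g lam Phi /\ exists x, lam x != 0.

Definition B2' (F : fieldType) (q : F) (f g : family F)
    (lam : int -> F) (Phi : int -> nat -> F) : Prop :=
  contiguity q epsB2' f g lam Phi /\ exists x, lam x != 0.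

Definition coefs (T : Type) (e0 : int) (c0 c1 : nat -> T) : int -> nat -> T :=
  fun e i => if e == e0 then c0 i else c1 i.

(* A2_list q alpha N g lamp Phip lamm Phim: an entry of the list, with target
   family g, and the data of the relation and of its associated relation. *)
Inductive A2_list (F : fieldType) (q alpha : F) (N : nat) :
    family F -> (int -> F) -> (int -> nat -> F) ->
    (int -> F) -> (int -> nat -> F) -> Prop :=
| qqKI :
    A2_list q alpha N (Family 0 (q * alpha) N)
      (fun _ => 1)
      (coefs 0 (fun i => q ^- i) (fun i => 1 - q ^- i))
      (fun x => q ^- N - alpha * q ^ (1 - x))
      (coefs 0 (fun i => q ^- i - alpha * q) (fun i => q ^- N - q ^- i))
| qqKII : (0 < N)%N ->
    A2_list q alpha N (Family 0 (q * alpha) N.-1)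
      (fun _ => 1)
      (coefs 0 (fun i => (1 - q ^ (N%:Z - i%:Z)) / (1 - q ^+ N))
               (fun i => (1 - q ^- i) / (1 - q ^- N)))
      (fun x => alpha * q * (1 - q ^ (N%:Z - x)) / (1 - q ^+ N))
      (coefs 0 (fun i => alpha * q - q ^- i) (fun i => q ^- i))
| qqKIII : (0 < N)%N ->
    A2_list q alpha N (Family (-1) alpha N.-1)
      (fun _ => 1 - q ^+ N)
      (coefs 0 (fun i => 1 - q ^ (N%:Z - i%:Z))
               (fun i => - q ^+ N * (1 - q ^- i) * (1 - alpha * q ^+ i)))
      (fun x => alpha * q ^+ N.+1 * ((1 - q ^ (- x)) / (1 - q ^+ N)))
      (coefs 0 (fun i => - q ^- i) (fun i => q ^- i)).

Definition rescaled (F : fieldType) (c : F) (eps : seq int) (M : nat)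
    (lam0 : int -> F) (Phi0 : int -> nat -> F)
    (lam : int -> F) (Phi : int -> nat -> F) : Prop :=
  (forall x, lam x = c * lam0 x) /\
  (forall (i : nat) (e : int), (i <= M)%N -> e \in eps -> Phi e i = c * Phi0 e i).

Definition comp_coefs (F : fieldType) (eps1 eps2 : seq int)
    (Phi1 Phi2 : int -> nat -> F) (e : int) (i : nat) : F :=
  \sum_(e1 <- eps1) Phi1 e1 i *
    \sum_(e2 <- eps2 | e1 + e2 == e) Phi2 e2 (absz (i%:Z + e1)).

(* f_i is expanded in a family h by an A2 relation, and the h_j are expanded in
   g by the associated relation of an A2 relation from g to h.  Either of the
   two A2 relations may be the trivial one. *)
Definition B2_from_A2 (F : fieldType) (q : F) (f g : family F)
    (lam : int -> F) (Phi : int -> nat -> F) : Prop :=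
  exists (h : family F) (lam1 : int -> F) (Phi1 : int -> nat -> F)
         (lam2 : int -> F) (Phi2 : int -> nat -> F)
         (lam3 : int -> F) (Phi3 : int -> nat -> F),
  [/\ A2 q f h lam1 Phi1, A2 q g h lam2 Phi2, A2_assoc q g h lam3 Phi3,
      (forall x, lam x = lam1 x * lam3 x) &
      (forall (i : nat) (e : int), (i <= fN f)%N -> e \in epsB2 ->
         Phi e i = comp_coefs epsA2 epsA2_assoc Phi1 Phi3 e i)].

Definition B2'_from_A2 (F : fieldType) (q : F) (f g : family F)
    (lam : int -> F) (Phi : int -> nat -> F) : Prop :=
  exists (h : family F) (lam1 : int -> F) (Phi1 : int -> nat -> F)
         (lam2 : int -> F) (Phi2 : int -> nat -> F),
  [/\ A2 q f h lam1 Phi1, A2 q h g lam2 Phi2,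
      (forall x, lam x = lam1 x * lam2 x) &
      (forall (i : nat) (e : int), (i <= fN f)%N -> e \in epsB2' ->
         Phi e i = comp_coefs epsA2 epsA2 Phi1 Phi2 e i)].

(* Main.v *)
Require Import Defs.
From mathcomp Require Import zify ring.

Set Implicit Arguments.
Unset Strict Implicit.
Unset Printing Implicit Defensive.

Import Order.TTheory GRing.Theory Num.Theory.

Local Open Scope ring_scope.

(** Write y = q^-x and Y_k = (y; q)_k, let f be the family with parameters
alpha and N, and g a target family with parameters eta, beta and M; put n =
q^-N, m = q^-M and tau = q^eta.

That the listed relations hold is a comparison of coefficients: the
coefficients of R_i in the basis Y_k change by simple factors when alpha or N
moves, and y Y_k = q^-k (Y_k - Y_(k+1)).

For completeness, let L be the functional orthogonal to all g_j with j > 0: a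
weighted sum over the lattice 0, ..., M, which exists for every beta <> 0 and
does not vanish at 1 (lsum_qqKsum, lsum1_neq0). If lam f_i is a combination of
g_(i+e) with all i + e > 0, then L (lam f_i) = 0. Since the coefficients of f_i
are explicit, these conditions for a few consecutive i, together with one
condition L (y lam f_i) = 0, say exactly that, for the first few k, L (lam Y_k)
= (n; q)_k / (alpha q)^k S(q^-k) with a polynomial S of small degree
(inversion). On the other side the numbers L (Y_k) satisfy a recurrence of
order two whose coefficients depend on beta, m and tau (moment_rec). Together
they give an equation between polynomials in V = q^-k, which holds at more
values of k than its degree, hence identically.

If lam is constant, the equation is that const_defect vanishes. Its leading
coefficient gives beta = alpha tau q^(deg S), because alpha is not a power of
q, and its values at V = 0, n, n q and n q^2 leave only the parameters that two
steps of the list can reach (const_defect_solve). If lam is a multiple of y -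
w, which happens only for B2, L (Y_k) is itself a quotient of a quadratic and
an affine function of V, times (n; q)_k / (alpha q)^k, and the equation is that
affine_defect vanishes; it is solved in the same way (affine_defect_solve). The
case S = 0 needs beta = 1/q and a factor lam that vanishes at the last lattice
point; there g_(j+1) is lam times the j-th member of a family with parameter
alpha = q, up to a constant, which reduces this case to a constant factor and
thereby excludes it (degenerate_target).

The coefficients of a relation are determined by lam, because the g_j are
linearly independent on the lattice of g (lattice_free). If no relation with a
constant factor leads from f to g, lam itself is determined up to a factor:
otherwise lam minus a multiple of the factor of the composite relation would be
a nonzero constant. For g = f the factors form a plane spanned by 1 and the
factor of the composite I followed by its associated relation. *)

(** * Powers of q and polynomial identities *)

(** The integer powers of q. *)
Definition qpow (F : fieldType) (q z : F) : Prop := exists k : int, z = q ^ k.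

Section Powers.
Variables (F : fieldType) (q : F).
Hypotheses (q0 : q != 0) (qroot : forall k : nat, (0 < k)%N -> q ^+ k != 1).

Lemma qpowM z z' : qpow q z -> qpow q z' -> qpow q (z * z').
Proof. by move=> [k ->] [l ->]; exists (k + l); rewrite expfzDr. Qed.

Lemma qpowV z : qpow q z -> qpow q z^-1.
Proof. by move=> [k ->]; exists (- k); rewrite invr_expz. Qed.

Lemma qpowX k : qpow q (q ^+ k).
Proof. by exists k%:Z. Qed.

Lemma qpow1 : qpow q 1.
Proof. by exists 0. Qed.

Lemma qpow_neq0 z : qpow q z -> z != 0.
Proof. by move=> [k ->]; rewrite expfz_neq0. Qed.

Lemma qexpz_eq1 (k : int) : q ^ k = 1 -> k = 0.
Proof.
have pos (j : nat) : q ^+ j = 1 -> j = 0%N.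
  by case: j => // j /eqP; rewrite (negbTE (qroot _)).
case: k => [j /pos -> //|j]; rewrite NegzE -exprnN => /eqP.
by rewrite invr_eq1 => /eqP /pos.
Qed.

Lemma qexpz_inj (k l : int) : q ^ k = q ^ l -> k = l.
Proof.
move=> e; apply/eqP; rewrite -subr_eq0; apply/eqP/qexpz_eq1.
by rewrite expfzDr // e -expfzDr // subrr.
Qed.

Lemma qpow_generic (alpha z z' : F) : (forall k : int, alpha != q ^ k) ->
  qpow q z -> qpow q z' -> alpha * z != z'.
Proof.
move=> ga hz hz'; apply/eqP=> e.
have : qpow q alpha.
  by rewrite -[alpha](mulfK (qpow_neq0 hz)) e; apply: qpowM => //; apply: qpowV.
by move=> [k ek]; move: (ga k); rewrite ek eqxx.
Qed.

(** The points q / q^k, that is q, 1, q^-1, ..., are pairwise distinct. *)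
Lemma poly_qpow_eq0 (p : {poly F}) r : (size p <= r)%N ->
  (forall k, (k < r)%N -> p.[q / q ^+ k] = 0) -> p = 0.
Proof.
move=> sp hp; apply/eqP; apply: contraT => p0.
pose rs := [seq q / q ^+ k | k <- iota 0 r].
have hr : all (root p) rs.
  by apply/allP=> _ /mapP [k + ->]; rewrite mem_iota add0n => /hp /eqP.
have ur : uniq rs.
  rewrite map_inj_uniq ?iota_uniq // => k l /(mulfI q0) /invr_inj e.
  by have [] : k%:Z = l%:Z by apply: qexpz_inj.
by have := max_poly_roots p0 hr ur; rewrite size_map size_iota ltnNge sp.
Qed.

Lemma quartic_eq0 a0 a1 a2 a3 a4 :
  (forall k, (k < 5)%N -> let V := q / q ^+ k in
     a0 + a1 * V + a2 * V ^+ 2 + a3 * V ^+ 3 + a4 * V ^+ 4 = 0) ->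
  [/\ a0 = 0, a1 = 0, a2 = 0, a3 = 0 & a4 = 0].
Proof.
move=> h; have p0 : Poly [:: a0; a1; a2; a3; a4] = 0.
  apply: (@poly_qpow_eq0 _ 5); first exact: size_Poly.
  by move=> k /h <-; rewrite horner_Poly /=; ring.
have c j : [:: a0; a1; a2; a3; a4]`_j = 0 by rewrite -coef_Poly p0 coef0.
by split; [exact: (c 0%N)|exact: (c 1%N)|exact: (c 2%N)|exact: (c 3%N)|exact: (c 4%N)].
Qed.

Lemma cubic_eq0 a0 a1 a2 a3 :
  (forall k, (k < 4)%N -> let V := q / q ^+ k in
     a0 + a1 * V + a2 * V ^+ 2 + a3 * V ^+ 3 = 0) ->
  [/\ a0 = 0, a1 = 0, a2 = 0 & a3 = 0].
Proof.
move=> h; have p0 : Poly [:: a0; a1; a2; a3] = 0.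
  apply: (@poly_qpow_eq0 _ 4); first exact: size_Poly.
  by move=> k /h <-; rewrite horner_Poly /=; ring.
have c j : [:: a0; a1; a2; a3]`_j = 0 by rewrite -coef_Poly p0 coef0.
by split; [exact: (c 0%N)|exact: (c 1%N)|exact: (c 2%N)|exact: (c 3%N)].
Qed.

End Powers.
(** * The equation for a constant factor *)
Section ConstantFactor.
Variables (F : fieldType) (q alpha n beta m tau : F).

(** The defect of the recurrence moment_rec at V = q^-k for the sequence
(n; q)_k / (alpha q)^k S(q^-k) with S = s0 + s1 V + s2 V^2, multiplied by
alpha q V and divided by (n; q)_k / (alpha q)^k. *)
Definition const_defect (s0 s1 s2 V : F) : F :=
  alpha * q * (1 - V / q) * (V - m * tau) * (s0 + s1 * V + s2 * V ^+ 2)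
  - (V - n) * ((beta * q + m - V * (beta / tau + q^-1))
                 * (s0 + s1 * (V / q) + s2 * (V / q) ^+ 2)
     + beta / (tau * alpha * q) * (V - n * q)
                 * (s0 + s1 * (V / q ^+ 2) + s2 * (V / q ^+ 2) ^+ 2)).

Hypotheses (q0 : q != 0) (qroot : forall k : nat, (0 < k)%N -> q ^+ k != 1).
Hypotheses (a0 : alpha != 0) (ga : forall k : int, alpha != q ^ k).
Hypotheses (pn : qpow q n) (pm : qpow q m) (pt : qpow q tau) (b0 : beta != 0).
Hypotheses (n1 : n != 1) (nq : n != q) (nqV : n * q != 1).

Let t0 : tau != 0 := qpow_neq0 q0 pt.
Let n0 : n != 0 := qpow_neq0 q0 pn.
Let m0 : m != 0 := qpow_neq0 q0 pm.

(* The monomial V^j of S contributes V^j (cA u + cB u V + cC u V^2) with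
   u = q^-j. *)
Let cA (u : F) := - alpha * q * m * tau
  + n * ((beta * q + m) * u - n * q * (beta / (tau * alpha * q)) * u ^+ 2).
Let cB (u : F) := alpha * q + alpha * m * tau - (beta * q + m) * u
  - n * (beta / tau + q^-1) * u
  + beta / (tau * alpha * q) * (n * q + n) * u ^+ 2.
Let cC (u : F) := - alpha + (beta / tau + q^-1) * u
  - beta / (tau * alpha * q) * u ^+ 2.

Lemma const_defect_expand s0 s1 s2 V : const_defect s0 s1 s2 V =
  s0 * cA 1 + (s1 * cA q^-1 + s0 * cB 1) * V
  + (s2 * cA (q^-1 ^+ 2) + s1 * cB q^-1 + s0 * cC 1) * V ^+ 2
  + (s2 * cB (q^-1 ^+ 2) + s1 * cC q^-1) * V ^+ 3
  + s2 * cC (q^-1 ^+ 2) * V ^+ 4.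
Proof. by rewrite /const_defect /cA /cB /cC; field; rewrite a0 t0 q0. Qed.

(** cC (q^-d) is the leading coefficient of the defect when S has degree d; up to
a unit it is (1 - beta / (alpha tau q^d)) (1 - alpha q^(d+1)). *)
Lemma cC_eq0 d : cC (q^-1 ^+ d) = 0 -> beta = alpha * tau * q ^+ d.
Proof.
move=> h.
have : (1 - beta / (alpha * tau * q ^+ d)) * (1 - alpha * q ^+ d.+1) = 0.
  have -> : (1 - beta / (alpha * tau * q ^+ d)) * (1 - alpha * q ^+ d.+1)
     = q ^+ d.+1 * cC (q^-1 ^+ d).
    rewrite /cC exprS exprVn; have : q ^+ d != 0 by rewrite expf_neq0.
    by move: (q ^+ d) => u u0; field; rewrite a0 t0 q0 u0.
  by rewrite h mulr0.
have qd0 : q ^+ d != 0 by rewrite expf_neq0.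
move/eqP; rewrite mulf_eq0 => /orP [] /eqP e; last first.
  have /eqP [] := qpow_generic q0 ga (qpowX q d.+1) (qpow1 q).
  by apply/eqP; rewrite eq_sym -subr_eq0 e.
have -> : beta = beta / (alpha * tau * q ^+ d) * (alpha * tau * q ^+ d).
  by rewrite mulfVK // !mulf_neq0.
by rewrite -[beta / _](subKr 1) e subr0 mul1r.
Qed.

Lemma const_defect_coefs s0 s1 s2 : (forall V, const_defect s0 s1 s2 V = 0) ->
  [/\ s0 * cA 1 = 0, s1 * cA q^-1 + s0 * cB 1 = 0,
      s2 * cA (q^-1 ^+ 2) + s1 * cB q^-1 + s0 * cC 1 = 0,
      s2 * cB (q^-1 ^+ 2) + s1 * cC q^-1 = 0 & s2 * cC (q^-1 ^+ 2) = 0].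
Proof.
by move=> h; apply: (quartic_eq0 q0 qroot) => k _ /=; rewrite -const_defect_expand.
Qed.

(** The defect has degree at most deg S + 2, so that it vanishes identically once
it vanishes at 4 points (deg S <= 1) or at 5 points (deg S <= 2). *)
Lemma const_defect_data s0 s1 s2 :
  (s2 = 0 /\ (forall k, (k < 4)%N -> const_defect s0 s1 s2 (q / q ^+ k) = 0)) \/
  (forall k, (k < 5)%N -> const_defect s0 s1 s2 (q / q ^+ k) = 0) ->
  [/\ forall V, const_defect s0 s1 s2 V = 0,
      s2 != 0 -> beta = alpha * tau * q ^+ 2,
      s2 = 0 -> s1 != 0 -> beta = alpha * tau * q &
      s2 = 0 -> s1 = 0 -> s0 != 0 -> beta = alpha * tau].
Proof.
move=> h.
have [e0 e1 e2 e3 e4] : [/\ s0 * cA 1 = 0, s1 * cA q^-1 + s0 * cB 1 = 0,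
  s2 * cA (q^-1 ^+ 2) + s1 * cB q^-1 + s0 * cC 1 = 0,
  s2 * cB (q^-1 ^+ 2) + s1 * cC q^-1 = 0 & s2 * cC (q^-1 ^+ 2) = 0].
  case: h => [[z h]|h].
    have [] := @cubic_eq0 _ q q0 qroot (s0 * cA 1) (s1 * cA q^-1 + s0 * cB 1)
      (s2 * cA (q^-1 ^+ 2) + s1 * cB q^-1 + s0 * cC 1)
      (s2 * cB (q^-1 ^+ 2) + s1 * cC q^-1).
      by move=> k /h /= <-; rewrite const_defect_expand z; ring.
    by move=> -> -> -> ->; split => //; rewrite z mul0r.
  by apply: (quartic_eq0 q0 qroot) => k /h /= <-; rewrite const_defect_expand.
split.
- by move=> V; rewrite const_defect_expand e0 e1 e2 e3 e4; ring.
- move=> s; apply: cC_eq0.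
  by move/eqP: e4; rewrite mulf_eq0 (negbTE s) => /eqP.
- move=> z s; rewrite -[q]expr1; apply: cC_eq0; rewrite expr1.
  by move/eqP: e3; rewrite z mul0r add0r mulf_eq0 (negbTE s) => /eqP.
- move=> z z' s; rewrite -[_ * tau]mulr1 -(expr0 q); apply: cC_eq0.
  rewrite expr0; move/eqP: e2.
  by rewrite z z' !mul0r !add0r mulf_eq0 (negbTE s) => /eqP.
Qed.

(* Proves that a product of powers of q is one *)
Local Ltac qp := do ?[assumption | exact: (qpowX _ 1) | exact: qpow1
  | exact: qpowX | apply: (qpowM q0) | apply: qpowV].

Lemma alpha_neq z z' : qpow q z -> qpow q z' -> alpha * z - z' == 0 = false.
Proof. by move=> hz hz'; rewrite subr_eq0; apply/negbTE/(qpow_generic q0 ga). Qed.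

Lemma const_defect_at0 s0 s1 s2 d : beta = alpha * tau * q ^+ d ->
  const_defect s0 s1 s2 0 = s0 * (alpha * (q * tau) - n) * (n * q ^+ d - m).
Proof. by move=> hb; rewrite /const_defect hb; field; rewrite a0 t0 q0. Qed.

Lemma const_defect_atn s0 s1 s2 : const_defect s0 s1 s2 n =
  alpha * (q - n) * (n - m * tau) * (s0 + s1 * n + s2 * n ^+ 2).
Proof. by rewrite /const_defect; field; rewrite a0 t0 q0. Qed.

(** The value of the defect at V = 0. *)
Lemma const_defect_zero0 s0 s1 s2 d : beta = alpha * tau * q ^+ d ->
  (forall V, const_defect s0 s1 s2 V = 0) -> s0 = 0 \/ m = n * q ^+ d.
Proof.
move=> hb /(_ 0)/eqP; rewrite (const_defect_at0 _ _ _ hb) !mulf_eq0.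
rewrite alpha_neq ?orbF //; last by qp.
case/orP=> /eqP e; [by left|right].
by apply/esym/eqP; rewrite -subr_eq0 e.
Qed.

(** The value of the defect at V = n. *)
Lemma const_defect_zeron s0 s1 s2 : (forall V, const_defect s0 s1 s2 V = 0) ->
  n = m * tau \/ s0 + s1 * n + s2 * n ^+ 2 = 0.
Proof.
move/(_ n)/eqP; rewrite const_defect_atn !mulf_eq0 (negbTE a0) !subr_eq0.
by rewrite (eq_sym q) (negbTE nq) => /= /orP [] /eqP; [left|right].
Qed.

Lemma const_defect_solve0 s0 : s0 != 0 -> beta = alpha * tau ->
  (forall V, const_defect s0 0 0 V = 0) -> tau = 1 /\ m = n.
Proof.
move=> s hb hE.
have hb0 : beta = alpha * tau * q ^+ 0 by rewrite expr0 mulr1.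
have [e|e] := const_defect_zero0 hb0 hE.
  by rewrite e eqxx in s.
have mn : m = n by rewrite e mulr1.
split=> //; have [|] := const_defect_zeron hE; last first.
  by rewrite !mul0r !addr0 => /eqP; rewrite (negbTE s).
by rewrite mn -{1}[n]mulr1 => /(mulfI n0).
Qed.

(** The solutions with deg S = 1 and beta = alpha tau q: the relations I, II
and III. *)
Definition solution1 := [\/ tau = 1 /\ m = n, tau = 1 /\ m = n * q
  | tau = q^-1 /\ m = n * q].

Lemma const_defect_solve1 s0 s1 : s1 != 0 -> beta = alpha * tau * q ->
  (forall V, const_defect s0 s1 0 V = 0) -> solution1.
Proof.
move=> s hb hE.
have q1 : q - 1 != 0 by rewrite subr_eq0; apply: (qroot (ltn0Sn 0)).
have tq : qpow q (tau * q) by qp.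
have [e|e] := @const_defect_zero0 _ _ _ 1 hb hE.
  (* S = V *)
  constructor 1; have [h|] := const_defect_zeron hE; last first.
    rewrite e mul0r add0r addr0 => /eqP.
    by rewrite mulf_eq0 (negbTE s) (negbTE n0).
  have em : m = n / tau by rewrite h mulfK.
  have : s1 * n * n * (q - 1) * (1 - tau) * (alpha * (q * tau * q) - n) = 0.
    rewrite -(mulr0 tau) -[in RHS](hE (n * q)) /const_defect hb em e.
    by field; rewrite a0 t0 q0.
  move/eqP; rewrite !mulf_eq0 (negbTE s) (negbTE n0) (negbTE q1).
  rewrite alpha_neq ?orbF //; last first.
    by qp.
  rewrite subr_eq0 => /eqP t1; split=> //.
  by rewrite em -t1 invr1 mulr1.
rewrite expr1 in e.
have [h|h] := const_defect_zeron hE.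
  constructor 3; split=> //; apply: (mulfI n0); apply: (mulIf q0).
  by rewrite mulfVK // {2}h e; ring.
(* S = V - n *)
constructor 2; split=> //.
have es0 : s0 = - (s1 * n).
  by apply/eqP; rewrite -subr_eq0 opprK -h mul0r addr0.
have : s1 * alpha * q * (1 - n) * (n * q) * (1 - tau) * (n * (q - 1)) = 0.
  have {}hE := hE (n * q); rewrite /const_defect hb e es0 in hE.
  by rewrite -[RHS]hE; field; rewrite a0 t0 q0.
move/eqP; rewrite !mulf_eq0 (negbTE s) (negbTE n0) (negbTE q0) (negbTE a0).
rewrite (negbTE q1) !subr_eq0 (eq_sym 1) (negbTE n1) /= orbF.
by rewrite eq_sym => /eqP.
Qed.

(** The solutions with deg S = 2 and beta = alpha tau q^2: all compositions of two
of the relations I, II, III. *)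
Definition solution2 := [\/ tau = 1 /\ [\/ m = n, m = n * q | m = n * q ^+ 2],
  tau = q^-1 /\ (m = n * q \/ m = n * q ^+ 2)
  | tau = q^-1 ^+ 2 /\ m = n * q ^+ 2].

Lemma const_defect_solve2 s0 s1 s2 : s2 != 0 -> beta = alpha * tau * q ^+ 2 ->
  (forall V, const_defect s0 s1 s2 V = 0) -> solution2.
Proof.
move=> s hb hE.
have q1 : q - 1 != 0 by rewrite subr_eq0; apply: (qroot (ltn0Sn 0)).
have [_ c1 c2 _ _] := const_defect_coefs hE.
(* the value at V = n q, given that S vanishes at n *)
have hnq : s0 + s1 * n + s2 * n ^+ 2 = 0 ->
    n * q - m * tau = 0 \/ s0 + s1 * (n * q) + s2 * (n * q) ^+ 2 = 0.
  move=> hn.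
  have : alpha * q * (1 - n) *
      (n * q - m * tau) * (s0 + s1 * (n * q) + s2 * (n * q) ^+ 2) = 0.
    have es0 : s0 = - (s1 * n + s2 * n ^+ 2).
      by apply/eqP; rewrite -subr_eq0 opprK addrA hn.
    rewrite -[RHS](hE (n * q)) /const_defect es0.
    by field; rewrite a0 t0 q0.
  move/eqP; rewrite !mulf_eq0 (negbTE a0) (negbTE q0) subr_eq0 eq_sym (negbTE n1).
  by case/orP=> /eqP; [left|right].
have [e0|em] := const_defect_zero0 hb hE; have [ht|hn] := const_defect_zeron hE.
- have em : m = n / tau by rewrite ht mulfK.
  have [e1|e1] := eqVneq s1 0.
    (* S = V^2 *)
    have : s2 * n * (1 - tau) * (alpha * (q ^+ 3 * tau) - n) = 0.
      rewrite -(mulr0 (- tau * q ^+ 2)) -[in RHS]c2 /cA /cB /cC hb em e0 e1.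
      by field; rewrite a0 t0 q0.
    move/eqP; rewrite !mulf_eq0 alpha_neq ?orbF; [|qp|by []].
    rewrite (negbTE s) (negbTE n0) subr_eq0 => /eqP t1.
    by constructor 1; split=> //; constructor 1; rewrite em -t1 invr1 mulr1.
  (* S = V (V - r) *)
  have : s1 * n * (1 - q * tau) * (alpha * (q ^+ 2 * tau) - n) = 0.
    rewrite -(mulr0 (- tau * q)) -[in RHS]c1 /cA /cB /cC hb em e0.
    by field; rewrite a0 t0 q0.
  move/eqP; rewrite !mulf_eq0 alpha_neq ?orbF; [|qp|by []].
  rewrite (negbTE e1) (negbTE n0) subr_eq0 => /eqP t1.
  have tV : tau = q^-1 by apply: (mulfI q0); rewrite -t1 mulfV.
  by constructor 2; split=> //; left; rewrite em tV invrK.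
- (* S = V (V - n) *)
  have es : s1 = - (s2 * n).
    apply: (mulIf n0); apply/eqP; rewrite -subr_eq0 mulNr opprK -mulrA -expr2.
    by rewrite -hn e0 add0r.
  have [/eqP|/eqP] := hnq hn; last first.
    have -> : s0 + s1 * (n * q) + s2 * (n * q) ^+ 2 = s2 * n ^+ 2 * q * (q - 1).
      by rewrite e0 es; ring.
    by rewrite !mulf_eq0 (negbTE s) (negbTE n0) (negbTE q0) (negbTE q1).
  rewrite subr_eq0 => /eqP emt.
  have em : m = n * q / tau by rewrite emt mulfK.
  have : s2 * n * n * (1 - tau) * (alpha * (q ^+ 2 * tau) - n) = 0.
    rewrite -(mulr0 tau) -[in RHS]c1 /cA /cB /cC hb em e0 es.
    by field; rewrite a0 t0 q0.
  move/eqP; rewrite !mulf_eq0 alpha_neq ?orbF; [|qp|by []].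
  rewrite (negbTE s) (negbTE n0) subr_eq0 => /eqP t1.
  by constructor 1; split=> //; constructor 2; rewrite em -t1 invr1 mulr1.
- constructor 3; split=> //; apply: (mulfI m0); rewrite -ht em exprVn mulfK //.
  by rewrite expf_neq0.
- (* S = (V - n) (V - r) *)
  have [/eqP|h] := hnq hn.
    rewrite em subr_eq0 => /eqP h; constructor 2; split; last by right.
    apply: (mulfI n0); apply: (mulIf q0); apply: (mulIf q0).
    by rewrite mulfVK // h; ring.
  constructor 1; split; last by constructor 3.
  have es1 : s1 = - (s2 * n * (1 + q)).
    have : s1 * (n * (q - 1)) = - (s2 * n * (1 + q)) * (n * (q - 1)).
      apply/eqP; rewrite -subr_eq0; apply/eqP.
      by rewrite -[RHS](subrr 0) -{1}h -hn; ring.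
    by apply: mulIf; rewrite mulf_neq0.
  have es0 : s0 = s2 * n ^+ 2 * q.
    apply/eqP; rewrite -subr_eq0; apply/eqP.
    by rewrite -hn es1; ring.
  have q2 : q + 1 != 0.
    have : (q - 1) * (q + 1) != 0.
      by rewrite -subr_sqr expr1n subr_eq0; apply: (qroot (ltn0Sn 1)).
    by rewrite mulf_eq0 negb_or => /andP [].
  have nq1 : 1 - n * q != 0 by rewrite subr_eq0 eq_sym.
  have nz : alpha * q ^+ 5 * (1 - n * q) * n ^+ 3 * s2
         * (q - 1) * ((q - 1) * (q + 1)) != 0.
    by do ?[apply: mulf_neq0 | apply: expf_neq0].
  apply/esym/eqP; rewrite -subr_eq0; apply/eqP/(mulfI nz).
  rewrite mulr0 -(mulr0 (q ^+ 1)) -[in RHS](hE (n * q ^+ 2)) /const_defect hb em es0 es1.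
  by field; rewrite a0 t0 q0.
Qed.

Lemma const_defect_solve s0 s1 s2 : [|| s0 != 0, s1 != 0 | s2 != 0] ->
  (s2 = 0 /\ (forall k, (k < 4)%N -> const_defect s0 s1 s2 (q / q ^+ k) = 0)) \/
  (forall k, (k < 5)%N -> const_defect s0 s1 s2 (q / q ^+ k) = 0) ->
  [\/ [/\ beta = alpha * tau, tau = 1 & m = n],
      beta = alpha * tau * q /\ solution1
    | [/\ s2 != 0, beta = alpha * tau * q ^+ 2 & solution2]].
Proof.
move=> hs /const_defect_data [hE b2 b1 b0'].
have [z2|s2n] := eqVneq s2 0; last first.
  by constructor 3; split; [| exact: b2|apply: (const_defect_solve2 s2n (b2 s2n) hE)].
rewrite z2 eqxx orbF in hs hE.
have [z1|s1n] := eqVneq s1 0; last first.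
  by constructor 2; split; [exact: b1|apply: (const_defect_solve1 s1n (b1 _ s1n) hE)].
rewrite z1 eqxx orbF in hs hE.
have hb := b0' z2 z1 hs.
by constructor 1; have [] := const_defect_solve0 hs hb hE.
Qed.

End ConstantFactor.

(** * The equation for a nonconstant factor *)
Section AffineFactor.
Variables (F : fieldType) (q : F).
Hypotheses (q0 : q != 0) (qroot : forall k : nat, (0 < k)%N -> q ^+ k != 1).

Local Ltac qp := do ?[assumption | exact: (qpowX _ 1) | exact: qpow1
  | exact: qpowX | apply: (qpowM q0) | apply: qpowV].

Lemma mulfI_eq0 (x y : F) : x != 0 -> x * y = 0 -> y = 0.
Proof. by move=> x0 /eqP; rewrite mulf_eq0 (negbTE x0) => /eqP. Qed.

Lemma linear_cancel a A B C :
  (forall V : F, (V - a) * (A + B * V + C * V ^+ 2) = 0) ->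
  [/\ A = 0, B = 0 & C = 0].
Proof.
move=> h.
have [_ h1 h2 h3 _] : [/\ - a * A = 0, A - a * B = 0, B - a * C = 0, C = 0
    & 0 = 0 :> F].
  apply: (quartic_eq0 q0 qroot) => k _ /=.
  by rewrite -[RHS](h (q / q ^+ k)); ring.
by move: h1 h2; rewrite h3 mulr0 subr0 => h1 h2; move: h1; rewrite h2 mulr0 subr0.
Qed.

Section Functions.
Variables (n m tau w : F).

(** Delta kap V is the determinant of the two linear equations that determine
L (Y_k) from L ((y - w) Y_k) and L ((y - w) Y_(k+1)); in spite of its form
(DeltaE) it is affine in V, with coefficients del0 and del1. *)
Definition del0 (kap : F) := w * kap - m * tau.
Definition del1 (kap : F) := 1 + m * tau / q - kap - w / q.
Definition Delta (kap V : F) := del0 kap + del1 kap * V.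

Lemma DeltaE kap V : Delta kap V =
  (1 - V / q) * (V - m * tau) - (kap - V / q) * (V - w).
Proof. by rewrite /Delta /del0 /del1; field. Qed.

Hypotheses (pn : qpow q n) (pm : qpow q m) (pt : qpow q tau).
Hypotheses (n1 : n != 1) (nq : n != q) (nq2 : n != q ^+ 2).

Let t0 : tau != 0 := qpow_neq0 q0 pt.
Let n0 : n != 0 := qpow_neq0 q0 pn.
Let m0 : m != 0 := qpow_neq0 q0 pm.
Let q1 : q - 1 != 0.
Proof. by rewrite subr_eq0; apply: (qroot (ltn0Sn 0)). Qed.
Let nq' : 1 - n / q != 0.
Proof. by rewrite subr_eq0 eq_sym -(inj_eq (mulIf q0)) mulfVK // mul1r. Qed.
Let nq2' : 1 - n / q ^+ 2 != 0.
Proof.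
rewrite subr_eq0 eq_sym -(inj_eq (mulIf (expf_neq0 2 q0))).
by rewrite mulfVK ?mul1r // expf_neq0.
Qed.

Section ConstantNumerator.
Variable a : F.
Hypotheses (a0 : a != 0) (ga : forall k : int, a != q ^ k).
Let kap := a * tau + m - a * w.
Let t := kap - n / q.

(** For this kap, del0 is a product: w kap - m tau = (w - tau) (m - a w). *)
Lemma del0_eq0 : del0 kap = 0 -> w = tau \/ m = a * w.
Proof.
move=> h; have : (w - tau) * (m - a * w) = 0.
  by rewrite -[RHS]h /del0 /kap; ring.
move/eqP; rewrite mulf_eq0 !subr_eq0 => /orP [] /eqP; by [left|right].
Qed.

Let gen z z' x : qpow q z -> qpow q z' -> x * (a * z - z') = 0 -> x = 0.
Proof.
move=> hz hz' /eqP; rewrite mulf_eq0 => /orP [/eqP //|].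
by rewrite subr_eq0 (negbTE (qpow_generic q0 ga hz hz')).
Qed.

(** The equation for a constant numerator S.  The second hypothesis covers the
degenerate determinant, in which case the numerator t has to vanish too. *)
Lemma solve_constant :
  (forall V, (V - n) * t * Delta kap V
     - a * q * Delta kap (V / q) * ((V - w) * t + Delta kap V) = 0) ->
  ((forall V, Delta kap V = 0) -> t = 0) ->
  [\/ tau = q /\ m = n / q, tau = 1 /\ m = n | tau = 1 /\ m = n / q].
Proof.
move=> hF hD.
have [tz|tn] := eqVneq t 0.
  have [e0 _ e2 _ _] : [/\ - a * q * (del0 kap * del0 kap) = 0,
      - a * (q + 1) * (del0 kap * del1 kap) = 0,
      - a * (del1 kap * del1 kap) = 0, 0 = 0 :> F & 0 = 0 :> F].
    apply: (quartic_eq0 q0 qroot) => k _ /=.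
    rewrite -[RHS](hF (q / q ^+ k)) tz /Delta; field.
    by rewrite q0 expf_neq0.
  have d0 : del0 kap = 0.
    by move/eqP: e0; rewrite 2!mulf_eq0 oppr_eq0 (negbTE a0) (negbTE q0) /= mulf_eq0 orbb => /eqP.
  have d1 : del1 kap = 0.
    by move/eqP: e2; rewrite mulf_eq0 oppr_eq0 (negbTE a0) /= mulf_eq0 orbb => /eqP.
  have ek : kap = n / q by apply/eqP; rewrite -subr_eq0 -/t tz.
  have : (1 - kap) * (1 - w / q) = 0.
    transitivity (del1 kap + del0 kap / q); last by rewrite d0 d1 mul0r addr0.
    by rewrite /del0 /del1; field.
  rewrite ek => /(mulfI_eq0 nq') /eqP; rewrite subr_eq0 => /eqP wq.
  have ew : w = q by rewrite -[w](mulfVK q0) -wq mul1r.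
  have en : n = m * tau.
    by apply/eqP; rewrite -subr_eq0 -d0 /del0 ek ew mulrCA mulfV // mulr1.
  have : (tau - q) * (a * 1 - m / q) = 0.
    by rewrite -[RHS]tz /t /kap en ew; field.
  move=> e.
  have tq : tau = q.
    by apply/eqP; rewrite -subr_eq0; apply/eqP; apply: (gen (qpow1 q) _ e); qp.
  by constructor 1; split=> //; rewrite en tq mulfK.
have hn : Delta kap (n / q) * ((1 - n / q) * (n - m * tau)) = 0.
  apply: (mulfI (mulf_neq0 a0 q0)); rewrite mulr0 -oppr0 -[in RHS](hF n).
  by rewrite /Delta /t /del0 /del1; field.
have [A|An] := eqVneq (Delta kap (n / q)) 0; last first.
  have en : n = m * tau.
    by apply/eqP; rewrite -subr_eq0; move/eqP: hn; rewrite !mulf_eq0 (negbTE An) (negbTE nq').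
  have em : m = n / tau by rewrite en mulfK.
  have [A B _] : [/\ (t - a * (q - w)) * del0 kap = 0,
      (t - a * (q - w) / q) * del1 kap = 0 & 0 = 0 :> F].
    apply: (@linear_cancel n) => V; rewrite -[RHS](hF V).
    have -> : (V - w) * t + Delta kap V = (V - n) * (1 - w / q).
      by rewrite DeltaE /t en; field.
    by rewrite /Delta; field.
  have [d0|d0] := eqVneq (del0 kap) 0; last first.
    have tE : t = a * (q - w).
      by apply/eqP; rewrite -subr_eq0; move/eqP: A; rewrite mulf_eq0 (negbTE d0) orbF.
    have : (tau - q) * (a * 1 - n / (q * tau)) = 0.
      transitivity (t - a * (q - w)); last by rewrite tE subrr.
      by rewrite /t /kap em; field; rewrite t0 q0.
    move=> e.
    have tq : tau = q.
      by apply/eqP; rewrite -subr_eq0; apply/eqP; apply: (gen (qpow1 q) _ e); qp.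
    by constructor 1; split=> //; rewrite en tq mulfK.
  have d1 : del1 kap != 0.
    apply: contra_neq tn => d1; apply: hD => V; by rewrite /Delta d0 d1 mul0r addr0.
  have tE : t = a * (q - w) / q.
    by apply/eqP; rewrite -subr_eq0; move/eqP: B; rewrite mulf_eq0 (negbTE d1) orbF.
  have [ew|ew] := del0_eq0 d0.
    have : (tau - q) * (a * 1 - n / tau) = 0.
      transitivity (q * (t - a * (q - w) / q)); last by rewrite tE subrr mulr0.
      by rewrite /t /kap em ew; field; rewrite t0 q0.
    move=> e.
    have tq : tau = q.
      by apply/eqP; rewrite -subr_eq0; apply/eqP; apply: (gen (qpow1 q) _ e); qp.
    by constructor 1; split=> //; rewrite en tq mulfK.
  have ew' : w = n / tau / a by rewrite -em ew mulrC mulKf.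
  have : (tau - 1) * (a * 1 - n / (q * tau)) = 0.
    transitivity (t - a * (q - w) / q); last by rewrite tE subrr.
    by rewrite /t /kap em ew'; field; rewrite a0 t0 q0.
  move=> e.
  have tq : tau = 1.
    by apply/eqP; rewrite -subr_eq0; apply/eqP; apply: (gen (qpow1 q) _ e); qp.
  by constructor 2; split=> //; rewrite en tq mulr1.
have d0E : del0 kap = - (del1 kap * (n / q)).
  by apply/eqP; rewrite -subr_eq0 opprK -A.
have d1 : del1 kap != 0.
  apply: contra_neq tn => d1; apply: hD => V.
  by rewrite /Delta d0E d1 !mul0r oppr0 addr0.
have wn : w = n / q.
  have : a * q * (del1 kap * (n / q) * (q - 1) / q) * ((n / q - w) * t) = 0.
    by rewrite -[RHS](hF (n / q)) A /Delta d0E; field.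
  move/eqP; rewrite !mulf_eq0 !invr_eq0 (negbTE a0) (negbTE q0) (negbTE d1).
  by rewrite (negbTE n0) (negbTE q1) (negbTE tn) !orbF subr_eq0 eq_sym => /eqP.
have em : m = n / (q * tau).
  have : (1 - n / q ^+ 2) * (n / q - m * tau) = 0.
    by rewrite -A DeltaE wn; field.
  move/(mulfI_eq0 nq2')/eqP; rewrite subr_eq0 => /eqP e.
  by rewrite invfM mulrA e mulfK.
have tE : t - a * (1 - n / q) = 0.
  apply: (mulfI (mulf_neq0 d1 (mulf_neq0 n0 n0))).
  have := hF 0; rewrite mul0r {1 2}/Delta mulr0 !addr0 d0E => h.
  rewrite mulr0 -(mulr0 q) -[in RHS]h.
  have -> : (0 - w) * t + Delta kap 0 = - (n / q) * (1 - n / q).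
    by rewrite DeltaE /t em wn; field; rewrite t0 q0.
  by field.
have : (tau - 1) * (a * 1 - n / (q * tau)) = 0.
  by rewrite -[RHS]tE /t /kap em wn; field; rewrite t0 q0.
move=> e.
have tq : tau = 1.
  by apply/eqP; rewrite -subr_eq0; apply/eqP; apply: (gen (qpow1 q) _ e); qp.
by constructor 3; split=> //; rewrite em tq mulr1.
Qed.
End ConstantNumerator.

Section LinearNumerator.
Variables a rho : F.
Hypotheses (a0 : a != 0) (ga : forall k : int, a != q ^ k).
Let kap := a * q * tau + m - a * q * w.
Let T V := rho * (n - kap) + (kap - n / q - rho + rho / q) * V.

(** The equation for S = V - rho; for rho = 0 it is the equation of
solve_constant with a q instead of a. *)
Lemma solve_linear :
  (forall V, (V - n) * T (V / q) * Delta kap V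
     - a * q * Delta kap (V / q) * ((V - w) * T V + (V - rho) * Delta kap V) = 0) ->
  ((forall V, Delta kap V = 0) -> forall V, T V = 0) ->
  [\/ tau = q /\ (m = n / q \/ m = n),
      tau = 1 /\ [\/ m = n, m = n / q | m = n * q]
    | tau = q^-1 /\ (m = n \/ m = n * q)].
Proof.
move=> hF hD.
have gen z z' x : qpow q z -> qpow q z' -> x * (a * z - z') = 0 -> x = 0.
  move=> hz hz' /eqP; rewrite mulf_eq0 => /orP [/eqP //|].
  by rewrite subr_eq0 (negbTE (qpow_generic q0 ga hz hz')).
have pq : qpow q q by exact: (qpowX q 1).
have aq0 : a * q != 0 by rewrite mulf_neq0.
have gaq k : a * q != q ^ k by apply: (qpow_generic q0 ga) => //; exists k.
have DE V : Delta kap V = del0 kap + del1 kap * V by [].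
have Fn : Delta kap (n / q) * ((1 - n / q) * (n - m * tau) * (n - rho)) = 0.
  apply: (mulfI aq0); rewrite mulr0 -oppr0 -[in RHS](hF n) /T !DeltaE.
  by field.
have [r0|rn] := eqVneq rho 0.
  (* S = V: the constant case with alpha q instead of alpha *)
  have [|D0|||] := @solve_constant (a * q) aq0 gaq.
  - move=> V; rewrite -/kap; move: V.
    pose t := kap - n / q.
    pose A := - n * t * del0 kap - a * q ^+ 2 * del0 kap * (del0 kap - w * t).
    pose B := t * del0 kap - n * t * del1 kap - a * q ^+ 2
      * (del0 kap * (t + del1 kap) + del1 kap / q * (del0 kap - w * t)).
    pose C := t * del1 kap - a * q * (del1 kap * (t + del1 kap)).
    have h V : (V - 0) * (A + B * V + C * V ^+ 2) = 0.
      rewrite -(mulr0 q) -[in RHS](hF V) /T r0 !DE /A /B /C /t; field.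
      by rewrite q0.
    have [hA hB hC] := linear_cancel h.
    move=> V; transitivity (A + B * V + C * V ^+ 2).
      by rewrite /A /B /C /t !DE; field.
    by rewrite hA hB hC !mul0r !addr0.
  - by have := hD D0 1; rewrite /T r0 mul0r !add0r mulr1 subr0 mul0r addr0.
  - by case=> -> ->; constructor 1; split=> //; left.
  - by case=> -> ->; constructor 2; split=> //; constructor 1.
  - by case=> -> ->; constructor 2; split=> //; constructor 2.
have D0P : del0 kap = 0 -> del1 kap = 0 -> forall V, Delta kap V = 0.
  by move=> d0 d1 V; rewrite DE d0 d1 mul0r addr0.
have TE : rho = n -> forall V, T V = (V - n) * (kap - n).
  by move=> e V; rewrite /T e; field.
have [/andP [/eqP d0z /eqP d1z]|nz] :=
  boolP ((del0 kap == 0) && (del1 kap == 0)).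
  have Tz := hD (D0P d0z d1z).
    have ek : kap = n.
      have := Tz 0; rewrite /T mulr0 addr0 => /(mulfI_eq0 rn)/eqP.
      by rewrite subr_eq0 eq_sym => /eqP.
    have : (1 - kap) * (1 - w / q) = 0.
      transitivity (del1 kap + del0 kap / q); last by rewrite d0z d1z mul0r addr0.
      by rewrite /del0 /del1; field.
    have n1' : 1 - n != 0 by rewrite subr_eq0 eq_sym.
    rewrite ek => /(mulfI_eq0 n1') /eqP; rewrite subr_eq0 => /eqP wq.
    have ew : w = q by rewrite -[w](mulfVK q0) -wq mul1r.
    have en : n * q = m * tau.
      by apply/eqP; rewrite -subr_eq0 -d0z /del0 ek ew mulrC.
    have e : (tau - q) * (a * q - m / q) = 0.
      transitivity (kap - m * tau / q); last by rewrite -en mulfK // ek subrr.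
      by rewrite /kap ew; field.
    have tq : tau = q.
      by apply/eqP; rewrite -subr_eq0; apply/eqP; apply: (gen _ _ _ pq _ e); qp.
    constructor 1; split=> //; right.
    by apply: (mulIf q0); rewrite en tq.
have Tn : ~ (forall V, T V = 0).
  move=> Tz; move/negP: nz; apply.
  have [h0 _ h2] : [/\ del0 kap * del0 kap = 0,
      del0 kap * del1 kap * (1 + q^-1) = 0 & del1 kap * del1 kap / q = 0].
    apply: (@linear_cancel rho) => V; apply: (mulfI aq0).
    rewrite mulr0 -oppr0 -[in RHS](hF V) !Tz !DE; field.
    by rewrite q0.
  move/eqP: h0; move/eqP: h2; rewrite !mulf_eq0 invr_eq0 (negbTE q0) orbF !orbb.
  by move=> -> ->.
have hB : m = n -> n = m * tau -> tau = 1.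
  by move=> -> /eqP; rewrite -{1}[n]mulr1 (inj_eq (mulfI n0)) => /eqP.
have hC : m = n -> rho = n -> tau = q \/ tau = 1.
  move=> mn rn'.
  have kn : kap - n != 0.
    apply/eqP=> z; apply: Tn => V; by rewrite TE // z mulr0.
  pose k := kap - n.
  pose A := - n * k * del0 kap - a * q * del0 kap * (del0 kap - w * k).
  pose B := k / q * del0 kap - n * k * del1 kap - a * q
      * (del0 kap * (k + del1 kap) + del1 kap / q * (del0 kap - w * k)).
  pose C := k / q * del1 kap - a * (del1 kap * (k + del1 kap)).
  have h V : (V - n) * (A + B * V + C * V ^+ 2) = 0.
    rewrite -[RHS](hF V) !TE // rn' !DE /A /B /C /k; field.
    by rewrite q0.
  have [hA hB' hC] := linear_cancel h.
  have hG V : (V / q - n) * k * Delta kap V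
     - a * q * Delta kap (V / q) * ((V - w) * k + Delta kap V) = 0.
    transitivity (A + B * V + C * V ^+ 2).
      by rewrite /A /B /C /k !DE; field.
    by rewrite hA hB' hC !mul0r !addr0.
  have : a * q * ((1 - n) * n) * ((q - tau) * Delta kap n) = 0.
    rewrite -oppr0 -[in RHS](hG (n * q)) /k !DE /del0 /del1 mn; field.
    by rewrite q0.
  have n1' : (1 - n) * n != 0 by rewrite mulf_neq0 // subr_eq0 eq_sym.
  move=> /(mulfI_eq0 (mulf_neq0 aq0 n1')) /eqP; rewrite mulf_eq0 subr_eq0.
  case/orP=> /eqP Dn; [by left|right].
  have d0E : del0 kap = - (del1 kap * n) by apply/eqP; rewrite -subr_eq0 opprK -Dn.
  have d1 : del1 kap != 0.
    by apply: contraNneq nz => d1; rewrite d0E d1 mul0r oppr0 eqxx.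
  have [h1 h2 _] : [/\ - n * k + a * q * (w * k + del1 kap * n) = 0,
     k - a * q * (k + del1 kap) = 0 & 0 = 0 :> F].
    apply: (@linear_cancel (n * q)) => V; apply: (mulfI d1).
    rewrite mulr0 -(mulr0 q) -[in RHS](hG V) !DE d0E; field.
    by rewrite q0.
  have : a * q * k * (w - n) = 0.
    by rewrite -(addr0 0) -{1}h1 -(mulr0 n) -h2; ring.
  rewrite -/k in kn; move/(mulfI_eq0 (mulf_neq0 aq0 kn))/eqP.
  rewrite subr_eq0 => /eqP wn; apply: hB => //.
  have : (1 - n / q) * (n - m * tau) = 0 by rewrite -Dn DeltaE wn; field.
  by move/(mulfI_eq0 nq')/eqP; rewrite subr_eq0 => /eqP.
have hBC : m = n -> n = m * tau \/ rho = n -> tau = q \/ tau = 1.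
  by move=> mn [e|e]; [right; apply: hB|apply: hC].
have fin : m = n -> tau = q \/ tau = 1 -> 
  [\/ tau = q /\ (m = n / q \/ m = n),
      tau = 1 /\ [\/ m = n, m = n / q | m = n * q]
    | tau = q^-1 /\ (m = n \/ m = n * q)].
  move=> mn [e|e]; first by constructor 1; split=> //; right.
  by constructor 2; split=> //; constructor 1.
have F0 : del0 kap * rho * (n - m) = 0.
  apply: (gen (q * tau) n); [by qp|by []|].
  by rewrite -[RHS](hF 0) /T !DE /del0 /kap; field.
have Fn' : [\/ Delta kap (n / q) = 0, n = m * tau | rho = n].
  move/eqP: Fn; rewrite !mulf_eq0 (negbTE nq') /= !subr_eq0.
  case/or3P=> /eqP e; [by constructor 1|by constructor 2|].
  by constructor 3; rewrite e.
have [mn|mn] := eqVneq m n.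
  case: Fn' => [A|e|e]; last first.
  - by apply: (fin mn); apply: hBC => //; right.
  - by apply: (fin mn); apply: hBC => //; left.
  have d0E : del0 kap = - (del1 kap * (n / q)).
    by apply/eqP; rewrite -subr_eq0 opprK -A.
  have d1 : del1 kap != 0.
    by apply: contraNneq nz => d1; rewrite d0E d1 mul0r oppr0 eqxx.
  have : a * q * (del1 kap * (n / q) * (q - 1) / q)
      * ((n / q - w) * T (n / q)) = 0.
    by rewrite -[RHS](hF (n / q)) A DE d0E; field.
  have nz1 : a * q * (del1 kap * (n / q) * (q - 1) / q) != 0.
    by rewrite !(mulf_neq0, invr_neq0).
  move/(mulfI_eq0 nz1)/eqP; rewrite mulf_eq0 subr_eq0 => /orP [/eqP wn|/eqP Tnq].
    have : (1 - n / q ^+ 2) * (n / q - m * tau) = 0.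
      by rewrite -A DeltaE -wn; field.
    move/(mulfI_eq0 nq2')/eqP; rewrite subr_eq0 mn => /eqP /(mulfI n0) e.
    by constructor 3; split; [rewrite -e|left].
  apply: (fin mn); apply: hBC => //.
  pose s1 := kap - n / q - rho + rho / q.
  have TE' V : T V = s1 * (V - n / q).
    by rewrite -[LHS]subr0 -Tnq /T /s1; field.
  pose A0 := - s1 * n / q + a * (w * s1 + rho * del1 kap).
  pose B0 := s1 / q - a * (s1 + del1 kap).
  have h V : (V - n) * (- (n / q) * A0 + (A0 - n / q * B0) * V + B0 * V ^+ 2) = 0.
    apply: (mulfI d1); rewrite mulr0 -[RHS](hF V) !TE' !DE d0E /A0 /B0; field.
    by rewrite q0.
  have [_ h1 h2] := linear_cancel h; move: h1; rewrite h2 mulr0 subr0 => h1.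
  have hn : (n - w) * s1 + (n - rho) * del1 kap = 0.
    apply: (mulfI a0); rewrite mulr0 -oppr0 -(addr0 0) -{1}h1 -(mulr0 n) -h2.
    by rewrite /A0 /B0; field.
  have : (1 - n / q) * ((n - m * tau) * (n - rho)) = 0.
    transitivity ((n - n / q) * ((n - w) * s1 + (n - rho) * del1 kap)); last first.
      by rewrite hn mulr0.
    transitivity ((n - w) * T n + (n - rho) * Delta kap n); last first.
      by rewrite TE' DE d0E; field.
    by rewrite /T DeltaE; field.
  move/(mulfI_eq0 nq')/eqP; rewrite mulf_eq0 !subr_eq0.
  by case/orP=> /eqP e; [left|right].
have d0 : del0 kap = 0.
  move/eqP: F0; rewrite !mulf_eq0 (negbTE rn) (subr_eq0 n m) (eq_sym n) (negbTE mn).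
  by rewrite !orbF => /eqP.
have d1 : del1 kap != 0 by move: nz; rewrite d0 eqxx.
have hH V : (V - n) * T (V / q) - a * ((V - w) * T V + (V - rho) * (del1 kap * V)) = 0.
  pose t0' := rho * (n - kap); pose s1 := kap - n / q - rho + rho / q.
  pose A := - n * t0' + a * w * t0'.
  pose B := t0' - n * s1 / q - a * (t0' - w * s1 - rho * del1 kap).
  pose C := s1 / q - a * (s1 + del1 kap).
  have h U : (U - 0) * (A + B * U + C * U ^+ 2) = 0.
    apply: (mulfI d1); rewrite mulr0 -[RHS](hF U) !DE d0 /T /A /B /C /t0' /s1; field.
    by rewrite q0.
  have [hA hB' hC'] := linear_cancel h.
  transitivity (A + B * V + C * V ^+ 2).
    by rewrite /A /B /C /t0' /s1 /T; field.
  by rewrite hA hB' hC' !mul0r !addr0.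
have wE : w = tau \/ m = a * q * w by apply: (@del0_eq0 (a * q)).
have aw_n : w = tau -> a * w = n -> False.
  move=> ->; move/eqP; apply/negP; apply: (qpow_generic q0 ga) => //.
have kE : w * kap = m * tau.
  by apply/eqP; rewrite -subr_eq0 -d0.
case: Fn' => [|en|rE].
- rewrite DE d0 add0r => /eqP; rewrite !mulf_eq0 invr_eq0.
  by rewrite (negbTE d1) (negbTE n0) (negbTE q0).
- (* n = m tau *)
  have : T 0 * (a * w - n) = 0.
    by rewrite -[RHS](hH 0) /T; field.
  move/eqP; rewrite mulf_eq0 /T mulr0 addr0 mulf_eq0 (negbTE rn) /=.
  rewrite !subr_eq0 => /orP [] /eqP e; case: wE => ew.
  + have kt : kap = m by apply: (mulfI t0); rewrite -[in LHS]ew kE mulrC.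
    have : tau = 1 by apply: (mulfI m0); rewrite -en e kt mulr1.
    by move=> t1; move: mn; rewrite en t1 mulr1 eqxx.
  + have kt : kap = a * q * tau by rewrite /kap ew; ring.
    have /eqP [] := qpow_generic q0 ga (qpowM q0 pq pt) pn.
    by rewrite e kt mulrA.
  + by case: (aw_n ew e).
  + have em : m = n * q by rewrite ew -e; ring.
    constructor 3; split; last by right.
    apply: (mulfI n0); apply: (mulIf q0).
    by rewrite mulfVK // {2}en em; ring.
- (* S = V - n *)
  have kn : kap - n != 0.
    by apply/eqP=> z; apply: Tn => V; rewrite TE // z mulr0.
  have [h1 h2 _] : [/\ - n * (kap - n) + a * w * (kap - n) = 0,
      (kap - n) / q - a * (kap - n + del1 kap) = 0 & 0 = 0 :> F].
    by apply: (@linear_cancel n) => V; rewrite -[RHS](hH V) !TE // rE; field.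
  have aw : a * w = n.
    apply/eqP; rewrite -subr_eq0; apply/eqP/(mulfI kn).
    by rewrite mulr0 -[RHS]h1; ring.
  case: wE => ew; first by case: (aw_n ew aw).
  have em : m = n * q by rewrite ew -aw; ring.
  have kt : kap = a * q * tau by rewrite /kap ew; ring.
  have wE : w = n / a by rewrite -aw mulrC mulKf.
  constructor 2; split; last by constructor 3.
  have : a * (1 - n) * (tau - 1) = 0.
    by rewrite -[RHS]h2 /del1 kt wE em; field; rewrite a0 q0.
  have n1' : 1 - n != 0 by rewrite subr_eq0 eq_sym.
  by move/(mulfI_eq0 (mulf_neq0 a0 n1'))/eqP; rewrite subr_eq0 => /eqP.
Qed.
End LinearNumerator.

Section GeneralNumerator.
Variables alpha beta s0 s1 : F.
Hypotheses (a0 : alpha != 0) (ga : forall k : int, alpha != q ^ k).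
Hypothesis (s_neq0 : (s0 != 0) || (s1 != 0)).

(** The argument kap of Delta. *)
Definition kappa := beta * q + m - beta * q * w / tau.
(** When L ((y - w) Y_k) = (n; q)_k / (alpha q)^k (s0 + s1 V), Cramer's rule gives
Delta kappa V L (Y_k) = - (n; q)_k / (alpha q)^k Tnum V. *)
Definition Tnum (V : F) := beta / (alpha * tau) * (V - n) * (s0 + s1 * (V / q))
  + (kappa - V / q) * (s0 + s1 * V).
(** The defect of the equation
L ((y - w) Y_k) = q^-k (L (Y_k) - L (Y_(k+1))) - w L (Y_k), after inserting the
values of L (Y_k) given by Tnum and clearing denominators. *)
Definition affine_defect (V : F) := (V - n) * Tnum (V / q) * Delta kappa V
  - alpha * q * Delta kappa (V / q)
      * ((V - w) * Tnum V + (s0 + s1 * V) * Delta kappa V).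

Let th := beta / (alpha * tau).
Let t2 := (th - 1) * s1 / q.
Let t1 := th * (s0 - n * s1 / q) + kappa * s1 - s0 / q.
Let t0' := (kappa - th * n) * s0.

Let TE V : Tnum V = t0' + t1 * V + t2 * V ^+ 2.
Proof. by rewrite /Tnum -/th /t0' /t1 /t2; field. Qed.

Let gen z z' x : qpow q z -> qpow q z' -> x * (alpha * z - z') = 0 -> x = 0.
Proof.
move=> hz hz' /eqP; rewrite mulf_eq0 => /orP [/eqP //|].
by rewrite subr_eq0 (negbTE (qpow_generic q0 ga hz hz')).
Qed.

(** The degree of Tnum is at most that of S: unless Delta vanishes identically, the
leading coefficient of the defect is a nonzero multiple of the top coefficient
of Tnum, because alpha is not a power of q. *)
Lemma affine_defect_leading : (forall k, (k < 5)%N -> affine_defect (q / q ^+ k) = 0) ->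
  ((forall V, Delta kappa V = 0) -> forall V, Tnum V = 0) ->
  (forall V, affine_defect V = 0) /\ t2 = 0 /\ (s1 = 0 -> t1 = 0).
Proof.
move=> hF hD; set d0 := del0 kappa; set d1 := del1 kappa.
pose c2 := t1 - w * t2 + s1 * d1.
pose c1 := t0' - w * t1 + s0 * d1 + s1 * d0.
pose c0 := - w * t0' + s0 * d0.
pose A0 := - n * t0' * d0 - alpha * q * d0 * c0.
pose A1 := t0' * d0 - n * (t1 / q * d0 + t0' * d1)
  - alpha * q * (d0 * c1 + d1 / q * c0).
pose A2 := t1 / q * d0 + t0' * d1 - n * (t2 / q ^+ 2 * d0 + t1 / q * d1)
  - alpha * q * (d0 * c2 + d1 / q * c1).
pose A3 := t2 / q ^+ 2 * d0 + t1 / q * d1 - n * (t2 / q ^+ 2 * d1)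
  - alpha * q * (d0 * t2 + d1 / q * c2).
pose A4 := t2 / q ^+ 2 * d1 - alpha * d1 * t2.
have FE V : affine_defect V = A0 + A1 * V + A2 * V ^+ 2 + A3 * V ^+ 3 + A4 * V ^+ 4.
  rewrite /affine_defect !TE /Delta -/d0 -/d1 /A0 /A1 /A2 /A3 /A4 /c0 /c1 /c2.
  by field.
have [z0 z1 z2 z3 z4] : [/\ A0 = 0, A1 = 0, A2 = 0, A3 = 0 & A4 = 0].
  by apply: (quartic_eq0 q0 qroot) => k /hF <-; rewrite FE.
split; first by move=> V; rewrite FE z0 z1 z2 z3 z4 !mul0r !addr0.
have pq : qpow q q by exact: (qpowX q 1).
have [e1|e1] := eqVneq d1 0; last first.
  have ht2 : t2 = 0.
    apply: (gen (qpowX q 2) (qpow1 q)); apply: (mulfI e1).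
    by rewrite mulr0 -(mulr0 (- q ^+ 2)) -z4 /A4; field.
  split=> // es; apply: (gen pq (qpow1 q)); apply: (mulfI e1).
  by rewrite mulr0 -(mulr0 (- q)) -[in RHS]z3 /A3 /c2 ht2 es; field.
have [e0|e0] := eqVneq d0 0.
  have TZ : forall V, Tnum V = 0.
    by apply: hD => V; rewrite /Delta -/d0 -/d1 e0 e1 mul0r addr0.
  have h V : (V - 0) * (t0' + t1 * V + t2 * V ^+ 2) = 0 by rewrite -TE TZ mulr0.
  by have [_ ? ?] := linear_cancel h.
have ht2 : t2 = 0.
  apply: (gen (qpowX q 3) (qpow1 q)); apply: (mulfI e0).
  by rewrite mulr0 -(mulr0 (- q ^+ 2)) -[in RHS]z3 /A3 e1; field.
split=> // es; apply: (gen (qpowX q 2) (qpow1 q)); apply: (mulfI e0).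
by rewrite mulr0 -(mulr0 (- q)) -[in RHS]z2 /A2 /c2 e1 ht2 es; field.
Qed.

(** beta = alpha tau / q for constant S, and beta = alpha tau for S of degree
one. *)
Lemma affine_defect_solve : (forall k, (k < 5)%N -> affine_defect (q / q ^+ k) = 0) ->
  ((forall V, Delta kappa V = 0) -> forall V, Tnum V = 0) ->
  (beta = alpha * tau / q /\
     [\/ tau = q /\ m = n / q, tau = 1 /\ m = n | tau = 1 /\ m = n / q]) \/
  (beta = alpha * tau /\
    [\/ tau = q /\ (m = n / q \/ m = n),
      tau = 1 /\ [\/ m = n, m = n / q | m = n * q]
    | tau = q^-1 /\ (m = n \/ m = n * q)]).
Proof.
move=> hF hD; have [hE [e2 e1]] := affine_defect_leading hF hD.
have thE x : th = x -> beta = x * (alpha * tau).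
  by move=> <-; rewrite /th mulfVK // mulf_neq0.
have [s1z|s1n] := eqVneq s1 0.
  have s0n : s0 != 0 by move: s_neq0; rewrite s1z eqxx orbF.
  have bE : beta = alpha * tau / q.
    rewrite mulrC; apply: thE; apply: (mulfI s0n); apply/eqP; rewrite -subr_eq0.
    by rewrite -(e1 s1z) /t1 s1z; apply/eqP; field.
  left; split=> //.
  have kE : kappa = alpha * tau + m - alpha * w.
    by rewrite /kappa bE; field; rewrite q0 t0.
  have TE' V : Tnum V = s0 * (kappa - n / q).
    by rewrite /Tnum s1z bE; field; rewrite q0 t0 a0.
  apply: (@solve_constant alpha a0 ga).
    move=> V; rewrite -kE; apply: (mulfI s0n).
    by rewrite mulr0 -[RHS](hE V) /affine_defect !TE' s1z; field.
  by rewrite -kE => /hD /(_ 0); rewrite TE' => /(mulfI_eq0 s0n).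
have bE : beta = alpha * tau.
  rewrite -[_ * _]mul1r; apply: thE; apply/eqP; rewrite -subr_eq0.
  by move/eqP: e2; rewrite /t2 !mulf_eq0 invr_eq0 (negbTE s1n) (negbTE q0) !orbF.
right; split=> //.
have kE : kappa = alpha * q * tau + m - alpha * q * w.
  by rewrite /kappa bE; field; rewrite t0.
pose rho := - s0 / s1.
have TE' V : Tnum V = s1 * (rho * (n - kappa)
    + (kappa - n / q - rho + rho / q) * V).
  by rewrite /Tnum bE /rho; field; rewrite q0 t0 a0 s1n.
apply: (@solve_linear alpha rho a0 ga); rewrite -kE.
  move=> V; apply: (mulfI s1n).
  by rewrite mulr0 -[RHS](hE V) /affine_defect !TE' /rho; field; rewrite q0 s1n.
by move=> /hD hT V; have := hT V; rewrite TE' => /(mulfI_eq0 s1n).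
Qed.

End GeneralNumerator.
End Functions.
End AffineFactor.

(** * Expansion of the polynomials and the contiguous relations *)
Section Expansion.
Variables (F : fieldType) (q : F).
Hypotheses (q0 : q != 0) (qroot : forall k : nat, (0 < k)%N -> q ^+ k != 1).

Lemma qpoch0 b : qpoch q b 0 = 1.
Proof. by rewrite /qpoch big_ord0. Qed.

Lemma qpochS b k : qpoch q b k.+1 = qpoch q b k * (1 - b * q ^+ k).
Proof. by rewrite /qpoch big_ord_recr. Qed.

Lemma qpochSl b k : qpoch q b k.+1 = (1 - b) * qpoch q (b * q) k.
Proof.
rewrite /qpoch big_ord_recl expr0 mulr1; congr (_ * _).
by apply: eq_bigr => l _; rewrite exprS mulrA.
Qed.

(** The coefficient of (y; q)_k in R_i, with n = q^-N arbitrary. *)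
Definition qcoef (a n : F) (i k : nat) : F :=
  qpoch q (q ^- i) k / (qpoch q q k * qpoch q n k) * (a * q ^+ i.+1) ^+ k.

Lemma qcoef0 a n i : qcoef a n i 0 = 1.
Proof. by rewrite /qcoef !qpoch0 expr0 !mulr1 divr1. Qed.

Lemma qcoefS a n i k : qcoef a n i k.+1 = qcoef a n i k * ((1 - q ^- i * q ^+ k)
  * (a * q ^+ i.+1) / ((1 - q ^+ k.+1) * (1 - n * q ^+ k))).
Proof. by rewrite /qcoef !qpochS !invfM !exprS; ring. Qed.

Lemma qcoef_diag a n i k : qcoef a n i.+1 k.+1 = qcoef a n i k *
  ((1 - q ^- i.+1) * a * q ^+ i.+2 * q ^+ k
     / ((1 - q ^+ k.+1) * (1 - n * q ^+ k))).
Proof.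
rewrite /qcoef qpochSl !(qpochS _ k) !invfM.
have -> : q ^- i.+1 * q = q ^- i by rewrite exprS invfM mulrC mulVKf.
have -> : (a * q ^+ i.+2) ^+ k.+1
    = (a * q ^+ i.+1) ^+ k * q ^+ k * (a * q ^+ i.+2).
  by rewrite exprSr -exprMn -mulrA -(exprSr q).
by rewrite !exprS; ring.
Qed.

(** The case i = 0 holds too, both sides being zero. *)
Lemma qcoef_pred a n i k :
  (1 - q ^- i) * qcoef a n i.-1 k = qcoef a n i k * (q ^- k - q ^- i).
Proof.
have qX0 j : q ^+ j != 0 by rewrite expf_neq0.
case: i => [|i] /=.
  rewrite expr0 invr1 subrr mul0r; case: k => [|k].
    by rewrite expr0 invr1 subrr mulr0.
  rewrite /qcoef; suff -> : qpoch q (q ^- 0) k.+1 = 0 by rewrite !mul0r.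
  by rewrite qpochSl expr0 invr1 subrr mul0r.
have h : (1 - q ^- i.+1) * qpoch q (q ^- i) k
    = qpoch q (q ^- i.+1) k * (1 - q ^- i.+1 * q ^+ k).
  rewrite -qpochS qpochSl; congr (_ * qpoch q _ k).
  by rewrite exprS invfM mulrC mulVKf.
have e : (a * q ^+ i.+2) ^+ k = (a * q ^+ i.+1) ^+ k * q ^+ k.
  by rewrite -exprMn -mulrA -exprSr.
rewrite /qcoef e; move: ((qpoch q q k * _)^-1) (qpoch q (q ^- i.+1) k) h => d p h.
move: ((a * _) ^+ k) => z.
transitivity (((1 - q ^- i.+1) * qpoch q (q ^- i) k) * (d * z)); first by ring.
by rewrite h; field; rewrite !qX0.
Qed.

Lemma qcoef_gt a n i k : (i < k)%N -> qcoef a n i k = 0.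
Proof.
move=> lik; rewrite /qcoef; suff -> : qpoch q (q ^- i) k = 0 by rewrite !mul0r.
apply/eqP; rewrite /qpoch prodf_seq_eq0; apply/hasP.
exists (Ordinal lik) => /=; first by rewrite mem_index_enum.
by rewrite mulVf ?subrr // expf_neq0.
Qed.

Lemma qcoef_scale a n i k : qcoef (q * a) n i k = q ^+ k * qcoef a n i k.
Proof. by rewrite /qcoef -[q * a * _]mulrA (exprMn _ q) mulrCA. Qed.

Lemma qcoef_step a n i k : 1 - n != 0 -> 1 - n * q ^+ k != 0 ->
  qcoef a (n * q) i k = qcoef a n i k * ((1 - n) / (1 - n * q ^+ k)).
Proof.
move=> h1 hk; have h : (1 - n) * qpoch q (n * q) k
    = qpoch q n k * (1 - n * q ^+ k) by rewrite -qpochS qpochSl.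
rewrite /qcoef; have -> : qpoch q (n * q) k = qpoch q n k * (1 - n * q ^+ k) / (1 - n).
  by rewrite -h mulrAC mulfV // mul1r.
by rewrite !invfM invrK; ring.
Qed.

Lemma one_subq_neq0 k : 1 - q ^+ k.+1 != 0.
Proof. by rewrite subr_eq0 eq_sym; apply: qroot. Qed.

(** R_i as a function of y = q^-x. *)
Definition qqKsum a n i y : F := \sum_(k < i.+1) qcoef a n i k * qpoch q y k.

Lemma qqKsum_widen K a n i y : (i < K)%N ->
  qqKsum a n i y = \sum_(k < K) qcoef a n i k * qpoch q y k.
Proof.
move=> lt; rewrite /qqKsum (big_ord_widen K (fun k => qcoef a n i k * qpoch q y k)) //.
rewrite [RHS](bigID (fun k : 'I_K => (k < i.+1)%N)) /= [X in _ + X]big1 ?addr0 //.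
by move=> k; rewrite -leqNgt => /qcoef_gt ->; rewrite mul0r.
Qed.

Lemma qqKsum_I a n i y : qqKsum a n i y =
  q ^- i * qqKsum (q * a) n i y + (1 - q ^- i) * qqKsum (q * a) n i.-1 y.
Proof.
rewrite [qqKsum _ _ i.-1 _](@qqKsum_widen i.+1); last by case: (i).
rewrite /qqKsum !mulr_sumr -big_split /=; apply: eq_bigr => k _.
rewrite [(1 - _) * (qcoef _ _ _ _ * _)]mulrA qcoef_pred qcoef_scale; field.
by rewrite !expf_neq0.
Qed.

(** The sums run up to K and not to i, because for i = N the relation only holds
where (y; q)_N vanishes. *)
Lemma qqKsum_II K a n i y : (forall k, (k < K)%N -> 1 - n * q ^+ k != 0) ->
  1 - n != 0 ->
  \sum_(k < K) qcoef a n i k * qpoch q y k =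
   (n - q ^- i) / (n - 1) * \sum_(k < K) qcoef (q * a) (n * q) i k * qpoch q y k
  + (1 - q ^- i) / (1 - n)
     * \sum_(k < K) qcoef (q * a) (n * q) i.-1 k * qpoch q y k.
Proof.
move=> hn h1; have h1' : n - 1 != 0 by rewrite -opprB oppr_eq0.
rewrite !mulr_sumr -big_split /=; apply: eq_bigr => k _.
rewrite [X in _ = _ + X](_ : _ = (1 - q ^- i) * qcoef (q * a) (n * q) i.-1 k
   / (1 - n) * qpoch q y k); last by ring.
have hk := hn k (ltn_ord k); rewrite qcoef_pred qcoef_scale qcoef_step //.
by field; rewrite h1 h1' hk !expf_neq0.
Qed.

(** Change of basis from (y; q)_k to (q y; q)_k, by
(y; q)_k = q^-k ((q y; q)_k - (1 - q^k) (q y; q)_(k-1)). *)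
Lemma sum_shift (c : nat -> F) K y :
  \sum_(k < K.+1) c k * qpoch q y k =
  \sum_(k < K) (q ^- k * c k - q ^- k.+1 * (1 - q ^+ k.+1) * c k.+1)
     * qpoch q (y * q) k + q ^- K * c K * qpoch q (y * q) K.
Proof.
have hZ k : qpoch q y k.+1 = q ^- k.+1 *
    (qpoch q (y * q) k.+1 - (1 - q ^+ k.+1) * qpoch q (y * q) k).
  rewrite qpochSl qpochS -[y * q * _]mulrA -exprS; field.
  by rewrite expf_neq0.
elim: K => [|K IH]; first by rewrite big_ord1 big_ord0 !qpoch0 expr0 ?invr1; ring.
by rewrite big_ord_recr IH big_ord_recr /= hZ; ring.
Qed.

Lemma qqKsum_III K a n i y : (forall k, (k < K)%N -> 1 - n * q ^+ k != 0) ->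
  1 - n != 0 -> n != 0 -> qcoef a n i K * qpoch q (y * q) K = 0 ->
  (1 - n^-1) * \sum_(k < K.+1) qcoef a n i k * qpoch q y k =
   (1 - (n * q ^+ i)^-1)
      * \sum_(k < K) qcoef a (n * q) i k * qpoch q (y * q) k
  + - n^-1 * (1 - q ^- i) * (1 - a * q ^+ i)
     * \sum_(k < K) qcoef a (n * q) i.-1 k * qpoch q (y * q) k.
Proof.
move=> hn h1 n0 hK.
have e : q ^- K * qcoef a n i K * qpoch q (y * q) K = 0 by rewrite -mulrA hK mulr0.
rewrite sum_shift e addr0.
rewrite !mulr_sumr -big_split /=; apply: eq_bigr => k _.
rewrite [X in _ = _ + X](_ : _ = (1 - q ^- i) * qcoef a (n * q) i.-1 k
   * (- n^-1 * (1 - a * q ^+ i)) * qpoch q (y * q) k); last by ring.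
have hk := hn k (ltn_ord k); rewrite qcoef_pred qcoef_step // qcoefS.
have := one_subq_neq0 k; move: hk.
have : q ^+ k != 0 by rewrite expf_neq0.
have : q ^+ i != 0 by rewrite expf_neq0.
rewrite !exprS; move: (q ^+ k) (q ^+ i) => Q U U0 Q0 hQ hq1.
by field; rewrite ?h1 ?hQ ?hq1 ?U0 ?Q0 ?q0 ?n0.
Qed.

(** The difference of the two sides telescopes. *)
Lemma qqKsum_I_assoc K a n i y : (forall k, (k < K)%N -> 1 - n * q ^+ k != 0) ->
  \sum_(k < K.+1) ((n - a * q * y) * (qcoef (q * a) n i k * qpoch q y k)
     - (q ^- i - a * q) * (qcoef a n i k * qpoch q y k)
     - (n - q ^- i) * (qcoef a n i.+1 k * qpoch q y k))
  = a * q * qcoef a n i K * qpoch q y K.+1.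
Proof.
elim: K => [_|K IH hn].
  by rewrite big_ord1 !qcoef0 qpochS !qpoch0 expr0 ?invr1; ring.
rewrite big_ord_recr /= IH; last by move=> k /ltnW; apply: hn.
rewrite (qpochS _ K.+1) qcoef_scale qcoef_diag qcoefS.
have := one_subq_neq0 K; have := hn K (leqnn _).
have : q ^+ K != 0 by rewrite expf_neq0.
have : q ^+ i != 0 by rewrite expf_neq0.
rewrite !exprS; move: (q ^+ K) (q ^+ i) => Q U U0 Q0 hQ hq1.
by field; rewrite ?hQ ?hq1 ?U0 ?q0.
Qed.

(** The difference of the two sides telescopes. *)
Lemma qqKsum_II_assoc K a n i y : (forall k, (k <= K)%N -> 1 - n * q ^+ k != 0) ->
  n != 0 ->
  \sum_(k < K.+1) (a * q * (1 - y / n) / (1 - n^-1)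
        * (qcoef (q * a) (n * q) i k * qpoch q y k)
     - (a * q - q ^- i) * (qcoef a n i k * qpoch q y k)
     - q ^- i * (qcoef a n i.+1 k * qpoch q y k))
  = - (a * q * qcoef a n i K / (1 - n * q ^+ K)) * qpoch q y K.+1.
Proof.
move=> + n0; elim: K => [|K IH] hn.
  have h1 : 1 - n != 0 by have := hn 0%N isT; rewrite expr0 mulr1.
  have h1' : n - 1 != 0 by rewrite -opprB oppr_eq0.
  rewrite big_ord1 !qcoef0 qpochS !qpoch0 expr0 mulr1; field.
  by rewrite n0 h1 h1' expf_neq0.
rewrite big_ord_recr /= IH; last by move=> k /leqW; apply: hn.
have h1 : 1 - n != 0 by have := hn 0%N isT; rewrite expr0 mulr1.
have h1' : n - 1 != 0 by rewrite -opprB oppr_eq0.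
have hK := hn K.+1 (leqnn _).
rewrite qcoef_step // (qpochS _ K.+1) qcoef_scale qcoef_diag qcoefS.
have := one_subq_neq0 K; have := hn K (leqnSn _); move: hK.
have : q ^+ K != 0 by rewrite expf_neq0.
have : q ^+ i != 0 by rewrite expf_neq0.
rewrite !exprS; move: (q ^+ K) (q ^+ i) => Q U U0 Q0 hK hQ hq1.
by field; rewrite ?hQ ?hq1 ?U0 ?q0 ?n0 ?h1 ?h1' ?hK.
Qed.

Lemma qqKsum_III_assoc a n i y : (forall k, (k <= i)%N -> 1 - n * q ^+ k != 0) ->
  n != 0 ->
  a * q / n * ((1 - y) / (1 - n^-1)) * qqKsum a (n * q) i (y * q) =
  - q ^- i * qqKsum a n i y + q ^- i * qqKsum a n i.+1 y.
Proof.
move=> hn n0.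
have h1 : 1 - n != 0 by have := hn 0%N isT; rewrite expr0 mulr1.
have h1' : n - 1 != 0 by rewrite -opprB oppr_eq0.
rewrite [qqKsum _ _ i y](@qqKsum_widen i.+2) // /qqKsum ![\sum_(k < i.+2) _]big_ord_recl.
rewrite !qcoef0 !mulrDr addrACA -mulrDl addNr mul0r add0r.
rewrite !mulr_sumr -big_split /=; apply: eq_bigr => k _.
have hk := hn k (ltn_ord k); rewrite /bump leq0n add1n qpochSl qcoef_diag qcoefS qcoef_step // ?hk //.
have := one_subq_neq0 k; move: hk.
have : q ^+ k != 0 by rewrite expf_neq0.
have : q ^+ i != 0 by rewrite expf_neq0.
rewrite !exprS; move: (q ^+ k) (q ^+ i) => Q U U0 Q0 hQ hq1.
by field; rewrite ?hQ ?hq1 ?U0 ?q0 ?n0 ?h1 ?h1'.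
Qed.

End Expansion.

Lemma in_rangeE (F : fieldType) (g : family F) (x : int) : in_range g x ->
  exists2 j : nat, x = j%:Z & (j <= fN g)%N.
Proof. by case: x => // j /= h; exists j. Qed.

(** As coefficients with index out of range vanish, the conditional sum of a
contiguity relation is an unconditional sum. *)
Lemma sum_epsA2 (F : fieldType) (g : family F) (Phi : int -> nat -> F) (h : nat -> F) (i : nat) :
  (forall e, e \in epsA2 -> ~~ in_range g (i%:Z + e) -> Phi e i = 0) ->
  \sum_(e <- epsA2 | in_range g (i%:Z + e)) Phi e i * h (absz (i%:Z + e))
  = Phi 0 i * h i + Phi (-1) i * h i.-1.
Proof.
move=> h0; have z e X (j : nat) : e \in epsA2 ->
    (0 <= i%:Z + e -> absz (i%:Z + e) = j) ->
    (if in_range g (i%:Z + e) then Phi e i * h (absz (i%:Z + e)) + X else X)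
    = Phi e i * h j + X.
  move=> he hj; case: ifP => [/andP [/hj -> //]|/negbT /(h0 _ he) ->].
  by rewrite mul0r add0r.
rewrite /epsA2 !big_cons big_nil (z _ _ i) ?(z _ _ i.-1) ?addr0 //; lia.
Qed.

Lemma sum_epsA2_assoc (F : fieldType) (g : family F) (Phi : int -> nat -> F) (h : nat -> F) (i : nat) :
  (forall e, e \in epsA2_assoc -> ~~ in_range g (i%:Z + e) -> Phi e i = 0) ->
  \sum_(e <- epsA2_assoc | in_range g (i%:Z + e)) Phi e i * h (absz (i%:Z + e))
  = Phi 1 i * h i.+1 + Phi 0 i * h i.
Proof.
move=> h0; have z e X (j : nat) : e \in epsA2_assoc ->
    (0 <= i%:Z + e -> absz (i%:Z + e) = j) ->
    (if in_range g (i%:Z + e) then Phi e i * h (absz (i%:Z + e)) + X else X)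
    = Phi e i * h j + X.
  move=> he hj; case: ifP => [/andP [/hj -> //]|/negbT /(h0 _ he) ->].
  by rewrite mul0r add0r.
rewrite /epsA2_assoc !big_cons big_nil (z _ _ i.+1) ?(z _ _ i) ?addr0 //; lia.
Qed.

Section Relations.
Variables (F : fieldType) (q : F).
Hypotheses (q0 : q != 0) (qroot : forall k : nat, (0 < k)%N -> q ^+ k != 1).

Lemma fpolyE (f : family F) i x :
  fpoly q f i x = qqKsum q (falpha f) (q ^- fN f) i (q ^ (- (x + feta f))).
Proof.
rewrite /fpoly /qqK /qhyp /qqKsum; apply: eq_bigr => k _.
by rewrite /qcoef /qpochs !big_cons !big_nil !mulr1; ring.
Qed.

Lemma qN_neq0 N k : (k < N)%N -> 1 - q ^- N * q ^+ k != 0.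
Proof.
move=> lt; rewrite subr_eq0 eq_sym -(subnK (ltnW lt)) exprD invfM.
by rewrite mulfVK ?expf_neq0 // invr_eq1; apply: qroot; rewrite subn_gt0.
Qed.

Lemma q1N_neq0 N : (0 < N)%N -> 1 - q ^- N != 0.
Proof. by move/qN_neq0; rewrite expr0 mulr1. Qed.

Lemma qpoch_lattice (j K : nat) : (j < K)%N -> qpoch q (q ^ (- j%:Z)) K = 0.
Proof.
move=> lt; apply/eqP; rewrite /qpoch prodf_seq_eq0; apply/hasP.
exists (Ordinal lt) => /=; first by rewrite mem_index_enum.
by rewrite -exprnN mulVf ?subrr // expf_neq0.
Qed.

Lemma contiguity_ext eps (f g : family F) lam lam' Phi :
  lam =1 lam' -> contiguity q eps f g lam Phi -> contiguity q eps f g lam' Phi.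
Proof. by move=> e [h0 h1]; split=> // i x hi hx; rewrite -e; apply: h1. Qed.

Lemma contiguityI eta a N : contiguity q epsA2 (Family eta a N)
  (Family eta (q * a) N) (fun _ => 1)
  (coefs 0 (fun i => q ^- i) (fun i => 1 - q ^- i)).
Proof.
have Z (i : nat) (e : int) : (i <= N)%N -> e \in epsA2 ->
     ~~ in_range (Family eta (q * a) N) (i%:Z + e) ->
     coefs 0 (fun i => q ^- i) (fun i => 1 - q ^- i) e i = 0.
  rewrite !inE /in_range /= => hi /orP [] /eqP -> h; first by lia.
  have -> : i = 0%N by lia.
  by rewrite /coefs /= expr0 invr1 subrr.
split=> // i x hi _; rewrite (sum_epsA2 (fun j => fpoly q _ j x)); last by move=> e; apply: Z.
by rewrite !fpolyE /coefs /= mul1r -qqKsum_I.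
Qed.

Lemma contiguityI_assoc eta a N : contiguity q epsA2_assoc
  (Family eta (q * a) N) (Family eta a N)
  (fun x => q ^- N - a * q ^ (1 - (x + eta)))
  (coefs 0 (fun i => q ^- i - a * q) (fun i => q ^- N - q ^- i)).
Proof.
have Z (i : nat) (e : int) : (i <= N)%N -> e \in epsA2_assoc ->
     ~~ in_range (Family eta a N) (i%:Z + e) ->
     coefs 0 (fun i => q ^- i - a * q) (fun i => q ^- N - q ^- i) e i = 0.
  rewrite !inE /in_range /= => hi /orP [] /eqP -> h; last by lia.
  by have -> : i = N by [lia]; rewrite /coefs /= subrr.
split=> // i x /= hi hx; rewrite (sum_epsA2_assoc (fun j => fpoly q _ j x)); last by move=> e; apply: Z.
rewrite !fpolyE /coefs /=.
have -> : a * q ^ (1 - (x + eta)) = a * q * q ^ (- (x + eta)).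
  by rewrite expfzDr // expr1z mulrA.
set n := q ^- N; set y := q ^ (- (x + eta)).
have [K [h1 h2 h3]] : exists K, [/\ (K <= N)%N, (i < K.+1)%N &
    a * q * qcoef q a n i K * qpoch q y K.+1 = 0 /\ ((n - q ^- i = 0) \/ (i < K)%N)].
  move: hi; rewrite leq_eqVlt => /orP [/eqP iN|lt]; last first.
    by exists i.+1; split=> //; rewrite qcoef_gt // mulr0 mul0r; split=> //; right.
  exists N; rewrite iN; split=> //; rewrite subrr; split; last by left.
  have /in_rangeE [j e jN] : in_range (Family eta a N) (x + eta).
    by case: hx => [/(_ 1 isT)|//]; rewrite iN; lia.
  by rewrite /y e qpoch_lattice // mulr0.
have := @qqKsum_I_assoc _ q q0 qroot K a n i y.
rewrite h3.1 => /(_ (fun k hk => qN_neq0 (leq_trans hk h1))) /eqP.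
rewrite !sumrB -!mulr_sumr -!(qqKsum_widen q0 _ n y h2).
rewrite subr_eq0 subr_eq => /eqP ->.
case: h3.2 => [->|lt]; first by rewrite !mul0r.
by rewrite (qqKsum_widen q0 _ n y (lt : (i.+1 < K.+1)%N)).
Qed.

Lemma qN_exp N i : q ^ (N%:Z - i%:Z) = (q ^- N * q ^+ i)^-1.
Proof. by rewrite expfzDr // -exprnN invfM invrK. Qed.

Lemma qN_pred N : (0 < N)%N -> q ^- N.-1 = q ^- N * q.
Proof. by case: N => // N _; rewrite exprS invfM mulrC mulVKf. Qed.

Lemma qshift (x e : int) : q ^ (- (x + (e - 1))) = q ^ (- (x + e)) * q.
Proof.
have -> : - (x + (e - 1)) = - (x + e) + 1 by lia.
by rewrite expfzDr // expr1z.
Qed.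

Lemma contiguityII eta a N : (0 < N)%N -> contiguity q epsA2 (Family eta a N)
  (Family eta (q * a) N.-1) (fun _ => 1)
  (coefs 0 (fun i => (1 - q ^ (N%:Z - i%:Z)) / (1 - q ^+ N))
           (fun i => (1 - q ^- i) / (1 - q ^- N))).
Proof.
move=> N0; set Phi := coefs _ _ _.
have Z (i : nat) (e : int) : (i <= N)%N -> e \in epsA2 ->
    ~~ in_range (Family eta (q * a) N.-1) (i%:Z + e) -> Phi e i = 0.
  rewrite !inE /in_range /= => hi /orP [] /eqP -> h.
    by have -> : i = N by [lia]; rewrite /Phi /coefs /= subrr expr0z subrr mul0r.
  have -> : i = 0%N by lia.
  by rewrite /Phi /coefs /= expr0 invr1 subrr mul0r.
split=> // i x /= hi hx.
rewrite (sum_epsA2 (fun j => fpoly q _ j x)); last by move=> e; apply: Z.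
rewrite !fpolyE /Phi /coefs /= mul1r qN_exp (qN_pred N0).
set n := q ^- N; set y := q ^ (- (x + eta)).
have -> : q ^+ N = n^-1 by rewrite invrK.
have n0 : n != 0 by rewrite invr_neq0 // expf_neq0.
have n1 : 1 - n != 0 by apply: q1N_neq0.
have n1' : n - 1 != 0 by rewrite -opprB oppr_eq0.
have qi0 : q ^+ i != 0 by rewrite expf_neq0.
have eA : (1 - (n * q ^+ i)^-1) / (1 - n^-1) = (n - q ^- i) / (n - 1).
  by field; rewrite ?n0 ?n1 ?n1' ?qi0.
rewrite eA; move: hi; rewrite leq_eqVlt => /orP [/eqP iN|lt].
  have yN : qpoch q y N = 0.
    have /in_rangeE [j e /= jN] :
        in_range (Family eta (q * a) N.-1) (x + eta).
      by case: hx => [/(_ 0 isT)|//]; rewrite iN; lia.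
    by rewrite /y e qpoch_lattice //; lia.
  have := @qqKsum_II _ q q0 N a n i y (@qN_neq0 N) n1.
  rewrite (_ : n - q ^- i = 0) ?iN ?subrr // !mul0r !add0r.
  have lt1 : (N.-1 < N)%N by lia.
  by rewrite -(qqKsum_widen q0 _ _ _ lt1) => <-; rewrite /qqKsum big_ord_recr /= yN mulr0 addr0.
have := @qqKsum_II _ q q0 i.+1 a n i y (fun k hk => @qN_neq0 N k (leq_trans hk lt)) n1.
by rewrite -!qqKsum_widen //; case: (i).
Qed.

Lemma contiguityII_assoc eta a N : (0 < N)%N -> contiguity q epsA2_assoc
  (Family eta (q * a) N.-1) (Family eta a N)
  (fun x => a * q * (1 - q ^ (N%:Z - (x + eta))) / (1 - q ^+ N))
  (coefs 0 (fun i => a * q - q ^- i) (fun i => q ^- i)).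
Proof.
move=> N0; have Z (i : nat) (e : int) : (i <= N.-1)%N -> e \in epsA2_assoc ->
     ~~ in_range (Family eta a N) (i%:Z + e) ->
     coefs 0 (fun i => a * q - q ^- i) (fun i => q ^- i) e i = 0.
  by rewrite !inE /in_range /= => hi /orP [] /eqP -> h; lia.
split=> // i x /= hi hx.
rewrite (sum_epsA2_assoc (fun j => fpoly q _ j x)); last by move=> e; apply: Z.
rewrite !fpolyE /coefs /= (qN_pred N0) expfzDr //.
set n := q ^- N; set y := q ^ (- (x + eta)).
have -> : q ^ N = n^-1 by rewrite invrK.
have -> : q ^+ N = n^-1 by rewrite invrK.
have n0 : n != 0 by rewrite invr_neq0 // expf_neq0.
have iN : (i < N)%N by lia.
have hn k : (k <= i)%N -> 1 - n * q ^+ k != 0.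
  by move=> hk; apply: qN_neq0; apply: leq_ltn_trans hk iN.
have := @qqKsum_II_assoc _ q q0 qroot i a n i y hn n0.
have hi' := hn i (leqnn i).
have -> : n^-1 * y = y / n by rewrite mulrC.
rewrite !sumrB -!mulr_sumr -!(qqKsum_widen q0 _ _ y (ltnSn i)) => /eqP.
rewrite !subr_eq => /eqP ->.
have -> : qqKsum q a n i.+1 y = \sum_(k < i.+1) qcoef q a n i.+1 k * qpoch q y k
    + qcoef q a n i.+1 i.+1 * qpoch q y i.+1 by rewrite /qqKsum big_ord_recr.
rewrite mulrDr (_ : q ^- i * (qcoef _ _ _ _ _ * _) =
  - (a * q * qcoef q a n i i / (1 - n * q ^+ i)) * qpoch q y i.+1); first by ring.
rewrite qcoef_diag //; have := one_subq_neq0 qroot i; move: hi'.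
have : q ^+ i != 0 by rewrite expf_neq0.
rewrite !exprS; move: (q ^+ i) => Q Q0 hQ hq1.
by field; rewrite ?hQ ?hq1 ?q0 ?Q0.
Qed.

Lemma contiguityIII eta a N : (0 < N)%N -> contiguity q epsA2 (Family eta a N)
  (Family (eta - 1) a N.-1) (fun _ => 1 - q ^+ N)
  (coefs 0 (fun i => 1 - q ^ (N%:Z - i%:Z))
     (fun i => - q ^+ N * (1 - q ^- i) * (1 - a * q ^+ i))).
Proof.
move=> N0; set Phi := coefs _ _ _.
have Z (i : nat) (e : int) : (i <= N)%N -> e \in epsA2 ->
    ~~ in_range (Family (eta - 1) a N.-1) (i%:Z + e) -> Phi e i = 0.
  rewrite !inE /in_range /= => hi /orP [] /eqP -> h.
    by have -> : i = N by [lia]; rewrite /Phi /coefs /= subrr expr0z subrr.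
  have -> : i = 0%N by lia.
  by rewrite /Phi /coefs /= expr0 invr1 subrr mulr0 mul0r.
split=> // i x /= hi hx.
rewrite (sum_epsA2 (fun j => fpoly q _ j x)); last by move=> e; apply: Z.
rewrite !fpolyE /Phi /coefs /= qN_exp (qN_pred N0).
set n := q ^- N; set y := q ^ (- (x + eta)).
have -> : q ^ (- (x + (eta - 1))) = y * q.
  exact: qshift.
have -> : q ^+ N = n^-1 by rewrite invrK.
have n0 : n != 0 by rewrite invr_neq0 // expf_neq0.
have n1 : 1 - n != 0 by apply: q1N_neq0.
have [K [hK iK hK0 hN]] : exists K, [/\ (K <= N)%N, (i < K.+1)%N,
    qcoef q a n i K * qpoch q (y * q) K = 0 & (K = N /\ i = N) \/ (i < K)%N].
  move: hi; rewrite leq_eqVlt => /orP [/eqP iN|lt]; last first.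
    by exists i.+1; split=> //; [rewrite qcoef_gt // mul0r|right].
  exists N; rewrite iN; split=> //; last by left.
  have /in_rangeE [j e /= jN] :
      in_range (Family (eta - 1) a N.-1) (x + (eta - 1)).
    by case: hx => [/(_ 0 isT)|//]; rewrite iN; lia.
  have -> : y * q = q ^ (- j%:Z).
    by rewrite -e qshift.
  by rewrite qpoch_lattice ?mulr0 //; lia.
have := @qqKsum_III _ q q0 qroot K a n i y
  (fun k hk => @qN_neq0 N k (leq_trans hk hK)) n1 n0 hK0.
rewrite -(qqKsum_widen q0 _ _ y iK) => ->.
have lt1 : (i.-1 < K)%N by lia.
rewrite -(qqKsum_widen q0 _ _ _ lt1).
case: hN => [[-> iN]|lt]; last by rewrite -qqKsum_widen.
by rewrite iN (_ : 1 - _ = 0) ?mul0r // mulVf ?expf_neq0 // invr1 subrr.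
Qed.

Lemma contiguityIII_assoc eta a N : (0 < N)%N -> contiguity q epsA2_assoc
  (Family (eta - 1) a N.-1) (Family eta a N)
  (fun x => a * q ^+ N.+1 * ((1 - q ^ (- (x + eta))) / (1 - q ^+ N)))
  (coefs 0 (fun i => - q ^- i) (fun i => q ^- i)).
Proof.
move=> N0; have Z (i : nat) (e : int) : (i <= N.-1)%N -> e \in epsA2_assoc ->
     ~~ in_range (Family eta a N) (i%:Z + e) ->
     coefs 0 (fun i => - q ^- i) (fun i => q ^- i) e i = 0.
  by rewrite !inE /in_range /= => hi /orP [] /eqP -> h; lia.
split=> // i x /= hi hx.
rewrite (sum_epsA2_assoc (fun j => fpoly q _ j x)); last by move=> e; apply: Z.
rewrite !fpolyE /coefs /= (qN_pred N0) [q ^+ N.+1]exprSr.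
set n := q ^- N; set y := q ^ (- (x + eta)).
have -> : q ^ (- (x + (eta - 1))) = y * q.
  exact: qshift.
have -> : q ^+ N = n^-1 by rewrite invrK.
have n0 : n != 0 by rewrite invr_neq0 // expf_neq0.
have iN : (i < N)%N by lia.
have hn k : (k <= i)%N -> 1 - n * q ^+ k != 0.
  by move=> hk; apply: qN_neq0; apply: leq_ltn_trans hk iN.
have h := @qqKsum_III_assoc _ q q0 qroot a n i y hn n0.
by rewrite [RHS]addrC -h; ring.
Qed.

End Relations.

(** * Moments of the source and of the target *)
Section Orthogonality.
Variables (F : fieldType) (q : F).
Hypotheses (q0 : q != 0) (qroot : forall k : nat, (0 < k)%N -> q ^+ k != 1).

Lemma qpochN_neq0 N k : (k <= N)%N -> qpoch q (q ^- N) k != 0.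
Proof.
move=> le; rewrite /qpoch; apply/prodf_neq0 => l _.
by apply: qN_neq0 => //; apply: leq_trans le.
Qed.

Lemma mul_qpoch y k : y * qpoch q y k = q ^- k * (qpoch q y k - qpoch q y k.+1).
Proof. by rewrite qpochS; field; rewrite expf_neq0. Qed.

(** The terminating q-binomial theorem. *)
Lemma qbinomial i z : \sum_(k < i.+1) qpoch q (q ^- i) k / qpoch q q k * z ^+ k
  = \prod_(l < i) (1 - z * q ^- l.+1).
Proof.
have qq0 k : qpoch q q k != 0.
  by apply/prodf_neq0 => l _; rewrite -exprS one_subq_neq0.
pose a i k := qpoch q (q ^- i) k / qpoch q q k.
have aS j k : a j.+1 k.+1 = a j k.+1 - q ^- j.+1 * a j k.
  rewrite /a qpochSl !(qpochS _ _ k).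
  have -> : q ^- j.+1 * q = q ^- j by rewrite exprS invfM mulrC mulVKf.
  have := one_subq_neq0 qroot k; have := qq0 k.
  have : q ^+ k != 0 by rewrite expf_neq0.
  have : q ^+ j != 0 by rewrite expf_neq0.
  rewrite !exprS; move: (q ^+ k) (q ^+ j) => Q U U0 Q0 h1 h2.
  by field; rewrite h1 h2 U0 q0.
have a_gt j : a j j.+1 = 0.
  by rewrite /a qpochS mulVf ?expf_neq0 // subrr mulr0 mul0r.
rewrite -[LHS]/(\sum_(k < i.+1) a i k * z ^+ k).
elim: i => [|i IH]; first by rewrite big_ord1 big_ord0 /a !qpoch0 divr1 mulr1.
rewrite [RHS]big_ord_recr /= -IH big_ord_recl /=.
under eq_bigr => k _ do rewrite /bump leq0n add1n aS mulrBl.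
rewrite sumrB big_ord_recr /= a_gt mul0r addr0.
have e1 : \sum_(k < i.+1) a i k * z ^+ k
    = a i.+1 0%N * z ^+ 0 + \sum_(k < i) a i k.+1 * z ^+ k.+1.
  by rewrite big_ord_recl /a !qpoch0.
have e2 : \sum_(k < i.+1) q ^- i.+1 * a i k * z ^+ k.+1
    = z * q ^- i.+1 * \sum_(k < i.+1) a i k * z ^+ k.
  by rewrite mulr_sumr; apply: eq_bigr => k _; rewrite (exprS z); ring.
by rewrite e2 addrA -e1; ring.
Qed.

(** The sum is that of the q-binomial theorem at z = q^(i-j), where the product
vanishes. *)
Lemma qcoef_orth (a n : F) i j : a != 0 -> (forall k, (k <= i)%N -> qpoch q n k != 0) ->
  (j < i)%N ->
  \sum_(k < i.+1) qcoef q a n i k * (qpoch q n k / (a * q) ^+ k) * (q ^- k) ^+ j = 0.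
Proof.
move=> a0 hn lt; have e0 : q ^+ (i - j) = q ^+ i * q ^- j.
  by rewrite -{2}(subnK (ltnW lt)) exprD mulfK // expf_neq0.
rewrite (eq_bigr (fun k : 'I_i.+1 => qpoch q (q ^- i) k / qpoch q q k
   * (q ^+ (i - j)) ^+ k)).
  rewrite qbinomial; have lt' : (i - j.+1 < i)%N by lia.
  apply/eqP; rewrite prodf_seq_eq0; apply/hasP; exists (Ordinal lt') => /=.
    by rewrite mem_index_enum.
  have -> : (i - j.+1).+1 = (i - j)%N by lia.
  by rewrite mulfV ?subrr // expf_neq0.
move=> k _; rewrite /qcoef; have hk := hn k (ltn_ord k).
have -> : (q ^- k) ^+ j = (q ^- j) ^+ k by rewrite -!exprVn -!exprM mulnC.
have -> : (q ^+ (i - j)) ^+ k = (q ^+ i) ^+ k * (q ^- j) ^+ k.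
  by rewrite -exprMn -e0.
have -> : (a * q ^+ i.+1) ^+ k = (q ^+ i) ^+ k * (a * q) ^+ k.
  by rewrite -exprMn exprS; congr (_ ^+ _); ring.
have : (a * q) ^+ k != 0 by rewrite expf_neq0 // mulf_neq0.
rewrite invfM; move: ((a * q) ^+ k) ((q ^+ i) ^+ k) ((q ^- j) ^+ k)
  (qpoch q q k)^-1 hk => u v w z; move: (qpoch q n k) => p p0 u0.
by field; rewrite p0 u0.
Qed.

End Orthogonality.

Section Functional.
Variables (F : fieldType) (q beta : F) (M : nat).
Hypotheses (q0 : q != 0) (qroot : forall k : nat, (0 < k)%N -> q ^+ k != 1).
Hypothesis b0 : beta != 0.
Let m := q ^- M.

(** The weight of the target family with parameters beta and M at the lattice
point j, normalised by weight M = 1; for j < M it satisfies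
(1 - m q^j) weight j = (1 - q^-(j+1)) (beta q - m q^(j+1)) weight (j+1). *)
Definition weight (j : nat) : F := \prod_(j <= k < M)
  ((1 - q ^- k.+1) * (beta * q - m * q ^+ k.+1) / (1 - m * q ^+ k)).

(** The functional h |-> sum of weight j h j over the lattice 0, ..., M. *)
Definition lsum (h : nat -> F) : F := \sum_(j < M.+1) weight j * h j.

Lemma eq_lsum h h' : (forall j, (j <= M)%N -> h j = h' j) -> lsum h = lsum h'.
Proof. by move=> e; apply: eq_bigr => j _; rewrite e // -ltnS. Qed.

Lemma lsumD h h' : lsum (fun j => h j + h' j) = lsum h + lsum h'.
Proof. by rewrite /lsum -big_split; apply: eq_bigr => j _ /=; rewrite mulrDr. Qed.

Lemma lsumZ c h : lsum (fun j => c * h j) = c * lsum h.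
Proof. by rewrite /lsum mulr_sumr; apply: eq_bigr => j _; rewrite mulrCA. Qed.

Lemma lsum_sum (I : Type) (r : seq I) (Q : pred I) (c : I -> F) (h : I -> nat -> F) :
  lsum (fun j => \sum_(i <- r | Q i) c i * h i j) =
  \sum_(i <- r | Q i) c i * lsum (h i).
Proof.
rewrite /lsum (eq_bigr (fun j : 'I_M.+1 =>
    \sum_(i <- r | Q i) c i * (weight j * h i j))).
  by rewrite exchange_big; apply: eq_bigr => i _ /=; rewrite mulr_sumr.
by move=> j _; rewrite mulr_sumr; apply: eq_bigr => i _; rewrite mulrCA.
Qed.

(** The recurrence of the weights, summed against h; at j = 0 the value of h at
0.-1 = 0 has coefficient zero. *)
Lemma pearson (h : nat -> F) :
  lsum (fun j => (1 - q ^- j) * (beta * q - m * q ^+ j) * h j.-1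
               - (1 - m * q ^+ j) * h j) = 0.
Proof.
rewrite /lsum; under eq_bigr => j _ do rewrite mulrBr.
rewrite sumrB big_ord_recl [X in _ - X]big_ord_recr /=.
rewrite expr0 invr1 subrr !mul0r mulr0 add0r mulVf ?expf_neq0 // subrr.
rewrite mul0r mulr0 addr0 -sumrB big1 // => j _.
rewrite /bump leq0n add1n /= [weight j]big_ltn ?ltn_ord // -/(weight j.+1).
have := qN_neq0 q0 qroot (ltn_ord j); rewrite -/m => hj.
field; by rewrite ?hj ?expf_neq0 ?q0.
Qed.

Lemma lsum_qpochS k : beta * q * lsum (fun j => qpoch q (q ^- j) k.+1) =
  (1 - m * q ^+ k) * lsum (fun j => qpoch q (q ^- j) k).
Proof.
have := pearson (fun j => qpoch q (q ^- j) k).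
rewrite (@eq_lsum _ (fun j => beta * q * qpoch q (q ^- j) k.+1
   + - (1 - m * q ^+ k) * qpoch q (q ^- j) k)).
  by rewrite lsumD !lsumZ mulNr => /eqP; rewrite subr_eq0 => /eqP.
move=> j _; have qj0 : q ^+ j != 0 by rewrite expf_neq0.
have e : (1 - q ^- j) * qpoch q (q ^- j.-1) k = qpoch q (q ^- j) k.+1.
  case: j {qj0} => [|j] /=.
    by rewrite qpochSl expr0 invr1 subrr !mul0r.
  by rewrite qpochSl exprS invfM (mulrC q^-1) mulfVK.
rewrite [X in X - _]mulrAC e qpochS; field.
by rewrite qj0.
Qed.

Lemma lsum_qpoch k : lsum (fun j => qpoch q (q ^- j) k) =
  qpoch q m k / (beta * q) ^+ k * lsum (fun _ => 1).
Proof.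
have bq0 : beta * q != 0 by rewrite mulf_neq0.
elim: k => [|k IH].
  rewrite qpoch0 expr0 divr1 mul1r; apply: eq_lsum => j _.
  by rewrite qpoch0.
apply: (mulfI bq0); rewrite lsum_qpochS IH qpochS exprS invfM.
have : (beta * q) ^+ k != 0 by rewrite expf_neq0.
move: ((beta * q) ^+ k) (beta * q) bq0 => u w w0 u0.
by field; rewrite w0 u0.
Qed.

(** The moment of order M is a single term, and it is a multiple of the moment of
order 0. *)
Lemma lsum1_neq0 : lsum (fun _ => 1) != 0.
Proof.
have : lsum (fun j => qpoch q (q ^- j) M) != 0.
  rewrite /lsum big_ord_recr big1 /=.
    by rewrite add0r /weight big_geq // mul1r; apply: (qpochN_neq0 q0 qroot).
  move=> j _; have := qpoch_lattice q0 (ltn_ord j); rewrite -exprnN => ->.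
  by rewrite mulr0.
by rewrite lsum_qpoch; apply: contra_neq => ->; rewrite mulr0.
Qed.

(** Orthogonality of R_i to the constants. *)
Lemma lsum_qqKsum i : (0 < i <= M)%N -> lsum (fun j => qqKsum q beta m i (q ^- j)) = 0.
Proof.
move=> /andP [i0 iM]; rewrite /qqKsum lsum_sum.
rewrite (eq_bigr (fun k : 'I_i.+1 => qcoef q beta m i k
  * (qpoch q m k / (beta * q) ^+ k) * (q ^- k) ^+ 0 * lsum (fun=> 1))).
  rewrite -mulr_suml qcoef_orth ?mul0r // => k ki.
  by apply: (qpochN_neq0 q0 qroot); apply: leq_trans iM.
by move=> k _; rewrite lsum_qpoch expr0 mulr1 mulrA.
Qed.

(** Orthogonality of R_i to y. *)
Lemma lsum_y_qqKsum i : (1 < i <= M)%N ->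
  lsum (fun j => q ^- j * qqKsum q beta m i (q ^- j)) = 0.
Proof.
move=> /andP [i1 iM]; have bq0 : beta * q != 0 by rewrite mulf_neq0.
rewrite (@eq_lsum _ (fun j => \sum_(k < i.+1) (qcoef q beta m i k * q ^- k)
    * (qpoch q (q ^- j) k - qpoch q (q ^- j) k.+1))); last first.
  by move=> j _; rewrite /qqKsum mulr_sumr; apply: eq_bigr => k _;
     rewrite mulrCA mul_qpoch // mulrA.
rewrite lsum_sum.
rewrite (eq_bigr (fun k : 'I_i.+1 => qcoef q beta m i k
  * (qpoch q m k / (beta * q) ^+ k) * q ^- k
      * ((1 - (beta * q)^-1) * lsum (fun=> 1))
  + qcoef q beta m i k * (qpoch q m k / (beta * q) ^+ k)
      * (m / (beta * q) * lsum (fun=> 1)))).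
  have hn k : (k <= i)%N -> qpoch q m k != 0.
    by move=> ki; apply: (qpochN_neq0 q0 qroot); apply: leq_trans iM.
  have o1 : \sum_(k < i.+1) qcoef q beta m i k
      * (qpoch q m k / (beta * q) ^+ k) * q ^- k = 0.
    exact: (qcoef_orth q0 qroot b0 hn i1).
  have o0 : \sum_(k < i.+1) qcoef q beta m i k
      * (qpoch q m k / (beta * q) ^+ k) = 0.
    by rewrite -[RHS](qcoef_orth q0 qroot b0 hn (ltnW i1)); under [RHS]eq_bigr do rewrite mulr1.
  by rewrite big_split /= -!mulr_suml o1 o0 !mul0r addr0.
move=> k _.
rewrite (@eq_lsum _ (fun j => qpoch q (q ^- j) k + -1 * qpoch q (q ^- j) k.+1));
  last by move=> j _; rewrite mulN1r.
rewrite lsumD lsumZ !lsum_qpoch qpochS (exprS (beta * q)).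
have : q ^+ k != 0 by rewrite expf_neq0.
have : (beta * q) ^+ k != 0 by rewrite expf_neq0.
rewrite invfM; move: ((beta * q) ^+ k) (q ^+ k) (beta * q) bq0 => u v w w0 u0 v0.
by field; rewrite u0 v0 w0.
Qed.

Variable tau : F.
Hypothesis t0 : tau != 0.

(** The moments in the variable tau y of the source; they are explicit only for
tau = 1. *)
Definition moment k := lsum (fun j => qpoch q (tau * q ^- j) k).

Lemma moment0 : moment 0 = lsum (fun=> 1).
Proof. by apply: eq_lsum => j _; rewrite qpoch0. Qed.

Lemma lsum_y_moment k : lsum (fun j => tau * q ^- j * qpoch q (tau * q ^- j) k) =
  q ^- k * (moment k - moment k.+1).
Proof.
rewrite (@eq_lsum _ (fun j => q ^- k * (qpoch q (tau * q ^- j) k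
    + -1 * qpoch q (tau * q ^- j) k.+1))).
  by rewrite lsumZ lsumD lsumZ mulN1r.
by move=> j _; rewrite mul_qpoch // mulN1r.
Qed.

(** The case k = -1 of moment_rec. *)
Lemma moment_rec0 : (beta * q + m - 1) * moment 0 = beta * q / tau * (moment 0 - moment 1).
Proof.
have := pearson (fun _ => 1).
rewrite (@eq_lsum _ (fun j => (beta * q + m - 1 - beta * q / tau)
    * qpoch q (tau * q ^- j) 0 + beta * q / tau * qpoch q (tau * q ^- j) 1)).
  by rewrite lsumD !lsumZ -!/(moment _) => e; apply/eqP; rewrite -subr_eq0 -[X in _ == X]e; apply/eqP; ring.
move=> j _; rewrite qpochS !qpoch0 expr0; field.
by rewrite t0 expf_neq0.
Qed.

(** From pearson with h j = (tau q^-j / q; q)_(k+1). *)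
Lemma moment_rec k : let V := q ^- k in
  (1 - V / q) * (1 - m * tau / V) * moment k =
  moment k.+1 * (beta * q - beta * V / tau - V / q + m) + beta * V / tau * moment k.+2.
Proof.
move=> V; have := pearson (fun j => qpoch q (tau * q ^- j / q) k.+1).
rewrite (@eq_lsum _ (fun j => (beta * q - beta * V / tau - V / q + m)
   * qpoch q (tau * q ^- j) k.+1 + (beta * V / tau * qpoch q (tau * q ^- j) k.+2
   + - ((1 - V / q) * (1 - m * tau / V)) * qpoch q (tau * q ^- j) k))).
  rewrite !lsumD !lsumZ -!/(moment _) => e.
  by apply/eqP; rewrite -subr_eq0 -[X in _ == X]oppr0 -e; apply/eqP; ring.
move=> j _.
have -> : qpoch q (tau * q ^- j / q) k.+1
    = (1 - tau * q ^- j / q) * qpoch q (tau * q ^- j) k.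
  by rewrite qpochSl mulfVK.
have -> : (1 - q ^- j) * (beta * q - m * q ^+ j)
      * qpoch q (tau * q ^- j.-1 / q) k.+1
    = (1 - q ^- j) * (beta * q - m * q ^+ j) * qpoch q (tau * q ^- j) k.+1.
  case: j => [|j]; first by rewrite expr0 invr1 subrr !mul0r.
  congr (_ * qpoch q _ _) => /=; rewrite exprS; field.
  by rewrite q0 expf_neq0.
rewrite !qpochS exprS /V; have : q ^+ j != 0 by rewrite expf_neq0.
have : q ^+ k != 0 by rewrite expf_neq0.
move: (q ^+ j) (q ^+ k) => y Q Q0 y0.
by field; rewrite y0 q0 t0 Q0 oner_neq0.
Qed.

End Functional.

Section Inversion.
Variables (F : fieldType) (q a : F) (N : nat).
Hypotheses (q0 : q != 0) (qroot : forall k : nat, (0 < k)%N -> q ^+ k != 1).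
Hypothesis a0 : a != 0.
Let n := q ^- N.

(** The moments of the functional orthogonal to the polynomials of positive degree
of the source, normalised by 1 in degree 0. *)
Definition source_moment k := qpoch q n k / (a * q) ^+ k.

Lemma source_moment0 : source_moment 0 = 1.
Proof. by rewrite /source_moment qpoch0 expr0 divr1. Qed.

Lemma source_momentS k : source_moment k.+1 = source_moment k * ((1 - n * q ^+ k) / (a * q)).
Proof. by rewrite /source_moment qpochS exprSr invfM; ring. Qed.

Lemma source_moment_neq0 k : (k <= N)%N -> source_moment k != 0.
Proof.
move=> kN; rewrite mulf_neq0 ?invr_neq0 ?expf_neq0 ?mulf_neq0 //.
exact: qpochN_neq0.
Qed.

Lemma interpolation d (v : nat -> F) : exists2 S : {poly F},
  (size S <= d.+1)%N & forall k, (k <= d)%N -> S.[q ^- k] = v k.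
Proof.
elim: d => [|d [S sS hS]].
  exists (v 0%N)%:P; first by rewrite size_polyC; case: eqP.
  by move=> k; rewrite leqn0 => /eqP ->; rewrite hornerC.
pose Z := \prod_(l < d.+1) ('X - (q ^- l)%:P).
have ZE x : Z.[x] = \prod_(l < d.+1) (x - q ^- l).
  by rewrite /Z horner_prod; apply: eq_bigr => l _; rewrite hornerXsubC.
have Z0 : Z.[q ^- d.+1] != 0.
  rewrite ZE; apply/prodf_neq0 => l _; rewrite subr_eq0; apply/eqP.
  move/invr_inj => e; have [] : (d.+1)%:Z = l%:Z by apply: (qexpz_inj q0 qroot).
  by move=> el; have := ltn_ord l; rewrite -el ltnn.
have sZ : size Z = d.+2.
  rewrite /Z size_prod_XsubC; congr _.+1.
  by rewrite /index_enum -enumT size_enum_ord.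
exists (S + ((v d.+1 - S.[q ^- d.+1]) / Z.[q ^- d.+1]) *: Z).
  rewrite (leq_trans (size_polyD _ _)) // geq_max (leq_trans sS) //=.
  by rewrite (leq_trans (size_scale_leq _ _)) // sZ.
move=> k; rewrite hornerD hornerZ leq_eqVlt => /orP [/eqP ->|lt].
  by rewrite mulfVK // addrC subrK.
rewrite hS // (ZE (q ^- k)) (bigD1 (Ordinal lt)) //= subrr mul0r mulr0 addr0 //.
Qed.

Lemma qcoef_orth_poly i (S : {poly F}) : (i <= N)%N -> (size S <= i)%N ->
  \sum_(k < i.+1) qcoef q a n i k * (source_moment k * S.[q ^- k]) = 0.
Proof.
move=> iN sS; under eq_bigr => k _ do rewrite horner_coef !mulr_sumr.
rewrite exchange_big big1 //= => j _.
have ji : (j < i)%N by apply: leq_trans (ltn_ord j) sS.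
have hn k : (k <= i)%N -> qpoch q n k != 0.
  by move=> ki; apply: qpochN_neq0 => //; apply: leq_trans iN.
transitivity (S`_j * 0); last by rewrite mulr0.
rewrite -[X in _ = _ * X](qcoef_orth q0 qroot a0 hn ji) mulr_sumr.
by apply: eq_bigr => k _; rewrite /source_moment; ring.
Qed.

Lemma qcoef_neq0 i k : (k <= i <= N)%N -> qcoef q a n i k != 0.
Proof.
move=> /andP [ki iN]; rewrite /qcoef !mulf_neq0 ?invr_neq0 ?expf_neq0 ?mulf_neq0 //.
- exact: qpochN_neq0.
- by apply/prodf_neq0 => l _; rewrite -exprS one_subq_neq0.
- by apply: qpochN_neq0 => //; apply: leq_trans iN.
- by rewrite expf_neq0.
Qed.

(** If a functional with moments x k is orthogonal to R_(d+1), ..., R_r, its moments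
of order at most r are those of the source times S(q^-k) for a polynomial S of
degree at most d; orthogonality to y R_r extends this to order r + 1. *)
Lemma inversion d r (x : nat -> F) : (d.+2 <= r <= N)%N ->
  (forall i, (d < i <= r)%N -> \sum_(k < i.+1) qcoef q a n i k * x k = 0) ->
  \sum_(k < r.+1) qcoef q a n r k * (q ^- k * (x k - x k.+1)) = 0 ->
  exists2 S : {poly F}, (size S <= d.+1)%N &
    forall k, (k <= r.+1)%N -> x k = source_moment k * S.[q ^- k].
Proof.
move=> /andP [dr rN] h1 h2; have [S sS hS] := interpolation d (fun k => x k / source_moment k).
exists S => //.
have hr k : (k <= r)%N -> x k = source_moment k * S.[q ^- k].
  elim/ltn_ind: k => k IH kr; have [kd|dk] := leqP k d.
    by rewrite hS // mulrC mulfVK // source_moment_neq0 // (leq_trans kr).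
  have e1 : \sum_(l < k.+1) qcoef q a n k l * x l = 0 by apply: h1; rewrite dk.
  have e2 := @qcoef_orth_poly k S (leq_trans kr rN) (leq_trans sS dk).
  have := etrans e1 (esym e2); rewrite !big_ord_recr /=.
  rewrite (eq_bigr (fun l : 'I_k => qcoef q a n k l * (source_moment l * S.[q ^- l]))).
    by move=> /addrI /(mulfI (qcoef_neq0 _)); apply; rewrite leqnn (leq_trans kr).
  move=> l _; rewrite IH ?ltn_ord //.
  exact: leq_trans (ltnW (ltn_ord l)) kr.
move=> k; rewrite leq_eqVlt ltnS => /orP [/eqP ->|]; last exact: hr.
pose T := 'X * S - (a * q)^-1 *: (('X - n%:P) * (S \Po (q^-1 *: 'X))).
have sT : (size T <= r)%N.
  have sc : (size (S \Po (q^-1 *: 'X)) <= d.+1)%N.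
    rewrite (leq_trans _ sS) // size_comp_poly2 //.
    by rewrite size_scale ?invr_neq0 // size_polyX.
  apply: leq_trans (dr); rewrite (leq_trans (size_polyD _ _)) // geq_max size_polyN.
  apply/andP; split.
    by rewrite (leq_trans (size_polyMleq _ _)) // size_polyX.
  rewrite (leq_trans (size_scale_leq _ _)) //.
  by rewrite (leq_trans (size_polyMleq _ _)) // size_XsubC.
have TE l : source_moment l * T.[q ^- l] =
    q ^- l * (source_moment l * S.[q ^- l] - source_moment l.+1 * S.[q ^- l.+1]).
  have -> : T.[q ^- l] = q ^- l * S.[q ^- l]
      - (a * q)^-1 * ((q ^- l - n) * S.[q ^- l.+1]).
    rewrite /T hornerD hornerN hornerM hornerX hornerZ hornerM hornerXsubC.
    by rewrite horner_comp hornerZ hornerX -invfM -exprS.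
  rewrite source_momentS; field.
  by rewrite a0 q0 expf_neq0.
have := etrans (qcoef_orth_poly rN sT) (esym h2); rewrite !big_ord_recr /=.
rewrite (eq_bigr (fun l : 'I_r => qcoef q a n r l * (q ^- l * (x l - x l.+1)))).
  rewrite TE -hr // => /addrI /(mulfI (qcoef_neq0 _)); rewrite leqnn rN.
  move=> /(_ isT) /(mulfI (invr_neq0 (expf_neq0 r q0))) /addrI /oppr_inj.
  by move=> ->.
by move=> l _; rewrite TE !hr // ltnW.
Qed.

End Inversion.

(** * Classification of the target parameters *)
Section Classification.
Variables (F : fieldType) (q : F).
Hypotheses (q0 : q != 0) (qroot : forall k : nat, (0 < k)%N -> q ^+ k != 1).

(** A contiguity relation required on the lattice of the target only.  It is
implied by contiguity and suffices for the classification. *)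
Definition latrel (eps : seq int) (f g : family F)
    (lam : int -> F) (Phi : int -> nat -> F) : Prop :=
  (forall (i : nat) (e : int), (i <= fN f)%N -> e \in eps ->
     ~~ in_range g (i%:Z + e) -> Phi e i = 0) /\
  (forall (i : nat) (x : int), (i <= fN f)%N -> in_range g (x + feta g) ->
     lam x * fpoly q f i x =
       \sum_(e <- eps | in_range g (i%:Z + e))
          Phi e i * fpoly q g (absz (i%:Z + e)) x).

Lemma contiguity_latrel eps f g lam Phi :
  contiguity q eps f g lam Phi -> latrel eps f g lam Phi.
Proof. by move=> [h0 h1]; split=> // i x hi hx; apply: h1 => //; right. Qed.

Lemma qN_neq (N k l : nat) : (l < N + k)%N -> q ^- N * q ^+ l != q ^+ k.
Proof.
move=> h; apply/eqP=> e; have : q ^ (- N%:Z + l%:Z) = q ^ k%:Z.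
  by rewrite expfzDr // -exprnN.
by move/(qexpz_inj q0 qroot); lia.
Qed.

Lemma qN_distinct (N : nat) : (1 < N)%N -> [/\ q ^- N != 1, q ^- N != q, q ^- N != q ^+ 2
     & q ^- N * q != 1].
Proof.
move=> N1; split.
- by have := @qN_neq N 0 0; rewrite expr0 mulr1 addn0; apply; apply: ltnW.
- by have := @qN_neq N 1 0; rewrite expr0 mulr1; apply; rewrite addn1.
- by have := @qN_neq N 2 0; rewrite expr0 mulr1; apply; rewrite addn2.
- by have := @qN_neq N 0 1; rewrite addn0; apply.
Qed.

(* Closes the side conditions of field *)
Local Ltac nz := do ?[apply/andP; split];
  first [assumption | exact: oner_neq0 | by apply: expf_neq0 | by apply: expfz_neq0].

Section Core.
Variables (a : F) (N : nat) (eta : int) (beta : F) (M : nat).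
Hypotheses (a0 : a != 0) (b0 : beta != 0).
Local Notation n := (q ^- N).
Local Notation m := (q ^- M).
Local Notation tau := (q ^ eta).
Local Notation f := (Family 0 a N).
Local Notation g := (Family eta beta M).
Local Notation L := (lsum q beta M).
Local Notation x := (moment q beta M tau).
Let t0 : tau != 0.
Proof. exact: expfz_neq0. Qed.

(* The point x = j - eta of the source corresponds to the point j of the lattice
   of the target. *)
Lemma latticeE (j : nat) : q ^ (- (j%:Z - eta)) = tau * q ^- j.
Proof. by rewrite opprB expfzDr // -exprnN. Qed.

Section Relation.
Variables (eps : seq int) (lam : int -> F) (Phi : int -> nat -> F).
Hypothesis hrel : latrel eps f g lam Phi.

Lemma latrel_lsum i : (i <= N)%N -> (forall e, e \in eps -> 0 < i%:Z + e) ->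
  L (fun j => lam (j%:Z - eta) * qqKsum q a n i (tau * q ^- j)) = 0.
Proof.
move=> iN he; rewrite (@eq_lsum _ _ _ _ _ (fun j =>
  \sum_(e <- eps | in_range g (i%:Z + e)) Phi e i *
    qqKsum q beta m (absz (i%:Z + e)) (q ^- j))).
  rewrite lsum_sum big_seq_cond big1 // => e /andP [ee /andP [_ /= r]].
  by rewrite lsum_qqKsum ?mulr0 //; move: (he e ee) r; lia.
move=> j jM; have := hrel.2 i (j%:Z - eta) iN.
rewrite fpolyE addr0 latticeE subrK => -> //.
by apply: eq_bigr => e _; rewrite fpolyE /= subrK -exprnN.
Qed.

Lemma latrel_y_lsum i : (i <= N)%N -> (forall e, e \in eps -> 1 < i%:Z + e) ->
  L (fun j => lam (j%:Z - eta)
     * (tau * q ^- j * qqKsum q a n i (tau * q ^- j))) = 0.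
Proof.
move=> iN he; rewrite (@eq_lsum _ _ _ _ _ (fun j =>
  \sum_(e <- eps | in_range g (i%:Z + e)) (tau * Phi e i) *
    (q ^- j * qqKsum q beta m (absz (i%:Z + e)) (q ^- j)))).
  rewrite lsum_sum big_seq_cond big1 // => e /andP [ee /andP [_ /= r]].
  by rewrite lsum_y_qqKsum ?mulr0 //; move: (he e ee) r; lia.
move=> j jM; have := hrel.2 i (j%:Z - eta) iN.
rewrite fpolyE addr0 latticeE subrK mulrCA => -> //.
rewrite mulr_sumr.
by apply: eq_bigr => e _; rewrite fpolyE /= subrK -exprnN; ring.
Qed.

End Relation.

Lemma lattice_qqKsum (u : nat -> F) i : L (fun j => u j * qqKsum q a n i (tau * q ^- j)) =
  \sum_(k < i.+1) qcoef q a n i k * L (fun j => u j * qpoch q (tau * q ^- j) k).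
Proof.
rewrite -lsum_sum; apply: eq_lsum => j _.
by rewrite /qqKsum mulr_sumr; apply: eq_bigr => k _; rewrite mulrCA.
Qed.

Lemma lattice_y_qqKsum (u : nat -> F) i :
  L (fun j => u j * (tau * q ^- j * qqKsum q a n i (tau * q ^- j))) =
  \sum_(k < i.+1) qcoef q a n i k *
   (q ^- k * (L (fun j => u j * qpoch q (tau * q ^- j) k)
            - L (fun j => u j * qpoch q (tau * q ^- j) k.+1))).
Proof.
transitivity (\sum_(k < i.+1) qcoef q a n i k * L (fun j => q ^- k *
   (u j * qpoch q (tau * q ^- j) k + -1 * (u j * qpoch q (tau * q ^- j) k.+1)))).
  rewrite -lsum_sum; apply: eq_lsum => j _.
  rewrite /qqKsum !mulr_sumr; apply: eq_bigr => k _.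
  rewrite [tau * _ * (qcoef _ _ _ _ _ * _)]mulrCA mul_qpoch //; ring.
by apply: eq_bigr => k _; rewrite lsumZ lsumD lsumZ mulN1r.
Qed.

Lemma x0_neq0 : x 0 != 0.
Proof. by rewrite moment0 lsum1_neq0. Qed.

Hypothesis ga : forall k : int, a != q ^ k.

Let pn : qpow q n. Proof. by exists (- N%:Z); rewrite -exprnN. Qed.
Let pm : qpow q m. Proof. by exists (- M%:Z); rewrite -exprnN. Qed.
Let pt : qpow q tau. Proof. by exists eta. Qed.

(** Relations with a constant factor that involve g_(i-d), ..., d = 1 or 2. *)
Lemma constant_classification eps lam Phi (c : F) (d : nat) : latrel eps f g lam Phi -> c != 0 ->
  (forall y : int, in_range g (y + eta) -> lam y = c) ->
  (forall e : int, e \in eps -> - d%:Z <= e) -> d = 1%N \/ d = 2%N -> (d.+2 <= N)%N ->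
  [\/ [/\ beta = a * tau, tau = 1 & m = n],
      beta = a * tau * q /\ solution1 q n m tau
    | [/\ d = 2%N, beta = a * tau * q ^+ 2 & solution2 q n m tau]].
Proof.
move=> hrel c0 hlam he hd dN.
have lamE j : (j <= M)%N -> lam (j%:Z - eta) = c.
  by move=> jM; apply: hlam; rewrite subrK.
have hi1 i : (d < i <= d.+2)%N -> \sum_(k < i.+1) qcoef q a n i k * x k = 0.
  move=> /andP [di iN]; apply: (mulfI c0); rewrite mulr0.
  have he' e : e \in eps -> 0 < i%:Z + e by move=> /he; lia.
  apply: etrans (latrel_lsum hrel (leq_trans iN dN) he').
  rewrite [RHS](@eq_lsum _ _ _ _ _ (fun j => c * qqKsum q a n i (tau * q ^- j))).
    by rewrite lattice_qqKsum mulr_sumr; apply: eq_bigr => k _; rewrite lsumZ mulrCA.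
  by move=> j /lamE ->.
have hi2 : \sum_(k < d.+3) qcoef q a n d.+2 k * (q ^- k * (x k - x k.+1)) = 0.
  apply: (mulfI c0); rewrite mulr0.
  have he' e : e \in eps -> 1 < d.+2%:Z + e by move=> /he; lia.
  apply: etrans (latrel_y_lsum hrel dN he').
  rewrite [RHS](@eq_lsum _ _ _ _ _ (fun j =>
     c * (tau * q ^- j * qqKsum q a n d.+2 (tau * q ^- j)))).
    by rewrite lattice_y_qqKsum mulr_sumr; apply: eq_bigr => k _;
      rewrite !lsumZ -!/(moment _ _ _ _ _); ring.
  by move=> j /lamE ->.
have [|S sS hS] := @inversion _ q a N q0 qroot a0 d d.+2 x _ hi1 hi2.
  by rewrite leqnn.
have s3 : (size S <= 3)%N by apply: (leq_trans sS); lia.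
have SE V : S.[V] = S`_0 + S`_1 * V + S`_2 * V ^+ 2.
  by rewrite (horner_coef_wide V s3) !big_ord_recr big_ord0 /= add0r expr0 mulr1.
have Sn0 : S != 0.
  by apply: contra_neq x0_neq0 => S0; rewrite hS // S0 horner0 mulr0.
have nz : [|| S`_0 != 0, S`_1 != 0 | S`_2 != 0].
  apply: contraNT Sn0; rewrite !negb_or !negbK => /and3P [/eqP e0 /eqP e1 /eqP e2].
  apply/eqP/polyP => i; rewrite coef0; move: i => [|[|[|i]]] //.
  by rewrite nth_default // (leq_trans s3).
have aq0 : a * q != 0 by rewrite mulf_neq0.
have hE k : (k < d.+3)%N ->
    const_defect q a n beta m tau S`_0 S`_1 S`_2 (q / q ^+ k) = 0.
  have EE V : const_defect q a n beta m tau S`_0 S`_1 S`_2 V =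
      a * q * (1 - V / q) * (V - m * tau) * S.[V]
      - (V - n) * ((beta * q + m - V * (beta / tau + q^-1)) * S.[V / q]
      + beta / (tau * a * q) * (V - n * q) * S.[V / q ^+ 2]) by rewrite !SE.
  case: k => [_|l ld].
    have h := moment_rec0 beta M q0 qroot t0.
    have e1 : x 1 = source_moment q a N 1 * S.[q^-1] by rewrite hS.
    have -> : q / q ^+ 0 = q by rewrite expr0 divr1.
    have qq : q / q = 1 by rewrite mulfV.
    have qq2 : q / q ^+ 2 = q^-1 by rewrite expr2 invfM mulrA qq mul1r.
    rewrite EE qq qq2 subrr.
    rewrite !(mulr0, mul0r) sub0r; apply/eqP; rewrite oppr_eq0.
    rewrite mulf_eq0; apply/orP; right; apply/eqP.
    have e0 : x 0 = S.[1] by rewrite hS // source_moment0 mul1r expr0 invr1.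
    rewrite -e0; apply/eqP; move/eqP: h; rewrite -subr_eq0 e1 source_momentS source_moment0 mul1r expr0.
    move=> /eqP <-; apply/eqP; field.
    by rewrite t0 a0 !expf_neq0 // q0.
  have -> : q / q ^+ l.+1 = q ^- l by rewrite exprS invfM mulVKf.
  have l2 : (l.+2 <= d.+3)%N by [].
  have l1 : (l.+1 <= d.+3)%N := ltnW l2.
  have ll : (l <= d.+3)%N := ltnW l1.
  have h := moment_rec beta M q0 qroot t0 l; rewrite /= !hS // in h.
  have lN : (l <= N)%N := leq_trans (ltnW (ld : (l < d.+2)%N)) dN.
  have mn := source_moment_neq0 q0 qroot a0 lN.
  apply: (mulfI mn); rewrite mulr0.
  have q2 : q ^- l / q ^+ 2 = q ^- l.+2 by rewrite -invfM -exprD addnC.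
  have q1 : q ^- l / q = q ^- l.+1 by rewrite exprS invfM mulrC.
  rewrite EE q2 q1.
  rewrite !source_momentS in h.
  move: h; rewrite q1 => /eqP; rewrite -subr_eq0 => /eqP h.
  have ql0 : q ^+ l != 0 by rewrite expf_neq0.
  rewrite -(mulr0 (a * q * q ^- l)) -[in RHS]h (exprS q l); field.
  by rewrite ?a0 ?t0 ?ql0 ?expf_neq0 ?q0 ?oner_neq0.
have N0 : (1 < N)%N by apply: leq_trans dN.
have [n1 nq _ nqV] := qN_distinct N0.
have hE' : (S`_2 = 0 /\ (forall k, (k < 4)%N ->
      const_defect q a n beta m tau S`_0 S`_1 S`_2 (q / q ^+ k) = 0)) \/
    (forall k, (k < 5)%N -> const_defect q a n beta m tau S`_0 S`_1 S`_2 (q / q ^+ k) = 0).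
  case: hd => dE; rewrite dE in hE sS; last by right.
  by left; split=> //; rewrite nth_default.
have [h|h|[s2 h1 h2]] := const_defect_solve q0 qroot a0 ga pn pm pt n1 nq nqV nz hE'.
- by constructor 1.
- by constructor 2.
- constructor 3; split=> //; case: hd => // dE.
  by move: s2; rewrite nth_default ?eqxx // -dE.
Qed.

(** Relations with a factor proportional to y - w; the first alternative is the
case of a functional that vanishes on the multiples of y - w. *)
Lemma affine_classification eps lam Phi (B w : F) : latrel eps f g lam Phi -> B != 0 ->
  (forall y : int, in_range g (y + eta) -> lam y = B * (q ^ (- y) - w)) ->
  (forall e : int, e \in eps -> -1 <= e) -> (4 <= N)%N -> (0 < M)%N ->
  [\/ beta = q^-1 /\ w = m * tau,
    beta = a * tau / q /\
     [\/ tau = q /\ m = n / q, tau = 1 /\ m = n | tau = 1 /\ m = n / q] |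
    beta = a * tau /\
    [\/ tau = q /\ (m = n / q \/ m = n),
      tau = 1 /\ [\/ m = n, m = n / q | m = n * q]
    | tau = q^-1 /\ (m = n \/ m = n * q)]].
Proof.
move=> hrel B0 hlam he N4 M0.
have lamE j : (j <= M)%N -> lam (j%:Z - eta) = B * (tau * q ^- j - w).
  by move=> jM; rewrite -latticeE hlam // subrK.
pose xt k := L (fun j => (tau * q ^- j - w) * qpoch q (tau * q ^- j) k).
have hi1 i : (1 < i <= 4)%N -> \sum_(k < i.+1) qcoef q a n i k * xt k = 0.
  move=> /andP [di iN]; apply: (mulfI B0); rewrite mulr0.
  have he' e : e \in eps -> 0 < i%:Z + e by move=> /he; lia.
  apply: etrans (latrel_lsum hrel (leq_trans iN N4) he').
  rewrite -(lattice_qqKsum (fun j => tau * q ^- j - w)) -lsumZ; apply: eq_lsum => j /lamE ->.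
  by rewrite mulrA.
have hi2 : \sum_(k < 5) qcoef q a n 4 k * (q ^- k * (xt k - xt k.+1)) = 0.
  apply: (mulfI B0); rewrite mulr0.
  have he' e : e \in eps -> 1 < 4%:Z + e by move=> /he; lia.
  apply: etrans (latrel_y_lsum hrel N4 he').
  rewrite -(lattice_y_qqKsum (fun j => tau * q ^- j - w)) -lsumZ; apply: eq_lsum => j /lamE ->.
  by rewrite mulrA.
have [|S sS hS] := @inversion _ q a N q0 qroot a0 1 4 xt _ hi1 hi2; first by [].
have SE V : S.[V] = S`_0 + S`_1 * V.
  by rewrite (horner_coef_wide V sS) !big_ord_recr big_ord0 /= add0r expr0 mulr1.
have xtE k : xt k = q ^- k * (x k - x k.+1) - w * x k.
  rewrite -lsum_y_moment // -lsumZ -mulN1r -lsumZ -lsumD; apply: eq_lsum => j _.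
  by rewrite mulrBl mulN1r.
pose kap := kappa q m tau w beta.
pose D := Delta q m tau w kap.
pose T := Tnum q n m tau w a beta S`_0 S`_1.
have aq0 : a * q != 0 by rewrite mulf_neq0.
have x0n := x0_neq0.
have mn k : (k <= N)%N -> source_moment q a N k != 0 by move=> kN; apply: source_moment_neq0.
have D0 : (kap - 1) * x 0 = beta * q / tau * S.[1].
  have := hS 0%N isT; rewrite xtE source_moment0 mul1r expr0 invr1 mul1r => <-.
  rewrite -[RHS]addr0 -(subrr (beta * q / tau * (x 0 - x 1))).
  rewrite -{1}(moment_rec0 beta M q0 qroot t0) /kap /kappa; field.
  by rewrite t0 expf_neq0.
(* Cramer's rule for the recurrence and the definition of xt *)
have D1 l : (l <= 4)%N -> D (q ^- l) * x l = - (source_moment q a N l * T (q ^- l)).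
  move=> l4; have h1 := hS l (leqW l4); have h2 := hS l.+1 l4.
  have h := moment_rec beta M q0 qroot t0 l.
  have ql0 : q ^+ l != 0 by rewrite expf_neq0.
  have q1 : q ^- l / q = q ^- l.+1 by rewrite exprS invfM mulrC.
  have e1 : x l.+1 = q ^+ l * ((q ^- l - w) * x l - source_moment q a N l * S.[q ^- l]).
    by rewrite -h1 xtE; field; rewrite ql0.
  have e2 : x l.+2 = q * q ^+ l * ((q ^- l.+1 - w) * x l.+1
      - source_moment q a N l.+1 * S.[q ^- l.+1]).
    by rewrite -h2 xtE exprS; field; nz.
  rewrite /= e2 q1 source_momentS in h.
  have TE : T (q ^- l) = beta / (a * tau) * (q ^- l - n) * S.[q ^- l.+1]
      + (kap - q ^- l.+1) * S.[q ^- l] by rewrite /T /Tnum -/kap q1 !SE.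
  transitivity (q ^- l * ((1 - q ^- l.+1) * (1 - m * tau / q ^- l) * x l)
    - (kap - q ^- l.+1) * (q ^- l - w) * x l).
    by rewrite /D DeltaE // q1; field; nz.
  rewrite h TE e1 exprS /kap /kappa.
  move: (S.[_]) (S.[_]) (source_moment q a N l) (x l) => S1 S2 u v.
  by field; nz.
have DE V : D V = del0 m tau w kap + del1 q m tau w kap * V by [].
pose t2 := (beta / (a * tau) - 1) * S`_1 / q.
pose t1 := beta / (a * tau) * (S`_0 - n * S`_1 / q) + kap * S`_1 - S`_0 / q.
pose t00 := (kap - beta / (a * tau) * n) * S`_0.
have TE V : T V = t00 + t1 * V + t2 * V ^+ 2.
  by rewrite /T /Tnum -/kap /t00 /t1 /t2; field; nz.
have T0P : (forall V, D V = 0) -> forall V, T V = 0.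
  move=> Dz; have [z0 z1 z2] : [/\ t00 = 0, t1 = 0 & t2 = 0].
    apply: (@linear_cancel _ q q0 qroot q) => V.
    have [h0 h1 h2 h3 _] : [/\ - q * t00 = 0, t00 - q * t1 = 0,
        t1 - q * t2 = 0, t2 = 0 & 0 = 0 :> F].
      apply: (quartic_eq0 q0 qroot) => k k5 /=.
      transitivity ((q / q ^+ k - q) * T (q / q ^+ k)); first by rewrite TE; ring.
      case: k k5 => [|k] k5; first by rewrite expr0 divr1 subrr mul0r.
      have -> : q / q ^+ k.+1 = q ^- k by rewrite exprS invfM mulVKf.
      have k4 : (k <= 4)%N := ltnW k5.
      have := D1 k k4; rewrite Dz mul0r => /esym/eqP; rewrite oppr_eq0 mulf_eq0.
      by rewrite (negbTE (mn k (leq_trans k4 N4))) => /eqP ->; rewrite mulr0.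
    transitivity (- q * t00 + (t00 - q * t1) * V + (t1 - q * t2) * V ^+ 2
      + t2 * V ^+ 3); first by ring.
    by rewrite h0 h1 h2 h3 !mul0r !addr0.
  by move=> V; rewrite TE z0 z1 z2 !mul0r !addr0.
have [Sz|Sz] := eqVneq S 0.
  (* the functional vanishes on multiples of y - w *)
  have k1 : kap = 1.
    apply/eqP; rewrite -subr_eq0; move/eqP: D0.
    by rewrite Sz horner0 mulr0 mulf_eq0 (negbTE x0n) orbF.
  have T1 : T 1 = 0.
    by rewrite /T /Tnum Sz !coef0 !mul0r !addr0 !mulr0 addr0.
  have : D 1 = 0.
    have := D1 0%N isT; rewrite expr0 invr1 T1 mulr0 oppr0 => /eqP.
    by rewrite mulf_eq0 (negbTE x0n) orbF => /eqP.
  have q1' : 1 - q^-1 != 0.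
    by rewrite subr_eq0 eq_sym invr_eq1; apply: (qroot (ltn0Sn 0)).
  rewrite /D DeltaE // k1 => e.
  have wE : w = m * tau.
    apply/eqP; rewrite -subr_eq0; apply/eqP/(mulfI q1').
    rewrite mulr0 -[RHS]e; field; nz.
  constructor 1; split=> //.
  have m1 : 1 - m != 0 by apply: q1N_neq0.
  have : (1 - m) * (beta * q - 1) = 0.
    transitivity (kap - 1); last by rewrite k1 subrr.
    by rewrite /kap /kappa wE; field; nz.
  move/(mulfI_eq0 m1)/eqP; rewrite subr_eq0 => /eqP e1.
  by apply: (mulIf q0); rewrite e1 mulVf.
have [n1 nq nq2 _] := qN_distinct (leq_trans (isT : 1 < 4)%N N4).
have nz : (S`_0 != 0) || (S`_1 != 0).
  apply: contraNT Sz; rewrite !negb_or !negbK => /andP [/eqP e0 /eqP e1].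
  apply/eqP/polyP => i; rewrite coef0; move: i => [|[|i]] //.
  by rewrite nth_default // (leq_trans sS).
have hF k : (k < 5)%N -> affine_defect q n m tau w a beta S`_0 S`_1 (q / q ^+ k) = 0.
  have FE V : affine_defect q n m tau w a beta S`_0 S`_1 V = (V - n) * T (V / q) * D V
      - a * q * D (V / q) * ((V - w) * T V + S.[V] * D V) by rewrite SE.
  case: k => [_|l l4].
    have -> : q / q ^+ 0 = q by rewrite expr0 divr1.
    have qq : q / q = 1 by rewrite mulfV.
    have := D1 0%N isT; rewrite expr0 invr1 source_moment0 mul1r => h.
    rewrite FE qq.
    have -> : T 1 = - (D 1 * x 0) by rewrite h opprK.
    have -> : D q = - (kap - 1) * (q - w).
      by rewrite /D DeltaE //; field; nz.
    have -> : T q = beta / (a * tau) * (q - n) * S.[1] + (kap - 1) * S.[q].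
      by rewrite /T /Tnum -/kap qq !SE.
    transitivity ((q - n) * (q - w) * D 1 * ((kap - 1) * x 0 - beta * q / tau * S.[1])).
      move: (D 1) (S.[1]) (S.[q]) (x 0) => D1' S1 Sq x0'.
      by field; nz.
    by rewrite D0 subrr mulr0.
  have -> : q / q ^+ l.+1 = q ^- l by rewrite exprS invfM mulVKf.
  have q1 : q ^- l / q = q ^- l.+1 by rewrite exprS invfM mulrC.
  have l4' : (l <= 4)%N := ltnW l4.
  have ln := mn l (leq_trans l4' N4).
  have ql0 : q ^+ l != 0 by rewrite expf_neq0.
  have h1 := D1 l l4'; have h2 := D1 l.+1 l4.
  have h3 := hS l (leqW l4'); rewrite xtE in h3.
  apply: (mulfI ln); rewrite mulr0 FE q1.
  transitivity (a * q * q ^- l * (source_moment q a N l.+1 * T (q ^- l.+1)) * D (q ^- l)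
     - a * q * D (q ^- l.+1) * ((q ^- l - w) * (source_moment q a N l * T (q ^- l))
         + (source_moment q a N l * S.[q ^- l]) * D (q ^- l))).
    rewrite source_momentS; move: (T (q ^- l)) (T (q ^- l.+1)) (D _) (D _) (S.[_]) (source_moment _ _ _ _).
    by move=> T1 T2 D2 D3 S1 u; field; nz.
  have -> : source_moment q a N l.+1 * T (q ^- l.+1) = - (D (q ^- l.+1) * x l.+1).
    by rewrite h2 opprK.
  have -> : source_moment q a N l * T (q ^- l) = - (D (q ^- l) * x l) by rewrite h1 opprK.
  rewrite -h3; move: (D _) (D _) (x _) (x _) => D2 D3 x1 x2.
  by field; nz.
have [h|h] := affine_defect_solve q0 qroot pn pm pt n1 nq nq2 a0 ga nz hF T0P.
  by constructor 2.
by constructor 3.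
Qed.

End Core.
End Classification.

(** * Uniqueness and composition of relations *)
Section Uniqueness.
Variables (F : fieldType) (q : F).
Hypotheses (q0 : q != 0) (qroot : forall k : nat, (0 < k)%N -> q ^+ k != 1).

(** The polynomials R_0, ..., R_M are linearly independent on 0, ..., M. *)
Lemma lattice_free (b : F) (M : nat) (c : nat -> F) : b != 0 ->
  (forall j, (j <= M)%N ->
     \sum_(k < M.+1) c k * qqKsum q b (q ^- M) k (q ^- j) = 0) ->
  forall k, (k <= M)%N -> c k = 0.
Proof.
move=> b0 h; pose d l := \sum_(k < M.+1) c k * qcoef q b (q ^- M) k l.
have hd j : (j <= M)%N -> \sum_(l < M.+1) d l * qpoch q (q ^- j) l = 0.
  move=> jM; rewrite -[RHS](h j jM) /d.
  under eq_bigr => l _ do rewrite mulr_suml.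
  rewrite exchange_big; apply: eq_bigr => k _ /=.
  rewrite (qqKsum_widen q0 _ _ _ (ltn_ord k)) mulr_sumr.
  by apply: eq_bigr => l _; rewrite mulrA.
have d0 l : (l <= M)%N -> d l = 0.
  elim/ltn_ind: l => l IH lM; have := hd l lM.
  have lM' : (l < M.+1)%N by [].
  rewrite (bigD1 (Ordinal lM')) //= big1 ?addr0.
    move/eqP; rewrite mulf_eq0 (negbTE (qpochN_neq0 q0 qroot (leqnn l))) orbF.
    by move/eqP.
  move=> k /eqP kl; case: (ltngtP k l) => [kl'|lk|e].
  - by rewrite IH ?mul0r // -ltnS.
  - by have := qpoch_lattice q0 lk; rewrite -exprnN => ->; rewrite mulr0.
  - by case: kl; apply: val_inj.
suff hc t k : (M - t <= k)%N -> (k <= M)%N -> c k = 0.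
  by move=> k; apply: (hc M); rewrite subnn.
elim: t k => [|t IH] k; first rewrite subn0.
all: move=> hk kM; have := d0 k kM; rewrite /d;
  have kM' : (k < M.+1)%N by [].
all: rewrite (bigD1 (Ordinal kM')) //= big1 ?addr0.
all: try by move/eqP; rewrite mulf_eq0 => /orP [/eqP //|];
  rewrite (negbTE (qcoef_neq0 q0 qroot b0 _)) // leqnn.
all: move=> l /eqP lk; case: (ltngtP l k) => [lk'|kl|e];
  [by rewrite qcoef_gt ?mulr0| |by case: lk; apply: val_inj].
- by have := ltn_ord l; lia.
- by rewrite IH ?mul0r //; have := ltn_ord l; lia.
Qed.

(** A relation with zero factor is trivial. *)
Lemma latrel_zero eps (f g : family F) lam Phi : falpha g != 0 -> uniq eps ->
  latrel q eps f g lam Phi ->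
  (forall x : int, in_range g (x + feta g) -> lam x = 0) ->
  forall (i : nat) e, (i <= fN f)%N -> e \in eps -> Phi e i = 0.
Proof.
move=> b0 ueps [h0 h1] hlam i e iN ee.
have [re|/(h0 _ _ iN ee) //] := boolP (in_range g (i%:Z + e)).
pose p e' : 'I_(fN g).+1 := inord (absz (i%:Z + e')).
pose c k := \sum_(e' <- eps | in_range g (i%:Z + e') && (val (p e') == k)) Phi e' i.
have pE e' : in_range g (i%:Z + e') -> val (p e') = absz (i%:Z + e').
  by move=> /andP [? ?]; rewrite /p /= inordK //; lia.
have c0 : c (absz (i%:Z + e)) = 0.
  apply: (@lattice_free _ (fN g) c b0) => [j jM|]; last first.
    by move: re => /andP [? ?]; lia.
  have := h1 i (j%:Z - feta g) iN; rewrite subrK => /(_ jM).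
  rewrite hlam ?subrK // mul0r => /esym e1.
  rewrite -[RHS]e1 (partition_big p predT) //=; apply: eq_bigr => k _.
  rewrite mulr_suml; apply: eq_big => [e'|e' /andP [re' /eqP kE]].
    by [].
  by rewrite fpolyE subrK -exprnN -(pE _ re') kE.
rewrite -[RHS]c0 /c big_mkcond (bigD1_seq e) //= re (pE _ re) eqxx /=.
rewrite big1_seq ?addr0 // => e' /andP [ne _]; case: ifP => // /andP [re'].
rewrite (pE _ re') => /eqP eE; case/eqP: ne.
by move: re re' => /andP [? _] /andP [? _]; lia.
Qed.

Lemma latrel_sub eps (f g : family F) lam Phi lam' Phi' :
  latrel q eps f g lam Phi -> latrel q eps f g lam' Phi' ->
  latrel q eps f g (fun x => lam x - lam' x) (fun e i => Phi e i - Phi' e i).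
Proof.
move=> [h0 h1] [h0' h1']; split=> [i e hi he hr|i x hi hx].
  by rewrite h0 // h0' // subrr.
rewrite mulrBl h1 // h1' // -sumrB; apply: eq_bigr => e _.
by rewrite mulrBl.
Qed.

Lemma latrel_scale eps (f g : family F) lam Phi c :
  latrel q eps f g lam Phi ->
  latrel q eps f g (fun x => c * lam x) (fun e i => c * Phi e i).
Proof.
move=> [h0 h1]; split=> [i e hi he hr|i x hi hx]; first by rewrite h0 // mulr0.
by rewrite -mulrA h1 // mulr_sumr; apply: eq_bigr => e _; rewrite mulrA.
Qed.

Lemma contiguity_scale eps (f g : family F) lam Phi c :
  contiguity q eps f g lam Phi ->
  contiguity q eps f g (fun x => c * lam x) (fun e i => c * Phi e i).
Proof.
move=> [h0 h1]; split=> [i e hi he hr|i x hi hx]; first by rewrite h0 // mulr0.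
by rewrite -mulrA h1 // mulr_sumr; apply: eq_bigr => e _; rewrite mulrA.
Qed.

Lemma latrel_uniq eps (f g : family F) lam Phi Phi' : falpha g != 0 -> uniq eps ->
  latrel q eps f g lam Phi -> latrel q eps f g lam Phi' ->
  forall (i : nat) e, (i <= fN f)%N -> e \in eps -> Phi e i = Phi' e i.
Proof.
move=> b0 ueps h h' i e hi he; apply/eqP; rewrite -subr_eq0; apply/eqP.
apply: (latrel_zero b0 ueps (latrel_sub h h') _ hi he).
by move=> x _; rewrite subrr.
Qed.

(** The lattice points of g that are not lattice points of h are harmless when the
second factor vanishes there. *)
Lemma latrel_comp (eps1 eps2 eps : seq int) (f g h : family F) lam1 Phi1 lam2 Phi2 :
  uniq eps -> (forall e1 e2, e1 \in eps1 -> e2 \in eps2 -> e1 + e2 \in eps) ->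
  latrel q eps1 f h lam1 Phi1 -> latrel q eps2 h g lam2 Phi2 ->
  (forall x : int, in_range g (x + feta g) ->
     in_range h (x + feta h) \/ lam2 x = 0) ->
  latrel q eps f g (fun x => lam1 x * lam2 x) (comp_coefs eps1 eps2 Phi1 Phi2).
Proof.
move=> ueps heps [z1 h1] [z2 h2] hx12.
have inner i e1 e2 : (i <= fN f)%N -> e1 \in eps1 -> e2 \in eps2 ->
   in_range h (i%:Z + e1) -> ~~ in_range g (i%:Z + (e1 + e2)) ->
   Phi2 e2 (absz (i%:Z + e1)) = 0.
  move=> iN he1 he2 rh rg; apply: z2 => //.
    by move: rh => /andP [? ?]; lia.
  rewrite gez0_abs ?addrA ?[_ + e1 + e2]/(_) -?addrA //.
  by case/andP: rh.
split=> [i e iN he rg|i x iN xg].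
  rewrite /comp_coefs big1_seq // => e1 /andP [_ he1].
  have [rh|rh] := boolP (in_range h (i%:Z + e1)); last by rewrite z1 // mul0r.
  rewrite big1_seq ?mulr0 // => e2 /andP [/eqP e12 he2].
  by apply: (inner i) => //; rewrite e12.
pose S := \sum_(e1 <- eps1 | in_range h (i%:Z + e1))
   Phi1 e1 i * (lam2 x * fpoly q h (absz (i%:Z + e1)) x).
have -> : \sum_(e <- eps | in_range g (i%:Z + e))
    comp_coefs eps1 eps2 Phi1 Phi2 e i * fpoly q g (absz (i%:Z + e)) x = S.
  rewrite /comp_coefs; under eq_bigr => e _ do rewrite mulr_suml.
  rewrite exchange_big /= /S [RHS]big_mkcond /= big_seq [RHS]big_seq.
  apply: eq_bigr => e1 he1; case: ifP => rh; last first.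
    by rewrite big1 // => e _; rewrite z1 ?rh // !mul0r.
  have rhN : (absz (i%:Z + e1)%R <= fN h)%N by move: rh => /andP [? ?]; lia.
  have rh0 : (absz (i%:Z + e1))%:Z = i%:Z + e1.
    by rewrite gez0_abs //; case/andP: rh.
  rewrite h2 // rh0.
  under eq_bigr => e _ do rewrite -mulrA mulr_suml.
  rewrite -mulr_sumr; congr (_ * _); rewrite (exchange_big_dep predT) //=.
  rewrite [RHS]big_mkcond big_seq [RHS]big_seq; apply: eq_bigr => e2 he2.
  have h12 := heps _ _ he1 he2.
  rewrite big_mkcond (bigD1_seq (e1 + e2)) //= eqxx andbT -addrA.
  rewrite [X in _ + X]big1_seq ?addr0 // => e /andP [ne _].
  by rewrite [e1 + e2 == e]eq_sym (negbTE ne) andbF.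
have -> : S = lam2 x * \sum_(e1 <- eps1 | in_range h (i%:Z + e1))
   Phi1 e1 i * fpoly q h (absz (i%:Z + e1)) x.
  by rewrite mulr_sumr; apply: eq_bigr => e1 _; rewrite mulrCA.
have [xh|->] := hx12 x xg; last by rewrite mulr0 !mul0r.
by rewrite -h1 //; ring.
Qed.

End Uniqueness.

(** * Steps of type A2 *)
Section Steps.
Variables (F : fieldType) (q : F).
Hypotheses (q0 : q != 0) (qroot : forall k : nat, (0 < k)%N -> q ^+ k != 1).

(** An A2 relation from f to h, with factor normalised to 1, such that the lattice
of h is contained in that of f. *)
Definition forward (f h : family F) : Prop := exists2 Phi,
  A2 q f h (fun _ => 1) Phi &
  forall x : int, in_range h (x + feta h) -> in_range f (x + feta f).

(** An A2 relation from g to h together with its associated relation, whose factor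
is u + v q^-x and vanishes at the lattice points of g outside the lattice
of h. *)
Definition step (g h : family F) (u v : F) : Prop := exists lam Phi,
  [/\ forward g h, A2_assoc q g h lam Phi,
      forall x : int, lam x = u + v * q ^ (- x) &
      forall x : int, in_range g (x + feta g) ->
        in_range h (x + feta h) \/ lam x = 0].

Lemma fpoly0 (f : family F) x : fpoly q f 0 x = 1.
Proof. by rewrite fpolyE /qqKsum big_ord1 qcoef0 qpoch0 mulr1. Qed.

Lemma trivial_contiguity eps f : uniq eps -> 0 \in eps ->
  contiguity q eps f f (fun _ => 1) (coefs 0 (fun _ => 1) (fun _ => 0)).
Proof.
move=> ue e0; have r (i : nat) : (i <= fN f)%N -> in_range f (i%:Z + 0).
  by rewrite addr0 /in_range lez_nat.
split=> [i e hi he|i x hi _].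
  by rewrite /coefs; case: eqP => // ->; rewrite r.
rewrite mul1r big_mkcond (bigD1_seq 0) // r // [i%:Z + 0]addr0 mul1r.
rewrite big1 /= ?addr0 // => e ne; rewrite /coefs (negbTE ne) mul0r.
by case: ifP.
Qed.

Lemma trivial_A2 f : A2 q f f (fun _ => 1) (coefs 0 (fun _ => 1) (fun _ => 0)).
Proof.
split; first by rewrite subrr.
  exact: trivial_contiguity.
by rewrite /coefs oner_neq0.
Qed.

Lemma forward_refl f : forward f f.
Proof. by exists (coefs 0 (fun _ => 1) (fun _ => 0)) => //; apply: trivial_A2. Qed.

Lemma step_refl f : step f f 1 0.
Proof.
exists (fun _ => 1), (coefs 0 (fun _ => 1) (fun _ => 0)); split.
- exact: forward_refl.
- split; last by exists 0; apply: oner_neq0.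
  exact: trivial_contiguity.
- by move=> x; rewrite mul0r addr0.
- by left.
Qed.

Lemma affine_neq0 (u v : F) : (u != 0) || (v != 0) ->
  exists x : int, u + v * q ^ (- x) != 0.
Proof.
have [v0 un|v0 _] := eqVneq v 0.
  by exists 0; rewrite v0 mul0r addr0; move: un; rewrite orbF.
have [e0|] := eqVneq (u + v * q ^ (- 0%:Z)) 0; last by exists 0.
exists (-1); apply/eqP => e1.
have : v * (q - 1) = 0.
  transitivity ((u + v * q ^ (- -1)) - (u + v * q ^ (- 0%:Z))).
    by rewrite opprK oppr0 expr1z expr0z; ring.
  by rewrite e0 e1 subrr.
move/eqP; rewrite mulf_eq0 (negbTE v0) subr_eq0.
by rewrite (negbTE (qroot (ltn0Sn 0))).
Qed.

Lemma stepI eta a N : a != 0 -> step (Family eta a N) (Family eta (q * a) N)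
  (q ^- N) (- a * q * q ^ (- eta)).
Proof.
move=> a0; have lamE (x : int) : q ^- N - a * q ^ (1 - (x + eta))
    = q ^- N + - a * q * q ^ (- eta) * q ^ (- x).
  rewrite opprD addrA !expfzDr // expr1z.
  by move: (q ^ (- x)) (q ^ (- eta)) => y z; ring.
eexists; eexists; split.
- exists (coefs 0 (fun i => q ^- i) (fun i => 1 - q ^- i)) => //; split.
  + by rewrite subrr.
  + exact: contiguityI.
  + by rewrite /coefs /= expr0 invr1 oner_neq0.
- split; first exact: contiguityI_assoc.
  have [|x hx] := @affine_neq0 (q ^- N) (- a * q * q ^ (- eta)).
    by apply/orP; left; apply: invr_neq0; apply: expf_neq0.
  by exists x; rewrite lamE.
- exact: lamE.
- by left.
Qed.

Lemma stepII eta a N : a != 0 -> (0 < N)%N ->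
  step (Family eta a N) (Family eta (q * a) N.-1)
  (a * q / (1 - q ^+ N)) (- a * q * q ^+ N * q ^ (- eta) / (1 - q ^+ N)).
Proof.
move=> a0 N0; have lamE (x : int) :
    a * q * (1 - q ^ (N%:Z - (x + eta))) / (1 - q ^+ N)
    = a * q / (1 - q ^+ N) + - a * q * q ^+ N * q ^ (- eta) / (1 - q ^+ N)
      * q ^ (- x).
  rewrite opprD addrA !expfzDr //.
  by move: (q ^ (- x)) (q ^ (- eta)) => y z; rewrite -[q ^ N]/(q ^+ N); ring.
have N1 : 1 - q ^+ N != 0 by rewrite subr_eq0 eq_sym qroot.
eexists; eexists; split.
- exists (coefs 0 (fun i => (1 - q ^ (N%:Z - i%:Z)) / (1 - q ^+ N))
           (fun i => (1 - q ^- i) / (1 - q ^- N))); first split.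
  + by rewrite subrr.
  + exact: contiguityII.
  + by rewrite /coefs /= subr0 mulfV // oner_neq0.
  + by rewrite /in_range /= => x; lia.
- split; first exact: contiguityII_assoc.
  have [|x hx] := @affine_neq0 (a * q / (1 - q ^+ N))
     (- a * q * q ^+ N * q ^ (- eta) / (1 - q ^+ N)).
    by apply/orP; left; apply: mulf_neq0; [apply: mulf_neq0|apply: invr_neq0].
  by exists x; rewrite lamE.
- exact: lamE.
- rewrite /in_range /= => x hx.
  have [e|] := eqVneq (x + eta) N%:Z.
    by right; rewrite e subrr expr0z subrr mulr0 mul0r.
  by left; lia.
Qed.

Lemma stepIII eta a N : a != 0 -> (0 < N)%N ->
  step (Family eta a N) (Family (eta - 1) a N.-1)
  (a * q ^+ N.+1 / (1 - q ^+ N))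
  (- a * q ^+ N.+1 / (1 - q ^+ N) * q ^ (- eta)).
Proof.
move=> a0 N0; have lamE (x : int) :
    a * q ^+ N.+1 * ((1 - q ^ (- (x + eta))) / (1 - q ^+ N))
    = a * q ^+ N.+1 / (1 - q ^+ N)
      + - a * q ^+ N.+1 / (1 - q ^+ N) * q ^ (- eta) * q ^ (- x).
  rewrite opprD !expfzDr //.
  by move: (q ^ (- x)) (q ^ (- eta)) => y z; ring.
have N1 : 1 - q ^+ N != 0 by rewrite subr_eq0 eq_sym qroot.
eexists; eexists; split.
- have h := contiguity_scale (1 - q ^+ N)^-1 (contiguityIII q0 qroot eta a N0).
  eexists; first split.
  + by rewrite /= addrAC subrr add0r.
  + by apply: (contiguity_ext _ h) => x; rewrite mulVf.
  + by rewrite /coefs /= subr0 mulVf // oner_neq0.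
  + by rewrite /in_range /= => x; lia.
- split; first exact: contiguityIII_assoc.
  have [|x hx] := @affine_neq0 (a * q ^+ N.+1 / (1 - q ^+ N))
     (- a * q ^+ N.+1 / (1 - q ^+ N) * q ^ (- eta)).
    apply/orP; left; apply: mulf_neq0; last exact: invr_neq0.
    by apply: mulf_neq0 => //; apply: expf_neq0.
  by exists x; rewrite lamE.
- exact: lamE.
- rewrite /in_range /= => x hx.
  have [e|] := eqVneq (x + eta) 0.
    by right; rewrite e oppr0 expr0z subrr mul0r mulr0.
  by left; lia.
Qed.

Lemma fpoly_alpha0 (g : family F) i x : falpha g = 0 -> fpoly q g i x = 1.
Proof.
move=> b0; rewrite fpolyE /qqKsum b0 big_ord_recl qcoef0 qpoch0 mulr1 big1 ?addr0 //.
by move=> k _; rewrite /qcoef mul0r expr0n mulr0 mul0r.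
Qed.

(** If the target parameter beta were 0, all g_j would be constant, but f_1 is
not. *)
Lemma target_alpha_neq0 eps (f g : family F) lam Phi :
  falpha f != 0 -> (0 < fN f)%N -> contiguity q eps f g lam Phi ->
  (forall e, e \in eps -> 1 + e <= (fN g)%:Z) -> (exists x, lam x != 0) ->
  falpha g != 0.
Proof.
move=> a0 N0 [z h] he [x hx]; apply/eqP=> b0.
have he0 e : e \in eps -> 0%N%:Z + e <= (fN g)%:Z by move=> /he; lia.
have h0 y := h 0%N y isT (or_introl he0).
have h1 y := h 1%N y N0 (or_introl he).
pose c0 := \sum_(e <- eps | in_range g (0%N%:Z + e)) Phi e 0%N.
pose c1 := \sum_(e <- eps | in_range g (1%N%:Z + e)) Phi e 1%N.
have l0 y : lam y = c0.
  have := h0 y; rewrite fpoly0 mulr1 => ->; apply: eq_bigr => e _.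
  by rewrite fpoly_alpha0 // mulr1.
have l1 y : lam y * fpoly q f 1 y = c1.
  by rewrite h1; apply: eq_bigr => e _; rewrite fpoly_alpha0 // mulr1.
have fE y : fpoly q f 1 y = 1 + qcoef q (falpha f) (q ^- fN f) 1 1
    * (1 - q ^ (- (y + feta f))).
  by rewrite fpolyE /qqKsum big_ord_recr big_ord1 /= qcoef0 qpochS !qpoch0 expr0; ring.
have e0 := l1 (- feta f); have e1 := l1 (1 - feta f).
rewrite fE l0 addNr oppr0 expr0z subrr mulr0 addr0 mulr1 in e0.
rewrite fE l0 subrK -e0 -[RHS]mulr1 in e1.
have c0n : c0 != 0 by rewrite -(l0 x).
have c11 : qcoef q (falpha f) (q ^- fN f) 1 1 != 0 by apply: qcoef_neq0.
move/(mulfI c0n)/eqP: e1; rewrite -subr_eq0 addrAC subrr add0r mulf_eq0.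
rewrite (negbTE c11) subr_eq0 => /eqP e.
by have := qexpz_eq1 qroot (esym e).
Qed.

(** The relation for i = 0 gives the shape of the factor. *)
Lemma lam_affine eps (f g : family F) lam Phi :
  eps = epsB2 \/ eps = epsA2_assoc -> (0 < fN g)%N ->
  contiguity q eps f g lam Phi ->
  exists u v, forall x : int, lam x = u + v * q ^ (- x).
Proof.
move=> heps M0 [z h].
pose k := qcoef q (falpha g) (q ^- fN g) 1 1.
exists (Phi 1 0%N * (1 + k) + Phi 0 0%N), (- (Phi 1 0%N * k * q ^ (- feta g))).
move=> x; have := h 0%N x isT; rewrite fpoly0 mulr1 => -> //; last first.
  by left=> e; case: heps => ->; rewrite !inE => he; lia.
have r1 : in_range g (0%N%:Z + 1) by rewrite /in_range; lia.
have r0 : in_range g (0%N%:Z + 0) by rewrite /in_range; lia.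
have r2 : in_range g (0%N%:Z + -1) = false by [].
transitivity (Phi 1 0%N * fpoly q g 1 x + Phi 0 0%N * 1).
  by case: heps => ->; rewrite /epsB2 /epsA2_assoc !big_cons big_nil r1 r0 ?r2 /=
    fpoly0 addr0.
rewrite fpolyE /qqKsum big_ord_recr big_ord1 /= qcoef0 qpochS.
rewrite !qpoch0 expr0 mulr1 -/k opprD expfzDr //.
by move: (q ^ (- x)) (q ^ (- feta g)) => y y0; ring.
Qed.

Lemma lam_const eps (f g : family F) lam Phi : eps = epsA2 \/ eps = epsB2' ->
  contiguity q eps f g lam Phi -> forall x : int, lam x = Phi 0 0%N.
Proof.
move=> heps [z h] x; have := h 0%N x isT; rewrite fpoly0 mulr1 => ->; last first.
  by left=> e; case: heps => ->; rewrite !inE => /orP [/eqP|] ; lia.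
by case: heps => ->; rewrite /epsA2 /epsB2' !big_cons big_nil /in_range /=
  ?fpoly0 mulr1 addr0.
Qed.

End Steps.

(** * The targets of relations *)
Section Targets.
Variables (F : fieldType) (q : F).
Hypotheses (q0 : q != 0) (qroot : forall k : nat, (0 < k)%N -> q ^+ k != 1).

Lemma comp_coefs_scale eps1 eps2 c (Phi1 Phi2 : int -> nat -> F) e i :
  comp_coefs eps1 eps2 (fun e i => c * Phi1 e i) Phi2 e i
  = c * comp_coefs eps1 eps2 Phi1 Phi2 e i.
Proof.
by rewrite /comp_coefs mulr_sumr; apply: eq_bigr => e1 _; rewrite mulrA.
Qed.

Lemma A2_scale f h Phi c : c != 0 -> A2 q f h (fun _ => 1) Phi ->
  A2 q f h (fun _ => c * 1) (fun e i => c * Phi e i).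
Proof.
move=> c0 [he hc h0]; split=> //; last by rewrite mulf_neq0.
exact: contiguity_scale hc.
Qed.

(** Composition of a forward relation from f to h with the associated relation of
a step from g to h.  Any multiple of the composite is of the required form. *)
Lemma B2_pair (f g h : family F) u v : forward q f h -> step q g h u v ->
  exists2 Phi0, latrel q epsB2 f g (fun x => u + v * q ^ (- x)) Phi0 &
  forall c lam Phi, c != 0 -> (forall x : int, lam x = c * (u + v * q ^ (- x))) ->
    (forall (i : nat) (e : int), (i <= fN f)%N -> e \in epsB2 ->
        Phi e i = c * Phi0 e i) ->
    B2_from_A2 q f g lam Phi.
Proof.
move=> [Phi1 h1 _] [lam3 [Phi3 [[Phi2 h2 _] h3 lamE hx]]].
exists (comp_coefs epsA2 epsA2_assoc Phi1 Phi3).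
  have [h10 h11] : latrel q epsB2 f g (fun x => 1 * lam3 x)
      (comp_coefs epsA2 epsA2_assoc Phi1 Phi3).
    apply: (@latrel_comp _ _ q0 epsA2 epsA2_assoc epsB2 f g h) => //.
    - by move=> e1 e2; rewrite !inE => /orP [] /eqP -> /orP [] /eqP ->.
    - by apply: contiguity_latrel; case: h1.
    - by apply: contiguity_latrel; case: h3.
  by split=> // i x hi hr; rewrite -h11 // mul1r lamE.
move=> c lam Phi c0 hlam hPhi.
exists h, (fun _ => c * 1), (fun e i => c * Phi1 e i), (fun _ => 1), Phi2, lam3, Phi3.
split=> //.
- exact: A2_scale.
- by move=> x; rewrite hlam mulr1 lamE.
- by move=> i e hi he; rewrite hPhi // comp_coefs_scale.
Qed.

Lemma B2'_pair (f g h : family F) : forward q f h -> forward q h g ->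
  exists2 Phi0, latrel q epsB2' f g (fun _ => 1) Phi0 &
  forall c lam Phi, c != 0 -> (forall x : int, lam x = c) ->
    (forall (i : nat) (e : int), (i <= fN f)%N -> e \in epsB2' ->
        Phi e i = c * Phi0 e i) ->
    B2'_from_A2 q f g lam Phi.
Proof.
move=> [Phi1 h1 _] [Phi2 h2 hx].
exists (comp_coefs epsA2 epsA2 Phi1 Phi2).
  have [h10 h11] : latrel q epsB2' f g (fun x => 1 * 1)
      (comp_coefs epsA2 epsA2 Phi1 Phi2).
    apply: (@latrel_comp _ _ q0 epsA2 epsA2 epsB2' f g h) => //.
    - by move=> e1 e2; rewrite !inE => /orP [] /eqP -> /orP [] /eqP ->.
    - by apply: contiguity_latrel; case: h1.
    - by apply: contiguity_latrel; case: h2.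
    - by move=> x /hx; left.
  by split=> // i x hi hr; rewrite -h11 // !mul1r.
move=> c lam Phi c0 hlam hPhi.
exists h, (fun _ => c * 1), (fun e i => c * Phi1 e i), (fun _ => 1), Phi2.
split=> //.
- exact: A2_scale.
- by move=> x; rewrite hlam !mulr1.
- by move=> i e hi he; rewrite hPhi // comp_coefs_scale.
Qed.

Lemma step_forward g h u v : step q g h u v -> forward q g h.
Proof. by move=> [? [? []]]. Qed.

Lemma qeta_eq (eta k : int) z : q ^ eta = z -> z = q ^ k -> eta = k.
Proof. by move=> <- /(qexpz_inj q0 qroot). Qed.

Lemma qM_eq (M N j : nat) : q ^- M = q ^- N * q ^+ j -> (M + j)%N = N.
Proof.
move=> e; have : q ^ (- M%:Z) = q ^ (- N%:Z + j%:Z).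
  by rewrite expfzDr // -!exprnN.
by move/(qexpz_inj q0 qroot); lia.
Qed.

Lemma qM_eqV (M N : nat) : q ^- M = q ^- N / q -> M = N.+1.
Proof.
move=> e; have h : q ^- N = q ^- M * q ^+ 1 by rewrite expr1 e mulfVK.
by rewrite -(qM_eq h) addn1.
Qed.

Section Source.
Variables (a : F) (N : nat).
Hypotheses (a0 : a != 0) (ga : forall k : int, a != q ^ k).
Local Notation f := (Family 0 a N).

(** The targets of the trivial relation and of the relations I, II, III. *)
Inductive target1 : family F -> Prop :=
| Target0 : target1 f
| TargetI : target1 (Family 0 (q * a) N)
| TargetII : target1 (Family 0 (q * a) N.-1)
| TargetIII : target1 (Family (-1) a N.-1).

(** The targets of the compositions of two relations out of I, II, III. *)
Inductive target2 : family F -> Prop :=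
| TargetI_I : target2 (Family 0 (q * (q * a)) N)
| TargetI_II : target2 (Family 0 (q * (q * a)) N.-1)
| TargetII_II : target2 (Family 0 (q * (q * a)) N.-1.-1)
| TargetI_III : target2 (Family (-1) (q * a) N.-1)
| TargetII_III : target2 (Family (-1) (q * a) N.-1.-1)
| TargetIII_III : target2 (Family (-1 - 1) a N.-1.-1).

Lemma const_target eps (g : family F) lam Phi c d : falpha g != 0 ->
  latrel q eps f g lam Phi -> c != 0 ->
  (forall y : int, in_range g (y + feta g) -> lam y = c) ->
  (forall e : int, e \in eps -> - d%:Z <= e) ->
  d = 1%N \/ d = 2%N -> (d.+2 <= N)%N ->
  target1 g \/ (d = 2%N /\ target2 g).
Proof.
case: g => eta b M /= b0 hrel c0 hlam he hd dN.
have tV : q^-1 = q ^ (-1) by [].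
have tV2 : q^-1 ^+ 2 = q ^ (-2) by rewrite -exprz_inv.
have eta0 : q ^ eta = 1 -> eta = 0 by move=> h; apply: (qeta_eq h).
have eta1 : q ^ eta = q^-1 -> eta = -1 by move=> h; apply: (qeta_eq h).
have eta2 : q ^ eta = q^-1 ^+ 2 -> eta = -2 by move=> h; apply: (qeta_eq h).
have M0 : q ^- M = q ^- N -> M = N.
  by move=> h; rewrite -(@qM_eq M N 0) ?addn0 // expr0 mulr1.
have M1 : q ^- M = q ^- N * q -> M = N.-1.
  by move=> h; rewrite -(@qM_eq M N 1) ?addn1 // expr1.
have M2 : q ^- M = q ^- N * q ^+ 2 -> M = N.-1.-1.
  by move=> h; rewrite -(@qM_eq M N 2) ?addn2.
case: (constant_classification q0 qroot a0 b0 ga hrel c0 hlam he hd dN).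
- move=> [bE t1 mE]; left.
  by rewrite bE t1 mulr1 (eta0 t1) (M0 mE); constructor.
- move=> [bE]; have bE1 : q ^ eta = 1 -> b = q * a.
    by move=> t1; rewrite bE t1 mulr1 mulrC.
  have bE2 : q ^ eta = q^-1 -> b = a by move=> t1; rewrite bE t1 mulfVK.
  case=> [[t1 mE]|[t1 mE]|[t1 mE]]; left.
  + by rewrite (bE1 t1) (eta0 t1) (M0 mE); constructor.
  + by rewrite (bE1 t1) (eta0 t1) (M1 mE); constructor.
  + by rewrite (bE2 t1) (eta1 t1) (M1 mE); constructor.
- move=> [d2 bE]; have bE1 : q ^ eta = 1 -> b = q * (q * a).
    by move=> t1; rewrite bE t1; ring.
  have bE2 : q ^ eta = q^-1 -> b = q * a by move=> t1; rewrite bE t1; field.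
  have bE3 : q ^ eta = q^-1 ^+ 2 -> b = a by move=> t1; rewrite bE t1; field.
  case=> [[t1 [mE|mE|mE]]|[t1 [mE|mE]]|[t1 mE]]; right; split=> //.
  + by rewrite (bE1 t1) (eta0 t1) (M0 mE); constructor.
  + by rewrite (bE1 t1) (eta0 t1) (M1 mE); constructor.
  + by rewrite (bE1 t1) (eta0 t1) (M2 mE); constructor.
  + by rewrite (bE2 t1) (eta1 t1) (M1 mE); constructor.
  + by rewrite (bE2 t1) (eta1 t1) (M2 mE); constructor.
  + by rewrite (bE3 t1) (eta2 t1) (M2 mE); constructor.
Qed.

Lemma target_alpha (g : family F) : target1 g \/ target2 g ->
  exists k : nat, falpha g = q ^+ k * a.
Proof.
have e2 : q * (q * a) = q ^+ 2 * a by rewrite expr2 mulrA.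
case=> [] [] /=; rewrite ?e2; try by exists 0%N; rewrite mul1r.
all: by [exists 1%N; rewrite expr1|exists 2%N].
Qed.

(** For alpha = 1/q the polynomials R_1, ..., R_M vanish at the last lattice point;
the quotients by this factor form the family with alpha = q and M - 1.  This
follows from the associated relation of II with alpha = 1/q followed by the
relation I with alpha = 1. *)
Lemma fpoly_degenerate eta M j x : (j < M)%N ->
  fpoly q (Family eta q^-1 M) j.+1 x =
  (1 - q ^ (M%:Z - (x + eta))) / (1 - q ^+ M)
    * fpoly q (Family eta q M.-1) j x.
Proof.
move=> jM; have M0 : (0 < M)%N by case: M jM.
have h1 i : (i < M)%N -> (1 - q ^ (M%:Z - (x + eta))) / (1 - q ^+ M)
    * fpoly q (Family eta 1 M.-1) i x =
    (1 - q ^- i) * fpoly q (Family eta q^-1 M) i x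
    + q ^- i * fpoly q (Family eta q^-1 M) i.+1 x.
  move=> iM; have [z /(_ i x)] := contiguityII_assoc q0 qroot eta q^-1 M0.
  rewrite /= (sum_epsA2_assoc (fun j => fpoly q (Family eta q^-1 M) j x)).
    rewrite /coefs /= mulVf // mulfV // mul1r => -> //; first by rewrite addrC.
      by lia.
    by left=> e; rewrite !inE => /orP [] /eqP ->; lia.
  by move=> e he; apply: z => //=; lia.
have h2 i : fpoly q (Family eta 1 M.-1) i x =
    q ^- i * fpoly q (Family eta q M.-1) i x
    + (1 - q ^- i) * fpoly q (Family eta q M.-1) i.-1 x.
  by rewrite !fpolyE /= qqKsum_I // mulr1.
have qi0 i : q ^- i != 0 by rewrite invr_neq0 // expf_neq0.
elim: j jM => [|j IH] jM; [apply: (mulfI (qi0 0%N))|apply: (mulfI (qi0 j.+1))].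
  have := h1 0%N jM; rewrite h2 expr0 invr1 subrr !mul0r add0r addr0 !mul1r.
  by move=> <-.
apply: (@addrI _ ((1 - q ^- j.+1) * fpoly q (Family eta q^-1 M) j.+1 x)).
rewrite -h1 // h2 /= IH; last exact: ltnW.
by ring.
Qed.

(** Dividing by the factor turns a B2 relation with target parameter 1/q into a
relation of type B2' with constant factor and target parameter q, which is not
of the form q^k alpha. *)
Lemma degenerate_target eta M lam Phi (B : F) :
  latrel q epsB2 f (Family eta q^-1 M) lam Phi -> B != 0 ->
  (forall y : int, in_range (Family eta q^-1 M) (y + eta) ->
     lam y = B * (q ^ (- y) - q ^- M * q ^ eta)) ->
  (4 <= N)%N -> (1 < M)%N -> False.
Proof.
move=> [z h] B0 hlam N4 M1.
pose G := Family eta q^-1 M; pose G2 := Family eta q M.-1.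
pose Lam (x : int) := (1 - q ^ (M%:Z - (x + eta))) / (1 - q ^+ M).
pose C := - B * q ^ eta * q ^- M * (1 - q ^+ M).
have M0 : (0 < M)%N by apply: ltnW.
have qM1 : 1 - q ^+ M != 0 by rewrite subr_eq0 eq_sym qroot.
have C0 : C != 0.
  rewrite /C !mulf_neq0 ?oppr_eq0 ?invr_neq0 ?expf_neq0 ?expfz_neq0 //.
have lamE (y : int) : in_range G (y + eta) -> lam y = C * Lam y.
  move=> hy; rewrite hlam // /C /Lam.
  rewrite opprD addrA !expfzDr // -[q ^ M]/(q ^+ M) -[q ^ (- eta)]invr_expz.
  have : q ^ eta != 0 by rewrite expfz_neq0.
  have : q ^+ M != 0 by rewrite expf_neq0.
  move: (q ^ eta) (q ^+ M) (q ^ (- y)) qM1 => u v y' v1 v0 u0.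
  by field; rewrite u0 v0 v1.
(* the coefficient of g_0 is read off at the last lattice point *)
have Phi0 (i : nat) e : (i <= N)%N -> e \in epsB2 -> i%:Z + e = 0 -> Phi e i = 0.
  move=> iN he ie; have xG : in_range G (M%:Z - eta + eta).
    by rewrite subrK /in_range lexx.
  have := h i (M%:Z - eta) iN xG.
  rewrite lamE // /Lam subrK subrr expr0z subrr mul0r mulr0 mul0r.
  rewrite big_mkcond (bigD1_seq e) //= ie /= fpoly0 mulr1.
  rewrite big1_seq /= ?addr0 // => e' /andP [ne he'].
  case: ifP => // /andP [r0 rM].
  case ee: (absz (i%:Z + e')) => [|k]; first by case/eqP: ne; lia.
  have kM : (k < M)%N by have rM' : i%:Z + e' <= M%:Z := rM; lia.
  by rewrite (fpoly_degenerate _ _ kM) subrK subrr expr0z subrr mul0r mul0r mulr0.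
have hrel : latrel q epsB2' f G2 (fun _ => C) (fun e => Phi (e + 1)).
  have sh : epsB2' = [seq e - 1 | e <- epsB2] by [].
  split=> [i e iN|i x iN xG2].
    rewrite sh => /mapP [e' he' ->]; rewrite subrK => r.
    have [ie|ie] := eqVneq (i%:Z + e') 0; first exact: Phi0.
    by apply: z => //; apply: contra r; rewrite /in_range /=; lia.
  have xG : in_range G (x + eta) by move: xG2; rewrite /in_range /=; lia.
  have L0 : Lam x != 0.
    rewrite /Lam mulf_neq0 ?invr_neq0 // subr_eq0 eq_sym.
    apply/eqP => /(qexpz_eq1 qroot); move: xG2; rewrite /in_range /=; lia.
  apply: (mulfI L0); rewrite mulrA [Lam x * C]mulrC -lamE // h // mulr_sumr.
  rewrite sh big_map big_mkcond [RHS]big_mkcond /= big_seq [RHS]big_seq.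
  apply: eq_bigr => e he; rewrite subrK.
  have [ie|ie] := eqVneq (i%:Z + e) 0.
    by rewrite Phi0 // !mul0r mulr0 !if_same.
  have rE : in_range G (i%:Z + e) = in_range G2 (i%:Z + (e - 1)).
    by rewrite /in_range /=; lia.
  rewrite rE; case: ifP => // /andP [r0 rM].
  case ee: (absz (i%:Z + e)) => [|k]; first by case/eqP: ie; lia.
  have kM : (k < M)%N by have rM' : i%:Z + (e - 1) <= M.-1%:Z := rM; lia.
  have -> : absz (i%:Z + (e - 1)) = k by lia.
  by rewrite (fpoly_degenerate _ _ kM) mulrCA.
have he e : e \in epsB2' -> - 2%:Z <= e.
  by rewrite !inE => /or3P [] /eqP ->.
have t : target1 G2 \/ target2 G2.
  have [|[_]] := @const_target epsB2' G2 _ _ C 2 q0 hrel C0 (fun _ _ => erefl)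
    he (or_intror erefl) N4; by [left|right].
have [k /= qE] := target_alpha t.
have := qpow_generic q0 ga (qpowX q k) (qpowX q 1).
by rewrite mulrC -qE expr1 eqxx.
Qed.

(** When no relation with constant factor leads to g, the relation is a multiple of
the composite through h. *)
Lemma B2_nonconstant (g h : family F) lam Phi u v u' v' :
  falpha g != 0 -> latrel q epsB2 f g lam Phi ->
  (forall x : int, lam x = u' + v' * q ^ (- x)) -> v' != 0 ->
  forward q f h -> step q g h u v -> v != 0 -> ~ target1 g -> (3 <= N)%N ->
  B2_from_A2 q f g lam Phi.
Proof.
move=> b0 hrel lamE v'0 hf hg v0 nt N3.
have [Phi0 hrel0 build] := B2_pair hf hg.
have hd := latrel_sub hrel (latrel_scale (v' / v) hrel0).
have dE (x : int) : lam x - v' / v * (u + v * q ^ (- x)) = u' - v' / v * u.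
  by rewrite lamE; field.
have c0 : v' / v != 0 by rewrite mulf_neq0 // invr_neq0.
have k0 : u' - v' / v * u = 0.
  apply/eqP; apply: contra_notT nt => k0.
  have he e : e \in epsB2 -> - 1%:Z <= e by rewrite !inE => /or3P [] /eqP ->.
  by have [|[]] := const_target b0 hd k0 (fun y _ => dE y) he (or_introl erefl) N3.
apply: (build (v' / v)) => //.
  by move=> x; apply/eqP; rewrite -subr_eq0 dE k0.
move=> i e hi hee; apply/eqP; rewrite -subr_eq0; apply/eqP.
have ueps : uniq epsB2 by [].
apply: (latrel_zero q0 qroot b0 ueps hd _ hi hee).
by move=> x _; rewrite dE.
Qed.

End Source.
End Targets.

(** * Relations of type A2 *)
Section A2Relations.
Variables (F : fieldType) (q a : F) (N : nat).
Hypotheses (q0 : q != 0) (qroot : forall k : nat, (0 < k)%N -> q ^+ k != 1).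
Hypotheses (a0 : a != 0) (ga : forall k : int, a != q ^ k).
Local Notation f := (Family 0 a N).

Lemma A2_listP g lamp Phip lamm Phim : A2_list q a N g lamp Phip lamm Phim ->
  [/\ A2 q f g lamp Phip, A2_assoc q f g lamm Phim,
      exists2 l0, l0 != 0 & forall x : int, lamp x = l0 &
      exists u v, v != 0 /\ forall x : int, lamm x = u + v * q ^ (- x)].
Proof.
case=> [|N0|N0].
- have lamE (x : int) : q ^- N - a * q ^ (1 - x) = q ^- N + (- a * q) * q ^ (- x).
    by rewrite expfzDr // expr1z; move: (q ^ (- x)) => y; ring.
  split.
  + split; first by [].
      exact: contiguityI.
    by rewrite /coefs /= expr0 invr1 oner_neq0.
  + split.
      apply: (contiguity_ext _ (contiguityI_assoc q0 qroot 0 a N)) => x.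
      by rewrite addr0.
    have [|x hx] := @affine_neq0 _ q qroot (q ^- N) (- a * q).
      by apply/orP; right; rewrite mulf_neq0 ?oppr_eq0.
    by exists x; rewrite lamE.
  + by exists 1; first exact: oner_neq0.
  + by exists (q ^- N), (- a * q); split=> //; rewrite mulf_neq0 ?oppr_eq0.
- have N1 : 1 - q ^+ N != 0 by rewrite subr_eq0 eq_sym qroot.
  have lamE (x : int) : a * q * (1 - q ^ (N%:Z - x)) / (1 - q ^+ N)
      = a * q / (1 - q ^+ N) + (- (a * q * q ^+ N / (1 - q ^+ N))) * q ^ (- x).
    by rewrite expfzDr // -[q ^ N]/(q ^+ N); move: (q ^ (- x)) => y; ring.
  have v0 : - (a * q * q ^+ N / (1 - q ^+ N)) != 0.
    by rewrite oppr_eq0; do ?[apply: mulf_neq0 | apply: invr_neq0 | apply: expf_neq0].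
  split.
  + split; first by [].
      exact: contiguityII.
    by rewrite /coefs /= subr0 mulfV // oner_neq0.
  + split.
      apply: (contiguity_ext _ (contiguityII_assoc q0 qroot 0 a N0)) => x.
      by rewrite addr0.
    have [|x hx] := @affine_neq0 _ q qroot (a * q / (1 - q ^+ N))
       (- (a * q * q ^+ N / (1 - q ^+ N))); first by apply/orP; right.
    by exists x; rewrite lamE.
  + by exists 1; first exact: oner_neq0.
  + by exists (a * q / (1 - q ^+ N)), (- (a * q * q ^+ N / (1 - q ^+ N))).
- have N1 : 1 - q ^+ N != 0 by rewrite subr_eq0 eq_sym qroot.
  have lamE (x : int) : a * q ^+ N.+1 * ((1 - q ^ (- x)) / (1 - q ^+ N))
      = a * q ^+ N.+1 / (1 - q ^+ N) + (- (a * q ^+ N.+1 / (1 - q ^+ N))) * q ^ (- x).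
    by move: (q ^ (- x)) => y; ring.
  have v0 : - (a * q ^+ N.+1 / (1 - q ^+ N)) != 0.
    by rewrite oppr_eq0; do ?[apply: mulf_neq0 | apply: invr_neq0 | apply: expf_neq0].
  split.
  + split; first by [].
      exact: (contiguityIII q0 qroot 0 a N0).
    by rewrite /coefs /= subr0.
  + split.
      apply: (contiguity_ext _ (contiguityIII_assoc q0 qroot 0 a N0)) => x.
      by rewrite addr0.
    have [|x hx] := @affine_neq0 _ q qroot (a * q ^+ N.+1 / (1 - q ^+ N))
       (- (a * q ^+ N.+1 / (1 - q ^+ N))); first by apply/orP; right.
    by exists x; rewrite lamE.
  + by exists (1 - q ^+ N).
  + by exists (a * q ^+ N.+1 / (1 - q ^+ N)), (- (a * q ^+ N.+1 / (1 - q ^+ N))).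
Qed.

Lemma A2_list_coef g lamp Phip lamm Phim : A2_list q a N g lamp Phip lamm Phim ->
  Phip (-1) 1%N != 0.
Proof.
have q1 : 1 - q^-1 != 0 by rewrite subr_eq0 eq_sym invr_eq1 (qroot (ltn0Sn 0)).
case=> [|N0|N0]; rewrite /coefs //=.
  by rewrite mulf_neq0 // invr_neq0 // q1N_neq0.
rewrite !mulf_neq0 ?oppr_eq0 ?expf_neq0 // subr_eq0 eq_sym.
by have := qpow_generic q0 ga (qpowX q 1) (qpow1 q).
Qed.

Lemma A2_rescaled g lam Phi lamp Phip l0 : falpha g != 0 ->
  A2 q f g lam Phi -> contiguity q epsA2 f g lamp Phip -> l0 != 0 ->
  (forall x : int, lamp x = l0) ->
  exists2 c, c != 0 & rescaled c epsA2 N lamp Phip lam Phi.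
Proof.
move=> b0 [_ hc h00] hp l00 lampE.
have lamE := lam_const q0 (or_introl erefl) hc.
exists (Phi 0 0%N / l0); first by rewrite mulf_neq0 // invr_neq0.
have e (x : int) : lam x - Phi 0 0%N / l0 * lamp x = 0.
  by rewrite lamE lampE mulfVK // subrr.
split=> [x|i e' hi he].
  by apply/eqP; rewrite -subr_eq0 e.
apply/eqP; rewrite -subr_eq0; apply/eqP.
have hd := latrel_sub (contiguity_latrel hc)
  (latrel_scale (Phi 0 0%N / l0) (contiguity_latrel hp)).
have ueps : uniq epsA2 by [].
by apply: (latrel_zero q0 qroot b0 ueps hd _ hi he) => x _; rewrite e.
Qed.

(** The factors of two associated relations differ, after rescaling, by a
constant k.  Substituting the relation for f_1 into the one for g_1 gives a
linear dependence between f_0, f_1 and f_2 in which f_0 has coefficient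
- k Phip (-1) 1. *)
Lemma assoc_rescaled g lamp Phip lamm Phim u v l0 lam' Phi' :
  (2 <= N)%N -> (1 <= fN g)%N ->
  contiguity q epsA2 f g lamp Phip -> (forall x : int, lamp x = l0) ->
  Phip (-1) 1%N != 0 ->
  A2_assoc q f g lamm Phim -> v != 0 ->
  (forall x : int, lamm x = u + v * q ^ (- x)) ->
  A2_assoc q f g lam' Phi' ->
  exists2 c, c != 0 & rescaled c epsA2_assoc (fN g) lamm Phim lam' Phi'.
Proof.
move=> N2 M1 hp lampE p1 [hm _] v0 lammE [hc [x0 lx0]].
have [u' [v' lamE]] : exists u' v', forall x : int, lam' x = u' + v' * q ^ (- x).
  by apply: (lam_affine q0 (or_intror erefl) _ hc) => /=; lia.
pose Psi e i := Phi' e i - v' / v * Phim e i.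
have hd : latrel q epsA2_assoc g f (fun x => lam' x - v' / v * lamm x) Psi.
  exact: latrel_sub (contiguity_latrel hc)
    (latrel_scale (v' / v) (contiguity_latrel hm)).
have dE (x : int) : lam' x - v' / v * lamm x = u' - v' / v * u.
  by rewrite lamE lammE; field.
pose k := u' - v' / v * u.
have k0 : k = 0.
  pose c i := if i == 0%N then - (k * Phip (-1) 1%N) else
    if i == 1%N then k * l0 - Phip 0 1%N * Psi 0 1%N else
    if i == 2%N then - (Phip 0 1%N * Psi 1 1%N) else 0.
  have : c 0%N = 0.
    apply: (@lattice_free _ q q0 qroot a N c a0) => // j jN.
    have xf : in_range f (j%:Z + feta f) by rewrite /= addr0 /in_range lez_nat.
    have := hd.2 1%N j%:Z M1 xf; rewrite dE -/k.
    rewrite (sum_epsA2_assoc (fun i => fpoly q f i j%:Z)); last first.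
      by move=> e he; apply: hd.1.
    have he e : e \in epsA2 -> 1%N%:Z + e <= (fN g)%:Z.
      by rewrite !inE => he; lia.
    have := hp.2 1%N j%:Z (ltnW N2) (or_introl he).
    rewrite (sum_epsA2 (fun i => fpoly q g i j%:Z)); last first.
      by move=> e hee; apply: hp.1 => //; apply: ltnW.
    rewrite lampE fpoly0 => e1 e2.
    have PE i : qqKsum q a (q ^- N) i (q ^- j) = fpoly q f i j%:Z.
      by rewrite fpolyE /= addr0 -exprnN.
    under eq_bigr => i _ do rewrite PE.
    rewrite (bigD1 (ord0 : 'I_N.+1)) //= (bigD1 (inord 1 : 'I_N.+1)) /=; last first.
      by rewrite -val_eqE /= inordK // ltnW.
    rewrite (bigD1 (inord 2 : 'I_N.+1)) /=; last first.
      by rewrite -!val_eqE /= !inordK // ltnW.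
    rewrite big1 ?addr0 ?inordK // ?(leqW N2) //.
      rewrite /c /= fpoly0 mulr1.
      transitivity (k * (l0 * fpoly q f 1 j - Phip (-1) 1%N * 1)
        - Phip 0 1%N * (Psi 1 1%N * fpoly q f 2 j + Psi 0 1%N * fpoly q f 1 j));
        first by ring.
      by rewrite -e2 e1; ring.
    move=> i /andP [/andP [i0 i1] i2]; rewrite /c.
    move: i0 i1 i2; rewrite -!val_eqE /= !inordK // ?(leqW N2) //.
    by move=> /negbTE -> /negbTE -> /negbTE ->; rewrite mul0r.
  by rewrite /c /= => /eqP; rewrite oppr_eq0 mulf_eq0 (negbTE p1) orbF => /eqP.
have e (x : int) : lam' x = v' / v * lamm x.
  by apply/eqP; rewrite -subr_eq0 dE -/k k0.
exists (v' / v).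
  by apply: contra_neq lx0 => z; rewrite e z mul0r.
split=> // i e' hi he; apply/eqP; rewrite -subr_eq0; apply/eqP.
have ueps : uniq epsA2_assoc by [].
have fa : falpha f != 0 by [].
by apply: (latrel_zero q0 qroot fa ueps hd _ hi he) => x _; rewrite dE.
Qed.

Lemma A2_target g lam Phi : (3 <= N)%N -> A2 q f g lam Phi ->
  target1 q a N g /\ falpha g != 0.
Proof.
move=> N3 [_ hc h00]; have lamE := lam_const q0 (or_introl erefl) hc.
have he e : e \in epsA2 -> - 1%:Z <= e by rewrite !inE => he; lia.
have [M0|M1] := posnP (fN g); last first.
  have b0 : falpha g != 0.
    apply: (target_alpha_neq0 q0 qroot _ _ hc) => //=; first by lia.
      by move=> e; rewrite !inE => hee; lia.
    by exists 0; rewrite lamE.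
  split=> //.
  have [//|[]] := const_target q0 qroot a0 ga b0 (contiguity_latrel hc) h00
    (fun y _ => lamE y) he (or_introl erefl) N3; by [].
(* a target with a single member: its parameter alpha is irrelevant *)
exfalso; pose g1 : family F := Family (feta g) 1 0.
have hr : latrel q epsA2 f g1 lam Phi.
  have rE i : in_range g1 i = in_range g i by rewrite /in_range M0.
  split=> [i e|i x]; rewrite rE; first by apply: hc.1.
  move=> iN xg; rewrite (contiguity_latrel hc).2 //; apply: eq_big => e.
    by rewrite rE.
  move=> /andP [i0 i1]; have -> : absz (i%:Z + e) = 0%N by rewrite M0 in i1; lia.
  by rewrite !fpoly0.
have [t|[]] := const_target q0 qroot a0 ga (oner_neq0 _ : falpha g1 != 0) hr h00
    (fun y _ => lamE y) he (or_introl erefl) N3; last by [].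
have [k /= e] := target_alpha (or_introl t : target1 q a N g1 \/ target2 q a N g1).
have := qpow_generic q0 ga (qpowX q k) (qpow1 q).
by rewrite mulrC -e eqxx.
Qed.

Lemma A2_complete g lam Phi : (3 <= N)%N -> A2 q f g lam Phi -> g <> f ->
  exists lamp Phip lamm Phim,
     [/\ A2_list q a N g lamp Phip lamm Phim,
         (exists2 c, c != 0 & rescaled c epsA2 N lamp Phip lam Phi) &
         (forall lam' Phi', A2_assoc q f g lam' Phi' ->
          exists2 c, c != 0 &
            rescaled c epsA2_assoc (fN g) lamm Phim lam' Phi')].
Proof.
move=> N3 h gf; have [t b0] := A2_target N3 h.
have N0 : (0 < N)%N by lia.
have [M1 [lamp [Phip [lamm [Phim hl]]]]] : (1 <= fN g)%N /\
    exists lamp Phip lamm Phim, A2_list q a N g lamp Phip lamm Phim.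
  case: t gf => [/(_ erefl) //|_|_|_] /=; split; try lia.
  - by do 4!eexists; exact: qqKI.
  - by do 4!eexists; exact: (qqKII _ _ N0).
  - by do 4!eexists; exact: (qqKIII _ _ N0).
exists lamp, Phip, lamm, Phim; split=> //.
  have [[_ hp _] _ [l0 l00 lE] _] := A2_listP hl.
  exact: (A2_rescaled b0 h hp l00 lE).
move=> lam' Phi' h'.
have [[_ hp _] hm [l0 l00 lE] [u [v [v0 lammE]]]] := A2_listP hl.
apply: (assoc_rescaled _ M1 hp lE (A2_list_coef hl) hm v0 lammE h').
by lia.
Qed.

End A2Relations.

(** * Relations of types B2 and B2' *)
Section Composites.
Variables (F : fieldType) (q a : F) (N : nat).
Hypotheses (q0 : q != 0) (qroot : forall k : nat, (0 < k)%N -> q ^+ k != 1).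
Hypotheses (a0 : a != 0) (ga : forall k : int, a != q ^ k).
Local Notation f := (Family 0 a N).

(** A step whose associated relation has a nonconstant factor. *)
Definition affine_step g h := exists u v, v != 0 /\ step q g h u v.

Lemma affine_stepI eta b M : b != 0 ->
  affine_step (Family eta b M) (Family eta (q * b) M).
Proof.
move=> b0; eexists; eexists; split; last exact: stepI.
by rewrite !mulf_neq0 ?oppr_eq0 // expfz_neq0.
Qed.

Lemma affine_stepII eta b M : b != 0 -> (0 < M)%N ->
  affine_step (Family eta b M) (Family eta (q * b) M.-1).
Proof.
move=> b0 M0; have M1 : 1 - q ^+ M != 0 by rewrite subr_eq0 eq_sym qroot.
eexists; eexists; split; last exact: stepII.
do ?[apply: mulf_neq0 | apply: invr_neq0 | apply: expf_neq0
  | apply: expfz_neq0] => //.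
by rewrite oppr_eq0.
Qed.

Lemma affine_stepIII eta b M : b != 0 -> (0 < M)%N ->
  affine_step (Family eta b M) (Family (eta - 1) b M.-1).
Proof.
move=> b0 M0; have M1 : 1 - q ^+ M != 0 by rewrite subr_eq0 eq_sym qroot.
eexists; eexists; split; last exact: stepIII.
do ?[apply: mulf_neq0 | apply: invr_neq0 | apply: expf_neq0
  | apply: expfz_neq0] => //.
by rewrite oppr_eq0.
Qed.

Lemma affine_forward g h : affine_step g h -> forward q g h.
Proof. by move=> [u [v [_ /step_forward]]]. Qed.

Lemma target_forward g : (3 <= N)%N -> target1 q a N g \/ target2 q a N g ->
  exists2 h, forward q f h & forward q h g.
Proof.
move=> N3; have N0 : (0 < N)%N by lia.
have N1 : (0 < N.-1)%N by lia.
have qa0 : q * a != 0 by rewrite mulf_neq0.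
have fI := affine_forward (affine_stepI 0 N a0).
have fII := affine_forward (affine_stepII 0 a0 N0).
have fIII := affine_forward (affine_stepIII 0 a0 N0).
case=> [] [].
- by exists f; apply: forward_refl.
- by exists f => //; apply: forward_refl.
- by exists f => //; apply: forward_refl.
- by exists f => //; apply: forward_refl.
- by exists (Family 0 (q * a) N) => //; exact: (affine_forward (affine_stepI 0 N qa0)).
- exists (Family 0 (q * a) N) => //.
  exact: (affine_forward (affine_stepII 0 qa0 N0)).
- exists (Family 0 (q * a) N.-1) => //.
  exact: (affine_forward (affine_stepII 0 qa0 N1)).
- exists (Family 0 (q * a) N) => //.
  exact: (affine_forward (affine_stepIII 0 qa0 N0)).
- exists (Family 0 (q * a) N.-1) => //.
  exact: (affine_forward (affine_stepIII 0 qa0 N1)).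
- exists (Family (0 - 1) a N.-1) => //.
  exact: (affine_forward (affine_stepIII (-1) a0 N1)).
Qed.

Lemma B2'_complete g lam Phi : (4 <= N)%N -> (0 < fN g)%N ->
  B2' q f g lam Phi -> B2'_from_A2 q f g lam Phi.
Proof.
move=> N4 M1 [hc [x0 lx0]].
have lamE := lam_const q0 (or_intror erefl) hc.
have c0 : Phi 0 0%N != 0 by rewrite -(lamE x0).
have he e : e \in epsB2' -> - 2%:Z <= e by rewrite !inE => /or3P [] /eqP ->.
have b0 : falpha g != 0.
  apply: (target_alpha_neq0 q0 qroot _ _ hc) => //=; first by lia.
    by move=> e; rewrite !inE => hee; lia.
  by exists x0.
have t : target1 q a N g \/ target2 q a N g.
  have [|[_]] := const_target q0 qroot a0 ga b0 (contiguity_latrel hc) c0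
    (fun y _ => lamE y) he (or_intror erefl) N4; by [left|right].
have [h h1 h2] := target_forward (ltnW N4) t.
have [Phi0 hr0 build] := B2'_pair q0 h1 h2.
apply: (build (Phi 0 0%N)) => // i e hi hee.
have ueps : uniq epsB2' by [].
have hr1 : latrel q epsB2' f g lam (fun e i => Phi 0 0%N * Phi0 e i).
  have [z h3] := latrel_scale (Phi 0 0%N) hr0.
  by split=> // j x hj hx; rewrite -h3 // lamE mulr1.
exact: (latrel_uniq q0 qroot b0 ueps (contiguity_latrel hc) hr1 hi hee).
Qed.

Lemma not_target1 (g : family F) :
  ~ [/\ feta g = 0, falpha g = a & fN g = N] ->
  ~ (feta g = 0 /\ falpha g = q * a) -> ~ (feta g = -1 /\ falpha g = a) ->
  ~ target1 q a N g.
Proof.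
move=> h1 h2 h3 t; case: t h1 h2 h3 => /= h1 h2 h3.
- by apply: h1.
- by apply: h2.
- by apply: h2.
- by apply: h3.
Qed.

Lemma B2_complete g lam Phi : (4 <= N)%N -> (1 < fN g)%N ->
  B2 q f g lam Phi -> g <> f -> B2_from_A2 q f g lam Phi.
Proof.
move=> N4 M2 [hc [x0 lx0]] gf.
have M1 : (0 < fN g)%N by apply: ltnW.
have [u' [v' lamE]] := lam_affine q0 (or_introl erefl) M1 hc.
have hr := contiguity_latrel hc.
have he e : e \in epsB2 -> - 1%:Z <= e by rewrite !inE => /or3P [] /eqP ->.
have b0 : falpha g != 0.
  apply: (target_alpha_neq0 q0 qroot _ _ hc) => //=; first by lia.
    by move=> e; rewrite !inE => hee; lia.
  by exists x0.
have [v0|v0] := eqVneq v' 0.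
  have lamC (x : int) : lam x = u' by rewrite lamE v0 mul0r addr0.
  have u0 : u' != 0 by rewrite -(lamC x0).
  have t : target1 q a N g.
    by have [|[]] := const_target q0 qroot a0 ga b0 hr u0
      (fun y _ => lamC y) he (or_introl erefl) (ltnW N4).
  have hf : forward q f g.
    have N0 : (0 < N)%N by lia.
    case: t gf => [/(_ erefl) //|_|_|_].
    - exact: (affine_forward (affine_stepI 0 N a0)).
    - exact: (affine_forward (affine_stepII 0 a0 N0)).
    - exact: (affine_forward (affine_stepIII 0 a0 N0)).
  have [Phi0 hr0 build] := B2_pair q0 hf (step_refl q g).
  apply: (build u') => //.
    by move=> x; rewrite lamC mul0r addr0 mulr1.
  move=> i e hi hee; have ueps : uniq epsB2 by [].
  have hr1 : latrel q epsB2 f g lam (fun e i => u' * Phi0 e i).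
    have [z h3] := latrel_scale u' hr0.
    by split=> // j x hj hx; rewrite -h3 // lamC mul0r addr0 mulr1.
  exact: (latrel_uniq q0 qroot b0 ueps hr hr1 hi hee).
(* In each case below h is f, or f moved by I, II or III, and g is moved to h by
   I, II or III. *)
have use h : forward q f h -> affine_step g h -> ~ target1 q a N g ->
    B2_from_A2 q f g lam Phi.
  move=> hf [u [v [vn hg]]] nt.
  exact: (B2_nonconstant q0 qroot a0 ga b0 hr lamE v0 hf hg vn nt (ltnW N4)).
have lamW (y : int) : lam y = v' * (q ^ (- y) - - u' / v').
  by rewrite lamE; move: (q ^ (- y)) => z; field.
case: g M2 M1 gf hc hr b0 use => eta b M /= M2 M1 gf hc hr b0 use.
have q1 : q - 1 != 0 by rewrite subr_eq0; apply: (qroot (ltn0Sn 0)).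
have q2 : q ^+ 2 - 1 != 0 by rewrite subr_eq0; apply: (qroot (ltn0Sn 1)).
have qa : q * a <> a.
  move/eqP; rewrite -subr_eq0 -{2}[a]mul1r -mulrBl mulf_eq0.
  by rewrite (negbTE q1) (negbTE a0).
have aq : a / q <> a by move=> e; apply: qa; rewrite -[in LHS]e mulrC mulfVK.
have aqq : a / q <> q * a.
  move=> e; have : a * (q ^+ 2 - 1) = 0.
    transitivity (q * (q * a - a / q)); first by field.
    by rewrite e subrr mulr0.
  by move/eqP; rewrite mulf_eq0 (negbTE q2) (negbTE a0).
have eta0 : q ^ eta = 1 -> eta = 0 by move=> h; apply: (qeta_eq q0 qroot h).
have eta1 : q ^ eta = q -> eta = 1 by move=> h; apply: (qeta_eq q0 qroot h).
have etaN : q ^ eta = q^-1 -> eta = -1 by move=> h; apply: (qeta_eq q0 qroot h).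
have M0E : q ^- M = q ^- N -> M = N.
  by move=> h; rewrite -(@qM_eq _ q q0 qroot M N 0) ?addn0 // expr0 mulr1.
have M1E : q ^- M = q ^- N * q -> M = N.-1.
  by move=> h; rewrite -(@qM_eq _ q q0 qroot M N 1) ?addn1 // expr1.
have MVE : q ^- M = q ^- N / q -> M = N.+1 by apply: qM_eqV.
have N0 : (0 < N)%N by lia.
have qaV : q * (a / q) = a by rewrite mulrC mulfVK.
have qa0 : q * a != 0 by rewrite mulf_neq0.
have aq0 : a / q != 0 by rewrite mulf_neq0 // invr_neq0.
have fI := affine_forward (affine_stepI 0 N a0).
have fII := affine_forward (affine_stepII 0 a0 N0).
have fIII := affine_forward (affine_stepIII 0 a0 N0).
have fT := forward_refl q f.
have nt := @not_target1 (Family eta b M).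
case: (affine_classification q0 qroot a0 b0 ga hr v0 (fun y _ => lamW y) he N4 M1).
- move=> [bE wE]; exfalso.
  rewrite bE in hr.
  apply: (degenerate_target q0 qroot a0 ga hr v0 _ N4 M2) => y _.
  by rewrite lamW wE.
- move=> [bE]; case=> [] [tE mE].
  + rewrite (eta1 tE) (MVE mE) bE tE mulfK // in use nt *.
    apply: (use f) => //; first exact: (affine_stepIII 1 a0 (ltn0Sn N)).
    by apply: nt => /= -[].
  + rewrite (eta0 tE) (M0E mE) bE tE mulr1 in use nt *.
    apply: (use f) => //.
      by have := affine_stepI 0 N aq0; rewrite qaV.
    by apply: nt => /= -[].
  + rewrite (eta0 tE) (MVE mE) bE tE mulr1 in use nt *.
    apply: (use f) => //.
      by have := affine_stepII 0 aq0 (ltn0Sn N); rewrite qaV.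
    by apply: nt => /= -[].
- move=> [bE]; case=> [[tE [mE|mE]]|[tE [mE|mE|mE]]|[tE [mE|mE]]].
  + rewrite (eta1 tE) (MVE mE) bE tE [a * q]mulrC in use nt *.
    apply: (use _ fI); first exact: (affine_stepIII 1 qa0 (ltn0Sn N)).
    by apply: nt => /= -[].
  + rewrite (eta1 tE) (M0E mE) bE tE [a * q]mulrC in use nt *.
    apply: (use _ fII); first exact: (affine_stepIII 1 qa0 N0).
    by apply: nt => /= -[].
  + by case: gf; rewrite (eta0 tE) (M0E mE) bE tE mulr1.
  + rewrite (eta0 tE) (MVE mE) bE tE mulr1 in use nt *.
    apply: (use _ fI); first exact: (affine_stepII 0 a0 (ltn0Sn N)).
    apply: nt => /= -[] //; last by move=> _ e; case: qa.
    by move=> _ _; lia.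
  + rewrite (eta0 tE) (M1E mE) bE tE mulr1 in use nt *.
    apply: (use _ fII); first exact: (affine_stepI 0 N.-1 a0).
    apply: nt => /= -[] //; last by move=> _ e; case: qa.
    by move=> _ _; lia.
  + rewrite (etaN tE) (M0E mE) bE tE in use nt *.
    apply: (use _ fIII).
      by have := affine_stepII (-1) aq0 N0; rewrite qaV.
    by apply: nt => /= -[].
  + rewrite (etaN tE) (M1E mE) bE tE in use nt *.
    apply: (use _ fIII).
      by have := affine_stepI (-1) N.-1 aq0; rewrite qaV.
    by apply: nt => /= -[].
Qed.

(** The factor is a combination of 1 and of the factor of I followed by its
associated relation; when one of the two coefficients is 0, the other is
written as the sum of its multiples by q and 1 - q, which are nonzero in every
characteristic. *)
Lemma B2_self lam Phi : (4 <= N)%N -> B2 q f f lam Phi ->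
  exists lam1 Phi1 lam2 Phi2,
    [/\ B2_from_A2 q f f lam1 Phi1, B2_from_A2 q f f lam2 Phi2,
        (forall x, lam x = lam1 x + lam2 x) &
        (forall (i : nat) (e : int), (i <= N)%N -> e \in epsB2 ->
           Phi e i = Phi1 e i + Phi2 e i)].
Proof.
move=> N4 [hc [x0 lx0]]; have N0 : (0 < fN f)%N by rewrite /=; lia.
have [u' [v' lamE]] := lam_affine q0 (or_introl erefl) N0 hc.
have [uI [vI [vn hI]]] := affine_stepI 0 N a0.
have [PhiI rI buildI] := B2_pair q0 (step_forward hI) hI.
have [PhiT rT buildT] := B2_pair q0 (forward_refl q f) (step_refl q f).
pose c := v' / vI; pose k := u' - c * uI.
have lE (x : int) :
    lam x = c * (uI + vI * q ^ (- x)) + k * (1 + 0 * q ^ (- x)).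
  by rewrite lamE /k /c; move: (q ^ (- x)) => y; field.
have PE (i : nat) e : (i <= N)%N -> e \in epsB2 ->
    Phi e i = c * PhiI e i + k * PhiT e i.
  move=> hi he; apply/eqP; rewrite -subr_eq0 opprD addrA; apply/eqP.
  have hd := latrel_sub (latrel_sub (contiguity_latrel hc) (latrel_scale c rI))
    (latrel_scale k rT).
  have ueps : uniq epsB2 by [].
  have fa : falpha f != 0 by [].
  apply: (latrel_zero q0 qroot fa ueps hd _ hi he) => x _.
  by rewrite lE; move: (q ^ (- x)) => y; ring.
have q1 : 1 - q != 0 by rewrite subr_eq0 eq_sym; apply: (qroot (ltn0Sn 0)).
have sI d : d != 0 -> B2_from_A2 q f f (fun x => d * (uI + vI * q ^ (- x)))
    (fun e i => d * PhiI e i) by move=> d0; apply: (buildI d).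
have sT d : d != 0 -> B2_from_A2 q f f (fun x => d * (1 + 0 * q ^ (- x)))
    (fun e i => d * PhiT e i) by move=> d0; apply: (buildT d).
have [cz|c0] := eqVneq c 0; have [kz|k0] := eqVneq k 0.
- by move: lx0; rewrite lE cz kz !mul0r addr0 eqxx.
- do 4!eexists; split; [apply: (sT (k * q)); exact: mulf_neq0
    | apply: (sT (k * (1 - q))); exact: mulf_neq0 | |].
    by move=> x /=; rewrite lE cz mul0r add0r; move: (q ^ (- x)) => y; ring.
  by move=> i e hi he /=; rewrite PE // cz mul0r add0r; ring.
- do 4!eexists; split; [apply: (sI (c * q)); exact: mulf_neq0
    | apply: (sI (c * (1 - q))); exact: mulf_neq0 | |].
    by move=> x /=; rewrite lE kz mul0r addr0; move: (q ^ (- x)) => y; ring.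
  by move=> i e hi he /=; rewrite PE // kz mul0r addr0; ring.
- by do 4!eexists; split; [exact: (sI c)|exact: (sT k)|exact: lE|exact: PE].
Qed.

End Composites.

(* N is generic too: for N <= 2 (A2), resp. N <= 3 (B2, B2'), the family has too
   few members to determine the target parameters and further relations appear.
   For g = f a B2 relation is the three-term recurrence relation up to an additive
   constant in lam; these form a plane, and each is a sum of two relations
   obtained from A2 relations. *)
Theorem mainTheorem11 (F : fieldType) (q alpha : F) (N : nat) :
  generic q alpha ->
  let f := Family 0 alpha N in
  (forall g lamp Phip lamm Phim,
     A2_list q alpha N g lamp Phip lamm Phim ->
     A2 q f g lamp Phip /\ A2_assoc q f g lamm Phim) /\
  ((3 <= N)%N ->
   forall g lam Phi, A2 q f g lam Phi -> g <> f ->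
   exists lamp Phip lamm Phim,
     [/\ A2_list q alpha N g lamp Phip lamm Phim,
         (exists2 c, c != 0 & rescaled c epsA2 N lamp Phip lam Phi) &
         (forall lam' Phi', A2_assoc q f g lam' Phi' ->
          exists2 c, c != 0 &
            rescaled c epsA2_assoc (fN g) lamm Phim lam' Phi')]) /\
  ((4 <= N)%N ->
   forall g lam Phi, fN g \in [:: N; N.-1; N.+1; N.-2; N.+2] ->
     (B2 q f g lam Phi -> g <> f -> B2_from_A2 q f g lam Phi) /\
     (B2 q f g lam Phi -> g = f ->
      exists lam1 Phi1 lam2 Phi2,
        [/\ B2_from_A2 q f f lam1 Phi1, B2_from_A2 q f f lam2 Phi2,
            (forall x, lam x = lam1 x + lam2 x) &
            (forall (i : nat) (e : int), (i <= N)%N -> e \in epsB2 ->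
               Phi e i = Phi1 e i + Phi2 e i)]) /\
     (B2' q f g lam Phi -> B2'_from_A2 q f g lam Phi)).
Proof.
move=> [q0 qroot a0 ga] f; split.
  by move=> g lamp Phip lamm Phim /(A2_listP q0 qroot a0) [? ?].
split; first by move=> N3 g lam Phi; apply: A2_complete.
move=> N4 g lam Phi hM.
have M2 : (1 < fN g)%N by move: hM; rewrite !inE; lia.
split; first exact: B2_complete.
split; last by apply: B2'_complete => //; apply: ltnW.
by move=> h gf; move: h; rewrite gf; apply: B2_self.
Qed.
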